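(* Let $X$ be a complementably minimal Banach space such that $X$ has a complemented subspace isomorphic to $X \oplus X$. Then $X$ has the SHAI property. In particular, Schlumprecht's arbitrarily distortable Banach space $\mathbf{S}$ has the SHAI property.
   Context: All Banach spaces are over $\mathbb{C}$. For a Banach space $X$, $\mathcal{B}(X)$ denotes the algebra of bounded linear operators on $X$. Isomorphic means linearly homeomorphic. A Banach space $X$ is called complementably minimal if every closed, infinite-dimensional subspace of $X$ contains a subspace which is complemented in $X$ and isomorphic to $X$. A Banach space $X$ has the SHAI property (Surjective Homomorphisms Are Injective) if for every non-zero Banach space $Y$, every surjective algebra homomorphism $\psi: \mathcal{B}(X) \rightarrow \mathcal{B}(Y)$ (a linear multiplicative map; continuity is not assumed) is injective. Schlumprecht's space $\mathbf{S}$ is the completion of the space $c_{00}$ of finitely supported scalar sequences on $\mathbb{N}$ with respect to the unique norm satisfying the implicit equation $$\Vert x \Vert = \max\left\lbrace \Vert x \Vert_{\infty}, \ \sup \left\lbrace \frac{1}{\log_2(1+n)} \sum_{i=1}^n \Vert E_i x \Vert : \ n \geq 2, \ E_1 < E_2 < \cdots < E_n \right\rbrace \right\rbrace \quad (x \in c_{00}),$$ where the $E_i$ are finite subsets of $\mathbb{N}$, $E_i < E_{i+1}$ means $\max E_i < \min E_{i+1}$, and $E_i x$ is the sequence which coincides with $x$ on $E_i$ and is zero elsewhere. *)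

(* Defs.v *)
From HB Require Import structures.
From mathcomp Require Import all_boot all_order all_algebra finmap complex.
From mathcomp Require Import all_classical all_reals all_analysis.

Set Implicit Arguments.
Unset Strict Implicit.
Unset Printing Implicit Defensive.

Import Order.TTheory GRing.Theory Num.Theory.
Import numFieldNormedType.Exports.

Local Open Scope classical_set_scope.
Local Open Scope ring_scope.

(** ** The algebra of bounded linear operators *)

Definition bounded_linear (K : numFieldType) (X : normedModType K)
  : {pred X -> X} :=
  fun f => `[< linear f /\ exists M : K, forall x, `|f x| <= M * `|x| >].

Section BoundedLinear.
Variables (K : numFieldType) (X : normedModType K).

Lemma bounded_linear_submod_closed : submod_closed (@bounded_linear K X).
Proof.
split=> [|a f g /asboolP[lf [M Mf]] /asboolP[lg [N Ng]]]; apply/asboolP; split.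
- by move=> b x y /=; rewrite scaler0 addr0.
- by exists 0 => x /=; rewrite normr0 mul0r.
- move=> b x y; rewrite !fctE lf lg !scalerDr !scalerA (mulrC a b) -!addrA.
  by congr (_ + _); rewrite addrCA.
- exists (`|a| * M + N) => x; rewrite mulrDl -mulrA.
  apply: le_trans (ler_normD _ _) _; apply: lerD => //.
  by rewrite normrZ; apply: ler_wpM2l.
Qed.

HB.instance Definition _ := GRing.isSubmodClosed.Build K (X -> X)
  (@bounded_linear K X) bounded_linear_submod_closed.

Lemma bounded_linear_id : id \in @bounded_linear K X.
Proof. by apply/asboolP; split=> //; exists 1 => x; rewrite mul1r. Qed.

Lemma bounded_linear_comp (f g : X -> X) :
  f \in @bounded_linear K X -> g \in @bounded_linear K X ->
  f \o g \in @bounded_linear K X.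
Proof.
move=> /asboolP[lf [M Mf]] /asboolP[lg [N Ng]]; apply/asboolP; split.
  by move=> a x y /=; rewrite lg lf.
have [[x0 x0_neq0]|X0] := pselect (exists x : X, x != 0); last first.
  have X0' (x : X) : x = 0.
    by apply/eqP/negPn/negP => x_neq0; apply: X0; exists x.
  by exists 0 => x; rewrite (X0' ((f \o g) x)) normr0 mul0r.
have M_ge0 : 0 <= M.
  rewrite -(pmulr_lge0 _ (_ : 0 < `|x0|)) ?normr_gt0//.
  exact: le_trans (normr_ge0 _) (Mf x0).
exists (M * N) => x /=; apply: le_trans (Mf _) _.
by rewrite -mulrA; apply: ler_wpM2l.
Qed.

End BoundedLinear.

Record bounded_operator (K : numFieldType) (X : normedModType K) :=
  BoundedOperator {
    bop_fun :> X -> X;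
    bop_funP : bop_fun \in @bounded_linear K X }.

Notation "'B(' X )" := (bounded_operator X)
  (at level 0, format "'B(' X )") : type_scope.

Section OperatorAlgebra.
Variables (K : numFieldType) (X : normedModType K).

HB.instance Definition _ := [isSub for @bop_fun K X].
HB.instance Definition _ := [Choice of B(X) by <:].
HB.instance Definition _ := [SubChoice_isSubLmodule of B(X) by <:].

Definition bop_one : B(X) := BoundedOperator (bounded_linear_id X).
Definition bop_mul (f g : B(X)) : B(X) :=
  BoundedOperator (bounded_linear_comp (bop_funP f) (bop_funP g)).

Let bop_linear (f : B(X)) : linear f.
Proof. by have /asboolP[] := bop_funP f. Qed.

Let bop_mulA : associative bop_mul. Proof. by move=> f g h; exact: val_inj. Qed.
Let bop_mul1l : left_id bop_one bop_mul.
Proof. by move=> f; exact: val_inj. Qed.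
Let bop_mul1r : right_id bop_one bop_mul.
Proof. by move=> f; exact: val_inj. Qed.
Let bop_mulDl : left_distributive bop_mul +%R.
Proof. by move=> f g h; exact: val_inj. Qed.
Let bop_mulDr : right_distributive bop_mul +%R.
Proof.
move=> f g h; apply: val_inj; apply/funext => x /=.
by have := bop_linear f 1 (g x) (h x); rewrite !scale1r.
Qed.

HB.instance Definition _ := GRing.Zmodule_isPzRing.Build B(X)
  bop_mulA bop_mul1l bop_mul1r bop_mulDl bop_mulDr.

(* B(X) is not declared as an [algType], which would require 1 != 0: this fails
   for X = 0. *)
Lemma bop_scalerAl (a : K) (f g : B(X)) : a *: (f * g) = (a *: f) * g.
Proof. exact: val_inj. Qed.
Lemma bop_scalerAr (a : K) (f g : B(X)) : a *: (f * g) = f * (a *: g).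
Proof.
apply: val_inj; apply/funext => x /=.
have f0 : f 0 = 0.
  by have := bop_linear f 1 0 0; rewrite !scale1r addr0 -[LHS]addr0 => /addrI.
by have := bop_linear f a (g x) 0; rewrite f0 !addr0.
Qed.

End OperatorAlgebra.

(** ** Subspaces, complementation and isomorphism *)

Section Subspaces.
Variables (K : numFieldType) (X : normedModType K).

Definition is_subspace (V : set X) : Prop :=
  V 0 /\ forall (a : K) u v, V u -> V v -> V (a *: u + v).

Definition finite_dimensional (V : set X) : Prop :=
  exists n (e : 'I_n -> X),
    V = [set v | exists c : 'I_n -> K, v = \sum_(i < n) c i *: e i].

Definition complemented (W : set X) : Prop :=
  exists P : B(X), P * P = P /\ range P = W.

(* The map [inv] is only relevant on W, where it is the inverse of [T]. *)
Definition isomorphic_to_subspace (Z : normedModType K) (W : set X) : Prop :=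
  exists (T : {linear Z -> X}) (inv : X -> Z),
    [/\ continuous T, range T = W, cancel T inv & {within W, continuous inv}].

End Subspaces.

Definition complementably_minimal (K : numFieldType)
    (X : completeNormedModType K) : Prop :=
  forall V : set X, closed V -> is_subspace V -> ~ finite_dimensional V ->
    exists W : set X,
      [/\ W `<=` V, complemented W & isomorphic_to_subspace X W].

(* Homomorphisms are not required to be unital. *)
Definition SHAI (K : numFieldType) (X : completeNormedModType K) : Prop :=
  forall Y : completeNormedModType K, (exists y : Y, y != 0) ->
  forall psi : {linear B(X) -> B(Y)},
    {morph psi : f g / f * g} -> (forall g, exists f, psi f = g) ->
    injective psi.

(** ** Schlumprecht's space *)

Definition finitely_supported (C : nzRingType) : {pred nat -> C^o} :=
  fun x => `[< finite_set [set k | x k != 0] >].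

Section FiniteSupport.
Variable C : nzRingType.

Lemma finitely_supported_submod_closed :
  submod_closed (@finitely_supported C).
Proof.
split=> [|a x y /asboolP fx /asboolP fy]; apply/asboolP.
  by rewrite (_ : [set _ | _] = set0)// -subset0 => k /=; rewrite eqxx.
apply: (@sub_finite_set _ _ ([set k | x k != 0] `|` [set k | y k != 0])).
  move=> k /=; rewrite !fctE => xyk; apply/orP; move: xyk.
  by apply: contraNT; rewrite negb_or !negbK => /andP[/eqP-> /eqP->];
    rewrite scaler0 addr0.
by rewrite finite_setU.
Qed.

HB.instance Definition _ := GRing.isSubmodClosed.Build C (nat -> C^o)
  (@finitely_supported C) finitely_supported_submod_closed.

End FiniteSupport.

Record c00 (C : nzRingType) := FinSupp {
  c00_fun :> nat -> C^o;
  c00_funP : c00_fun \in @finitely_supported C }.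

Section C00.
Variable C : nzRingType.

HB.instance Definition _ := [isSub for @c00_fun C].
HB.instance Definition _ := [Choice of c00 C by <:].
HB.instance Definition _ := [SubChoice_isSubLmodule of c00 C by <:].

Lemma c00_restrict_subproof (E : {fset nat}) (x : c00 C) :
  (fun k => if k \in E then x k else 0) \in @finitely_supported C.
Proof.
have /asboolP fx := c00_funP x; apply/asboolP; apply: sub_finite_set fx => k /=.
by case: ifP => // _; rewrite eqxx.
Qed.

Definition c00_restrict (E : {fset nat}) (x : c00 C) : c00 C :=
  FinSupp (c00_restrict_subproof E x).

End C00.

Section Schlumprecht.
Variable R : realType.

(* The norm of a normed space over R[i] takes its values in R[i]; they are
   nonnegative reals, so taking the real part only changes their type. *)
Definition rnorm (V : normedModType R[i]) (v : V) : R := complex.Re `|v|.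

Definition is_norm (N : c00 R[i] -> R) : Prop :=
  [/\ forall x y, N (x + y) <= N x + N y,
      forall (a : R[i]) x, N (a *: x) = rnorm (a : R[i]^o) * N x &
      forall x, N x = 0 -> x = 0].

Definition log2 (t : R) : R := ln t / ln 2.

(* Nonempty finite sets E_0 < E_1 < ... < E_(n-1). *)
Definition successive (n : nat) (E : 'I_n -> {fset nat}) : Prop :=
  (forall i, E i != fset0) /\
  (forall i j : 'I_n, j = i.+1 :> nat ->
     forall a b, a \in E i -> b \in E j -> (a < b)%N).

(* The equation is stated in \bar R, so that no finiteness of the suprema is
   presupposed. *)
Definition schlumprecht_equation (N : c00 R[i] -> R) : Prop :=
  forall x : c00 R[i],
    (N x)%:E = Order.max
      (ereal_sup [set (rnorm (x k))%:E | k in [set: nat]])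
      (ereal_sup [set s : \bar R |
         exists n (E : 'I_n -> {fset nat}),
           [/\ (2 <= n)%N, successive E &
             s = ((log2 (1 + n%:R))^-1
                  * \sum_(i < n) N (c00_restrict (E i) x))%:E]]).

Definition is_completion (N : c00 R[i] -> R) (S : completeNormedModType R[i])
    : Prop :=
  exists iota : {linear c00 R[i] -> S},
    (forall x, rnorm (iota x) = N x) /\ dense (range iota).

(* Schlumprecht's space is determined up to isometric isomorphism. *)
Definition is_schlumprecht_space (S : completeNormedModType R[i]) : Prop :=
  exists N : c00 R[i] -> R,
    [/\ is_norm N, schlumprecht_equation N & is_completion N S].

End Schlumprecht.

(* Main.v *)
Require Import Defs.
From HB Require Import structures.
From mathcomp Require Import all_boot all_order all_algebra finmap complex.
From mathcomp Require Import all_classical all_reals all_analysis.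
From mathcomp Require Import ring lra zify.

Import numFieldNormedType.Exports.

Local Open Scope classical_set_scope.
Local Open Scope ring_scope.

Set Implicit Arguments.
Unset Strict Implicit.
Unset Printing Implicit Defensive.

Import Order.TTheory GRing.Theory Num.Theory.

(** For the first part, let psi : B(X) -> B(Y) be a surjective homomorphism with
    a nonzero kernel. The kernel is an ideal, so it contains all operators of
    finite rank. Lift an idempotent p of rank one on Y to an operator A on X.
    The identity of Y does not factor through p, for otherwise Y would be a line
    and B(Y) commutative, whereas psi carries two orthogonal copies of X inside X
    to orthogonal factorizations of the identity of Y; hence the identity of X
    does not factor through A. Because X is complementably minimal, this makes A
    strictly singular (strictly_singular_or_factors). Then 1 - A is a Fredholm
    operator of index zero, by homotopy along 1 - t A
    (strictly_singular_index_zero), hence it has a left inverse modulo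
    operators of finite rank. Applying psi, 1 - p has a left inverse, and
    (1 - p) p = 0 gives p = 0, which is absurd.

    For the second part, write f(n) = log2 (1 + n) and let e_k be the unit
    vectors. An induction on the support shows that the norm decreases when each
    of a family of successive pieces of a vector is replaced by a single
    coordinate of at most its norm (comparison, block_comparison). So every
    normalized block sequence dominates (e_k), and its span is the range of a
    projection as soon as it is also dominated by (e_k). The latter is false for
    general blocks, but holds for averages: if x_k behaves like a unit vector of
    l_1 under partitions into fewer than M_k sets, where f(M_k) exceeds the
    total size of the preceding blocks, then (x_k) is dominated by (e_k)
    (block_domination). Indeed, consider a partition E_1 < ... < E_m that
    maximizes the sum of the norms of the E_j z, divided by f(m), for
    z = sum_k b_k x_k. Blocks with M_k <= m contribute a bounded multiple of the
    norm of their coefficients. Of the other blocks, those cut by the partition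
    contribute at most 4 |b_k| each, and those contained in E_j form a vector
    y_j. By maximality, refining the partition inside the E_j cannot pay; this
    makes the contribution of the y_j normed by partitions of weight less than
    4 f(m) negligible. The remaining y_j are treated by induction, at the cost of
    an error of the order of f(m)^(-1/2); as f(m) increases at least fourfold
    from one stage to the next, these errors are summable (node_bound,
    head_tail_bound).

    An argument of James yields such averages among the sums of any normalized
    block sequence (average_exists), and sliding humps yield them close to any
    subspace of infinite dimension. A small perturbation then gives a
    complemented copy of the space in the subspace, so the space is
    complementably minimal. It is isomorphic to its square, because spreading
    the coordinates along the even or along the odd integers is isometric
    (spread_le, schlumprecht_square), so the first part applies. *)

(** * Real norms and completeness *)

Section RealNorm.
Variable R : realType.
Local Notation C := R[i].

Section Base.
Variable V : normedModType C.
Implicit Types x y : V.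

Lemma rnormE x : `|x| = (rnorm x)%:C%C.
Proof. by rewrite /rnorm RRe_real// normr_real. Qed.

Lemma rnorm_ge0 x : 0 <= rnorm x.
Proof. by rewrite -ler0c -rnormE. Qed.

Lemma rnormD x y : rnorm (x + y) <= rnorm x + rnorm y.
Proof. by rewrite -lecR rmorphD /= -!rnormE; exact: ler_normD. Qed.

Lemma rnormN x : rnorm (- x) = rnorm x.
Proof. by rewrite /rnorm normrN. Qed.

Lemma rnormB x y : rnorm (x - y) <= rnorm x + rnorm y.
Proof. by rewrite -(rnormN y); exact: rnormD. Qed.

Lemma rdistC x y : rnorm (x - y) = rnorm (y - x).
Proof. by rewrite -rnormN opprB. Qed.

Lemma rnorm0 : rnorm (0 : V) = 0.
Proof. by rewrite /rnorm normr0. Qed.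

Lemma rnorm_eq0 x : (rnorm x == 0) = (x == 0).
Proof. by rewrite -(normr_eq0 x) rnormE -(inj_eq (@complexI R)). Qed.

Lemma rnorm_gt0 x : (0 < rnorm x) = (x != 0).
Proof. by rewrite lt_def rnorm_eq0 rnorm_ge0 andbT. Qed.

Lemma rnormZ (a : C) x : rnorm (a *: x) = rnorm (a : C^o) * rnorm x.
Proof.
apply: (@complexI R); rewrite rmorphM /= -!rnormE normrZ.
by congr (_ * _).
Qed.

Lemma rdist_tri x y z : rnorm (x - z) <= rnorm (x - y) + rnorm (y - z).
Proof. by rewrite -[x - z](subrKA y); exact: rnormD. Qed.

Lemma rnorm_sub_ge x y : rnorm x - rnorm y <= rnorm (x - y).
Proof. by rewrite lerBlDr -{1}(subrK y x); exact: rnormD. Qed.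

Lemma rnorm_sum (I : Type) (s : seq I) (P : pred I) (F : I -> V) :
  rnorm (\sum_(i <- s | P i) F i) <= \sum_(i <- s | P i) rnorm (F i).
Proof.
elim/big_rec2: _ => [|i b a _ ab]; first by rewrite rnorm0.
by apply: le_trans (rnormD _ _) _; rewrite lerD2l.
Qed.

End Base.

Lemma rnorm_real (a : R) : rnorm (a%:C%C : C^o) = `|a|.
Proof. by rewrite /rnorm normc_def /= expr0n /= addr0 sqrtr_sqr. Qed.

Lemma rnormM (a b : C) : rnorm (a * b : C^o) = rnorm (a : C^o) * rnorm (b : C^o).
Proof. exact: (rnormZ a (b : C^o)). Qed.

Lemma rnorm1 : rnorm (1 : C^o) = 1.
Proof. by rewrite (rnorm_real 1) normr1. Qed.

Lemma rnormV (a : C) : rnorm (a^-1 : C^o) = (rnorm (a : C^o))^-1.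
Proof.
have [->|a0] := eqVneq a 0; first by rewrite invr0 (@rnorm0 C^o) invr0.
have ra0 : rnorm (a : C^o) != 0 by rewrite (@rnorm_eq0 C^o).
by apply: (mulfI ra0); rewrite -rnormM !mulfV// rnorm1.
Qed.

Lemma Re_le_rnorm (a : C) : complex.Re a <= rnorm (a : C^o).
Proof.
apply: le_trans (ler_norm _) _; rewrite -lecR.
apply: le_trans (normc_ge_Re a) _.
by rewrite (_ : `|a| = `|a : C^o|)// rnormE.
Qed.

End RealNorm.

Section Topology.
Variable R : realType.
Local Notation C := R[i].

Lemma gt0_complexE (e : C) : 0 < e -> exists2 d : R, 0 < d & e = d%:C%C.
Proof.
move=> e0; exists (complex.Re e); last first.
  by rewrite RRe_real// gtr0_real.
by move: e0; rewrite ltcE/= => /andP[].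
Qed.

Lemma ball_rnormE (V : normedModType C) (x y : V) (d : R) :
  ball x d%:C%C y <-> rnorm (x - y) < d.
Proof. by rewrite -ball_normE /ball_ /= rnormE ltcR. Qed.

Lemma nbhs_rnormP (V : normedModType C) (x : V) (A : set V) :
  nbhs x A <-> exists2 d : R, 0 < d & forall y, rnorm (x - y) < d -> A y.
Proof.
split=> [/nbhs_ballP[e /= /gt0_complexE[d d0 ->] sA]|[d d0 sA]].
  by exists d => // y xy; apply: sA; apply/ball_rnormE.
apply/nbhs_ballP; exists d%:C%C; first by rewrite /= ltcR.
by move=> y /ball_rnormE; exact: sA.
Qed.

Lemma closure_rnormP (V : normedModType C) (A : set V) (x : V) :
  closure A x <-> forall d : R, 0 < d -> exists2 a, A a & rnorm (a - x) < d.
Proof.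
split=> [cA d d0|H B /nbhs_rnormP[d d0 sB]].
  have [|a [Aa xa]] := cA [set y | rnorm (x - y) < d].
    by apply/nbhs_rnormP; exists d.
  by exists a => //; rewrite rdistC.
have [a Aa xa] := H d d0; exists a; split=> //.
by apply: sB; rewrite rdistC.
Qed.

Lemma closed_rnorm (V : normedModType C) (A : set V) (x : V) : closed A ->
  (forall d : R, 0 < d -> exists2 a, A a & rnorm (a - x) < d) -> A x.
Proof.
move=> cA H; have -> : A = closure A by apply/closure_id.
exact/closure_rnormP.
Qed.

Lemma dense_rnorm (V : normedModType C) (A : set V) (x : V) (d : R) :
  dense A -> 0 < d -> exists2 a, A a & rnorm (a - x) < d.
Proof.
move=> dA d0.
have [|a [Ba Aa]] := dA ((ball x d%:C%C)^°) _ (@open_interior _ _).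
  by exists x; apply/nbhs_rnormP; exists d => // y /ball_rnormE.
exists a => //; rewrite rdistC; apply/ball_rnormE.
exact: interior_subset Ba.
Qed.

Lemma geometric_small (K d : R) : 0 < d -> exists n, K / 2 ^+ n < d.
Proof.
move=> d0; exists (Num.truncn (`|K| / d)).+1.
apply: le_lt_trans (_ : `|K| / 2 ^+ (Num.truncn (`|K| / d)).+1 < _).
  by rewrite ler_wpM2r ?invr_ge0 ?exprn_ge0// ler_norm.
rewrite ltr_pdivrMr ?exprn_gt0// mulrC -ltr_pdivrMr//.
apply: lt_trans (truncnS_gt _) _.
by rewrite -natrX ltr_nat ltn_expl.
Qed.

(** Completeness enters only in this form: the explicit error makes norm
    estimates survive passing to the limit. *)
Lemma geometric_limit (V : completeNormedModType C) (u : nat -> V) (K : R) :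
  (forall n, rnorm (u n.+1 - u n) <= K / 2 ^+ n) ->
  exists l, forall n, rnorm (u n - l) <= 2 * K / 2 ^+ n.
Proof.
move=> uK.
have K0 : 0 <= K by have := le_trans (rnorm_ge0 _) (uK 0%N); rewrite expr0 divr1.
have uB n k : rnorm (u (n + k)%N - u n) <= 2 * K / 2 ^+ n - 2 * K / 2 ^+ (n + k).
  elim: k => [|k IH]; first by rewrite addn0 !subrr rnorm0.
  have := le_trans (rdist_tri (u (n + k.+1)%N) (u (n + k)%N) (u n))
    (lerD _ IH); rewrite addnS => /(_ _ (uK _)) => H; apply: le_trans H _.
  rewrite exprS invfM; set t := (2 ^+ (n + k))^-1.
  by rewrite le_eqVlt; apply/orP; left; apply/eqP; field.
have uC n k : rnorm (u (n + k)%N - u n) <= 2 * K / 2 ^+ n.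
  by apply: le_trans (uB n k) _; rewrite gerBl divr_ge0 ?exprn_ge0 ?mulr_ge0.
have cu : cauchy (u @ \oo).
  apply: cauchy_exP => _ /gt0_complexE[d d0 ->].
  have [n nd] := geometric_small (2 * K) d0; exists (u n).
  suff: \forall m \near \oo, ball (u n) d%:C%C (u m) by [].
  exists n => // m /= nm; apply/ball_rnormE; rewrite rdistC.
  by rewrite -(subnKC nm); apply: le_lt_trans (uC _ _) nd.
have /cauchy_cvgP/cvg_ex[l ul] := cu.
exists l => n; apply/ler_addgt0Pr => e e0.
have /ul : nbhs l [set y | rnorm (l - y) < e] by apply/nbhs_rnormP; exists e.
move=> [m _ /(_ (maxn m n) (leq_maxl _ _))] /= H.
apply: le_trans (rdist_tri _ (u (maxn m n)) _) _; apply: lerD.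
  by rewrite rdistC -(subnKC (leq_maxr m n)).
by rewrite rdistC ltW.
Qed.

Lemma bounded_continuous (V W : normedModType C) (g : V -> W) (M : R) :
  (forall x y, g (x - y) = g x - g y) -> (forall x, rnorm (g x) <= M * rnorm x) ->
  continuous g.
Proof.
move=> gB gM x A /nbhs_rnormP[d d0 dA]; apply/nbhs_rnormP.
have M1 : 0 < `|M| + 1 by rewrite ltr_wpDl.
exists (d / (`|M| + 1)); first by rewrite divr_gt0.
move=> y xy; apply: dA; rewrite -gB; apply: le_lt_trans (gM _) _.
apply: (@le_lt_trans _ _ ((`|M| + 1) * rnorm (x - y))).
  by rewrite ler_wpM2r ?rnorm_ge0// (le_trans (ler_norm _))// lerDl.
by rewrite mulrC -ltr_pdivlMr.
Qed.

Lemma rnorm_pair_ge (V W : normedModType C) (z : (V * W)%type) :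
  rnorm z.1 <= rnorm z /\ rnorm z.2 <= rnorm z.
Proof.
rewrite -!lecR -!rnormE; split; case: z => z1 z2 /=; rewrite prod_normE /=;
  by rewrite comparable_le_max ?lexx ?orbT// real_comparable.
Qed.

Lemma rnorm_pair_le (V W : normedModType C) (x : V) (y : W) :
  rnorm ((x, y) : (V * W)%type) <= rnorm x + rnorm y.
Proof.
rewrite -lecR rmorphD /= -!rnormE prod_normE /= comparable_ge_max ?real_comparable//.
by rewrite lerDl lerDr !normr_ge0.
Qed.

End Topology.

(** * The Hahn-Banach theorem *)

Section HahnBanach.
Variables (R : realType) (V : normedModType R[i]).
Local Notation C := R[i].
Implicit Types (x y : V) (p q : V -> R).

Definition sublinear p :=
  (forall x y, p (x + y) <= p x + p y) /\
  (forall (t : R) x, 0 <= t -> p (t%:C%C *: x) <= t * p x).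

Lemma sublinear0 p : sublinear p -> p 0 = 0.
Proof.
move=> [pD pZ]; apply/eqP; rewrite eq_le; apply/andP; split.
  by have := pZ 0 0 (lexx _); rewrite scale0r mul0r.
by have := pD 0 0; rewrite addr0 -{1}[p 0]addr0 lerD2l.
Qed.

Lemma sublinear_homogeneous p (t : R) x :
  sublinear p -> 0 <= t -> p (t%:C%C *: x) = t * p x.
Proof.
move=> sp; have [_ pZ] := sp; rewrite le_eqVlt => /predU1P[<-|t0].
  by rewrite scale0r mul0r sublinear0.
apply/eqP; rewrite eq_le pZ ?(ltW t0)//=.
have := pZ t^-1 (t%:C%C *: x); rewrite scalerA -rmorphM /= mulVf ?gt_eqF//.
by rewrite scale1r invr_ge0 (ltW t0) => /(_ isT); rewrite ler_pdivlMl//.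
Qed.

Lemma sublinearN p x : sublinear p -> - p (- x) <= p x.
Proof.
move=> sp; have [pD _] := sp.
have := pD x (- x); rewrite subrr sublinear0// => H.
by rewrite -subr_ge0 opprK.
Qed.

Lemma rnorm_sublinear : sublinear (@rnorm R V).
Proof.
split=> [x y|t x t0]; first exact: rnormD.
by rewrite rnormZ rnorm_real ger0_norm.
Qed.

(** The two hypotheses on indices hold both for a chain of functions ordered
    pointwise and for the translates that occur below, so the same infimum
    serves for the upper bound required by Zorn's lemma and for the
    minimality argument. *)
Lemma sublinear_inf (I : Type) (A : set I) (F : I -> V -> R) (q : V -> R) :
  A !=set0 ->
  (forall i x, A i -> - q x <= F i x) ->
  (forall i j, A i -> A j -> exists2 k, A k &
     forall x y, F k (x + y) <= F i x + F j y) ->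
  (forall i s, A i -> 0 <= s -> exists2 k, A k &
     forall x, F k (s%:C%C *: x) <= s * F i x) ->
  let r x := inf [set F i x | i in A] in
  sublinear r /\ forall i x, A i -> r x <= F i x.
Proof.
move=> [i0 Ai0] Fq FD FZ r.
have rle i x : A i -> r x <= F i x.
  move=> Ai; apply: ge_inf; last by exists i.
  by exists (- q x) => _ [j Aj <-]; exact: Fq.
have lerinf x (c : R) : (forall i, A i -> c <= F i x) -> c <= r x.
  move=> H; apply: lb_le_inf; first by exists (F i0 x); exists i0.
  by move=> _ [j Aj <-]; exact: H.
split=> //; split=> [x y|s x s0].
  rewrite -lerBlDr; apply: (lerinf) => i Ai; rewrite lerBlDr [F i x + _]addrC -lerBlDr.
  apply: (lerinf) => j Aj; rewrite lerBlDr [F j y + _]addrC.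
  by have [k Ak Fk] := FD i j Ai Aj; apply: le_trans (rle k _ Ak) (Fk x y).
move: s0; rewrite le_eqVlt => /predU1P[<-|s0].
  rewrite scale0r mul0r; have [k Ak Fk] := FZ i0 0 Ai0 (lexx _).
  by apply: le_trans (rle k _ Ak) _; have := Fk 0; rewrite scaler0 mul0r.
rewrite -ler_pdivrMl//; apply: (lerinf) => i Ai; rewrite ler_pdivrMl//.
by have [k Ak Fk] := FZ i s Ai (ltW s0); apply: le_trans (rle k _ Ak) (Fk x).
Qed.

(** This lowers p at - y as far as sublinearity permits, namely to - p y. *)
Lemma sublinear_lower p y : sublinear p ->
  exists r, [/\ sublinear r, forall x, r x <= p x &
    forall x, r x <= p (x + y) - p y].
Proof.
move=> sp; have [pD pZ] := sp.
pose F (t : R) x := p (x + t%:C%C *: y) - t * p y.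
have [| | | |] := @sublinear_inf R [set t | 0 <= t] F (fun x => p (- x)).
- by exists 0 => /=.
- move=> t x /= t0; rewrite /F lerBrDr -(sublinear_homogeneous y sp t0).
  by rewrite addrC lerBlDr; apply: le_trans (pD _ _); rewrite addrAC subrr add0r.
- move=> s t /= s0 t0; exists (s + t); first exact: addr_ge0.
  move=> x z; rewrite /F rmorphD /= scalerDl mulrDl.
  have := pD (x + s%:C%C *: y) (z + t%:C%C *: y); rewrite addrACA.
  by move: (p (x + z + _)) (p (x + _)) (p (z + _)) => a b c; lra.
- move=> t s /= t0 s0; exists (s * t); first exact: mulr_ge0.
  move=> x; rewrite /F rmorphM /= -scalerA -scalerDr.
  have := pZ s (x + t%:C%C *: y) s0.
  by move: (p _) (p _) => a b; rewrite mulrBr mulrA lerD2r.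
move=> sr rF; eexists; split; first exact: sr.
  move=> x; apply: le_trans (rF 0 x _) _ => /=; first exact: lexx.
  by rewrite /F scale0r addr0 mul0r subr0.
move=> x; apply: le_trans (rF 1 x _) _ => /=; first exact: ler01.
by rewrite /F scale1r mul1r.
Qed.

Lemma minimal_sublinear q : sublinear q -> exists p,
  [/\ sublinear p, forall x, p x <= q x &
    forall r, sublinear r -> (forall x, r x <= p x) -> r = p].
Proof.
move=> sq; pose T := {p | sublinear p /\ forall x, p x <= q x}.
pose le (a b : T) := `[< forall x, sval b x <= sval a x >].
have [| | | |[p [sp pq]] pmin] := @Zorn T le.
- by move=> t; apply/asboolP.
- move=> r s t /asboolP rs /asboolP st; apply/asboolP => x.
  exact: le_trans (st x) (rs x).
- move=> [s s'] [t t'] /asboolP /= st /asboolP /= ts; apply: eq_exist => /=.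
  by apply/funext => x; apply/eqP; rewrite eq_le st ts.
- move=> A Atot; have [A0|nA0] := pselect (A !=set0); last first.
    have qq : sublinear q /\ forall x, q x <= q x by [].
    exists (exist _ q qq) => s As.
    by exfalso; apply: nA0; exists s.
  have [||||] := @sublinear_inf T A (fun p : T => sval p) (fun x => q (- x)) => //.
  + move=> [p [sp pq]] x _ /=; apply: le_trans (sublinearN _ sp).
    by rewrite lerN2.
  + move=> r s Ar As; have [/asboolP rs|/asboolP sr] := Atot r s Ar As.
      exists s => // x y; have [[sD _] _] := svalP s.
      by apply: le_trans (sD _ _) _; rewrite lerD2r.
    exists r => // x y; have [[rD _] _] := svalP r.
    by apply: le_trans (rD _ _) _; rewrite lerD2l.
  + move=> r s Ar s0; exists r => // x; have [[_ rZ] _] := svalP r.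
    exact: rZ.
  set r := (fun x => inf _); move=> sr rA.
  have rq x : r x <= q x.
    have [a Aa] := A0; apply: le_trans (rA a x Aa) _.
    by have [_] := svalP a; exact.
  by exists (exist _ r (conj sr rq)) => s As; apply/asboolP => x /=; exact: rA.
exists p; split=> // r sr rp.
have rq x : r x <= q x by apply: le_trans (rp x) (pq x).
have := pmin (exist _ r (conj sr rq)) => /(_ _)/(congr1 sval) /= -> //.
exact/asboolP.
Qed.

(** A minimal sublinear function cannot be lowered at any point by
    sublinear_lower, which makes it additive. *)
Lemma real_functional q : sublinear q -> exists g : V -> R,
  [/\ forall x y, g (x + y) = g x + g y,
      forall (t : R) x, g (t%:C%C *: x) = t * g x & forall x, g x <= q x].
Proof.
move=> /minimal_sublinear[p [sp pq pmin]]; have [pD _] := sp.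
have gD x y : p (x + y) = p x + p y.
  apply/eqP; rewrite eq_le pD /=.
  have [r [sr rp ry]] := sublinear_lower y sp.
  by have := ry x; rewrite (pmin r sr rp) lerBrDr.
exists p; split=> // t x; have [t0|/ltW t0] := leP 0 t.
  exact: sublinear_homogeneous.
apply/eqP; rewrite -subr_eq0 -[t in t * _]opprK mulNr opprK.
rewrite -sublinear_homogeneous ?oppr_ge0// -gD -scalerDl -rmorphD /= subrr.
by rewrite scale0r sublinear0.
Qed.

End HahnBanach.

Definition functional (R : realType) (V : normedModType R[i]) (phi : V -> R[i]) :=
  (forall (a : R[i]) u v, phi (a *: u + v) = a * phi u + phi v) /\
  exists M : R, forall x, rnorm (phi x : R[i]^o) <= M * rnorm x.

Section Functional.
Variables (R : realType) (V : normedModType R[i]).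
Local Notation C := R[i].

Section Theory.
Variables (phi : V -> C) (phiF : functional phi).
Lemma functionalD u v : phi (u + v) = phi u + phi v.
Proof. by have [/(_ 1 u v)] := phiF; rewrite scale1r mul1r. Qed.
Lemma functional0 : phi 0 = 0.
Proof. by have := functionalD 0 0; rewrite addr0 => /esym/eqP; rewrite -subr_eq0 addrK => /eqP. Qed.
Lemma functionalZ a u : phi (a *: u) = a * phi u.
Proof. by have [/(_ a u 0)] := phiF; rewrite functional0 !addr0. Qed.
Lemma functionalN u : phi (- u) = - phi u.
Proof. by rewrite -scaleN1r functionalZ mulN1r. Qed.
Lemma functionalB u v : phi (u - v) = phi u - phi v.
Proof. by rewrite functionalD functionalN. Qed.
Lemma functional_sum (I : Type) (s : seq I) (P : pred I) (F : I -> V) :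
  phi (\sum_(i <- s | P i) F i) = \sum_(i <- s | P i) phi (F i).
Proof. by rewrite (big_morph _ functionalD functional0). Qed.
End Theory.

(** The complex functional is recovered from its real part g by
    phi x = g x - i g (i x), and rotating x makes phi x real, so that the bound
    on g carries over. *)
Lemma norming_functional (y : V) : y != 0 -> exists2 phi : V -> C,
  functional phi & phi y = 1 /\
  forall x, rnorm (phi x : C^o) <= rnorm x / rnorm y.
Proof.
move=> y0.
(* Lowering the norm at - y first forces g y = rnorm y. *)
have [q [sq qp qy]] := sublinear_lower y (@rnorm_sublinear R V).
have [g [gD gZ gq]] := real_functional sq.
have gN x : g (- x) = - g x.
  by have := gZ (-1) x; rewrite rmorphN1 scaleN1r mulN1r.
have gp x : g x <= rnorm x by apply: le_trans (gq x) (qp x).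
have gy : g y = rnorm y.
  apply/eqP; rewrite eq_le gp /= -lerN2 -gN; apply: le_trans (gq _) _.
  by have := qy (- y); rewrite addNr rnorm0 sub0r.
pose f x : C := Complex (g x) (- g ('i%C *: x)).
have fD u v : f (u + v) = f u + f v.
  by rewrite /f scalerDr !gD opprD.
have fR (t : R) u : f (t%:C%C *: u) = t%:C%C * f u.
  rewrite /f scalerA mulrC -scalerA !gZ; apply/eqP.
  by rewrite eq_complex /= !mul0r subr0 addr0 mulrN !eqxx.
have fI u : f ('i%C *: u) = 'i%C * f u.
  rewrite /f scalerA (_ : 'i%C * 'i%C = -1); last by rewrite -expr2 sqr_i.
  rewrite scaleN1r gN; apply/eqP.
  by rewrite eq_complex /= !mul0r !mul1r !add0r !opprK !eqxx.
have fZ a u : f (a *: u) = a * f u.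
  rewrite {1}[a]complexE scalerDl fD fR -scalerA fI fR mulrA -mulrDl.
  by rewrite -complexE.
have fle x : rnorm (f x : C^o) <= rnorm x.
  have [->|fx0] := eqVneq (f x) 0; first by rewrite (@rnorm0 R C^o) rnorm_ge0.
  set c : R := rnorm (f x : C^o).
  have c0 : 0 < c by rewrite (@rnorm_gt0 R C^o).
  pose u : C := c%:C%C / f x.
  have : f (u *: x) = c%:C%C by rewrite fZ /u divfK.
  move=> /(congr1 (@complex.Re R)) /= <-; apply: le_trans (gp _) _.
  by rewrite rnormZ /u rnormM rnorm_real gtr0_norm// rnormV mulfV ?mul1r ?gt_eqF.
have ry0 : 0 < rnorm y by rewrite rnorm_gt0.
have fy : f y != 0.
  apply/eqP => /(congr1 (@complex.Re R)) /= H.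
  by move: ry0; rewrite -gy H ltxx.
have fyr : rnorm y <= rnorm (f y : C^o).
  by rewrite -gy; exact: (Re_le_rnorm (f y)).
exists (fun x => f x / f y); first split.
- by move=> a u v; rewrite fD fZ mulrDl mulrA.
- exists (rnorm y)^-1 => x; rewrite rnormM rnormV mulrC.
  apply: ler_pM => //; first by rewrite invr_ge0 (@rnorm_ge0 R C^o).
    exact: (@rnorm_ge0 R C^o).
  by rewrite lef_pV2 ?posrE// (@rnorm_gt0 R C^o).
split; first by rewrite mulfV.
move=> x; rewrite rnormM rnormV; apply: ler_pM => //.
- exact: (@rnorm_ge0 R C^o).
- by rewrite invr_ge0 (@rnorm_ge0 R C^o).
- by rewrite lef_pV2 ?posrE// (@rnorm_gt0 R C^o).
Qed.

End Functional.

(** * Bounded operators and perturbation of invertibility *)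

Section Operators.
Variable R : realType.
Local Notation C := R[i].

Section Basics.
Variable X : normedModType C.
Implicit Types (S T : B(X)) (x y : X).

Lemma bop_ext S T : (forall x, S x = T x) -> S = T.
Proof. by move=> ST; apply: val_inj; apply/funext => x; exact: ST. Qed.

Lemma bopP T (a : C) x y : T (a *: x + y) = a *: T x + T y.
Proof. by have /asboolP[TL _] := bop_funP T; exact: TL. Qed.

Lemma bopD T x y : T (x + y) = T x + T y.
Proof. by rewrite -[x]scale1r bopP !scale1r. Qed.

Lemma bop0 T : T 0 = 0.
Proof. by apply: (addrI (T 0)); rewrite -bopD !addr0. Qed.

Lemma bopZ T (a : C) x : T (a *: x) = a *: T x.
Proof. by rewrite -[a *: x]addr0 bopP bop0 addr0. Qed.

Lemma bopN T x : T (- x) = - T x.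
Proof. by rewrite -scaleN1r bopZ scaleN1r. Qed.

Lemma bopB T x y : T (x - y) = T x - T y.
Proof. by rewrite bopD bopN. Qed.

Lemma bop_sum T (I : Type) (s : seq I) (P : pred I) (F : I -> X) :
  T (\sum_(i <- s | P i) F i) = \sum_(i <- s | P i) T (F i).
Proof. by rewrite (big_morph _ (bopD T) (bop0 T)). Qed.

Lemma bop_bound T : exists2 M : R, 0 <= M &
  forall x, rnorm (T x) <= M * rnorm x.
Proof.
have /asboolP[_ [M MT]] := bop_funP T.
exists `|complex.Re M| => // x.
have [->|x0] := eqVneq x 0; first by rewrite bop0 !rnorm0 mulr0.
have := MT x; rewrite !rnormE => H.
have {}H : rnorm (T x) <= complex.Re M * rnorm x.
  move: H; rewrite lecE => /andP[_].
  by case: (M) => a b /=; rewrite mulr0 subr0.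
by apply: le_trans H _; rewrite ler_wpM2r ?rnorm_ge0// ler_norm.
Qed.

Lemma bop_continuous T : continuous T.
Proof.
have [M _ MT] := bop_bound T.
by apply: (bounded_continuous _ MT) => x y; exact: bopB.
Qed.

Lemma bop_exists (f : X -> X) :
  (forall (a : C) x y, f (a *: x + y) = a *: f x + f y) ->
  (exists M : R, forall x, rnorm (f x) <= M * rnorm x) ->
  exists T : B(X), forall x, T x = f x.
Proof.
move=> fl [M Mf].
have fb : f \in @bounded_linear C X.
  apply/asboolP; split=> //; exists M%:C%C => x.
  by rewrite !rnormE -rmorphM /= lecR.
by exists (BoundedOperator fb).
Qed.

(** The case distinction makes rank_one u phi an operator for every function
    phi, so that a proof of functional phi is needed only to evaluate it. *)
Lemma rank_one_subproof (u : X) (phi : X -> C) :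
  (fun x => (if `[< functional phi >] then phi x else 0) *: u)
    \in @bounded_linear C X.
Proof.
apply/asboolP; case: asboolP => [phiF|_]; last first.
  split=> [a x y|]; first by rewrite !scale0r scaler0 addr0.
  by exists 0 => x; rewrite scale0r normr0 mul0r.
split=> [a x y|]; first by rewrite functionalD// functionalZ// scalerDl scalerA.
have [_ [M Mphi]] := phiF; exists (M * rnorm u)%:C%C => x.
rewrite !rnormE -rmorphM /= lecR rnormZ mulrAC ler_wpM2r ?rnorm_ge0//.
Qed.

Definition rank_one (u : X) (phi : X -> C) : B(X) :=
  BoundedOperator (rank_one_subproof u phi).

Lemma rank_oneE u phi x : functional phi -> rank_one u phi x = phi x *: u.
Proof. by move=> phiF /=; rewrite asboolT. Qed.

Lemma functional_comp phi T : functional phi -> functional (phi \o T).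
Proof.
move=> phiF; split=> [a u v /=|].
  by rewrite bopD bopZ functionalD// functionalZ.
have [_ [M Mphi]] := phiF; have [N N0 NT] := bop_bound T.
exists (`|M| * N) => x /=; apply: le_trans (Mphi _) _.
apply: (@le_trans _ _ (`|M| * rnorm (T x))).
  by rewrite ler_wpM2r ?rnorm_ge0// ler_norm.
by rewrite -mulrA ler_wpM2l.
Qed.

Definition invertible T := exists S, S * T = 1 /\ T * S = 1.

Lemma invertibleM S T : invertible S -> invertible T -> invertible (S * T).
Proof.
move=> [S' [S'S SS']] [T' [T'T TT']]; exists (T' * S'); split.
  by rewrite mulrA -(mulrA T') S'S mulr1.
by rewrite mulrA -(mulrA S) TT' mulr1.
Qed.

Lemma invertible_bijective T (c : R) : 0 < c ->
  (forall x, c * rnorm x <= rnorm (T x)) ->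
  (forall y, exists x, T x = y) -> invertible T.
Proof.
move=> c0 cT surT; have [g gP] := choice surT.
have injT x y : T x = T y -> x = y.
  move=> Txy; apply/eqP; rewrite -subr_eq0 -rnorm_eq0 eq_le rnorm_ge0 andbT.
  by have := cT (x - y); rewrite bopB Txy subrr rnorm0 pmulr_rle0.
have [||G GP] := @bop_exists g.
- by move=> a x y; apply: injT; rewrite bopP !gP.
- by exists c^-1 => y; rewrite ler_pdivlMl// -{2}(gP y).
exists G; split; apply: bop_ext => x /=; last by rewrite GP gP.
by apply: injT; rewrite GP gP.
Qed.

End Basics.

Section Neumann.
Variable X : completeNormedModType C.
Implicit Types (S T : B(X)) (x y : X).

Lemma neumann (K : B(X)) :
  (forall x, rnorm (K x) <= 2^-1 * rnorm x) -> invertible (1 - K).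
Proof.
move=> Ksmall.
have below x : 2^-1 * rnorm x <= rnorm ((1 - K) x).
  have := rnorm_sub_ge x (K x); rewrite (_ : x - K x = (1 - K) x)//.
  by have := Ksmall x; move: (rnorm _) (rnorm _) (rnorm _) => a b c; lra.
apply: (invertible_bijective (c := 2^-1)) => // y.
pose u n := iter n (fun x => y + K x) y.
have uS n : u n.+1 = y + K (u n) by [].
have [|l ul] := @geometric_limit R X u (rnorm y / 2).
  elim=> [|n IH]; first by rewrite uS /u/= addrAC subrr add0r expr0 divr1 mulrC.
  rewrite uS [u n.+1]uS opprD addrACA subrr add0r -bopB.
  apply: le_trans (Ksmall _) _; rewrite exprS invfM mulrCA.
  by rewrite ler_wpM2l.
exists l; apply/eqP; rewrite -subr_eq0 -rnorm_eq0 eq_le rnorm_ge0 andbT.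
apply/ler_addgt0Pr => e e0; rewrite add0r.
have [n ne] := geometric_small (2 * rnorm y) e0.
have -> : (1 - K) l - y = (l - u n.+1) + K (u n - l).
  by rewrite (_ : (1 - K) l = l - K l)// uS bopB opprD !addrA subrK addrAC.
apply: le_trans (rnormD _ _) _; apply: le_trans (ltW ne).
have H1 := ul n.+1; have H2 := ul n; have H3 := Ksmall (u n - l).
rewrite [rnorm (l - _)]rdistC.
move: H1 H2 H3; rewrite exprS invfM mulrCA [2 * (_ / 2)]mulrC divfK//.
move: (rnorm (u n.+1 - l)) (rnorm (u n - l)) (rnorm (K _)) => a b c.
have : 0 <= rnorm y / 2 ^+ n by rewrite divr_ge0 ?rnorm_ge0 ?exprn_ge0.
by rewrite -(mulrA 2 (rnorm y)); move: (rnorm y / _) => d; lra.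
Qed.

Lemma invertible_near T : invertible T -> exists2 e : R, 0 < e &
  forall S, (forall x, rnorm (S x - T x) <= e * rnorm x) -> invertible S.
Proof.
move=> [T' [T'T TT']]; have [M M0 MT'] := bop_bound T'.
exists ((M + 1)^-1 / 2) => [|S ST].
  by rewrite divr_gt0// invr_gt0 ltr_wpDl.
have -> : S = T * (1 - T' * (T - S)).
  by rewrite mulrBr mulr1 mulrA TT' mul1r subKr.
apply: invertibleM; first by exists T'.
apply: neumann => x; apply: le_trans (MT' ((T - S) x)) _.
have := ST x; rewrite rdistC => {}ST.
rewrite (_ : (T - S) x = T x - S x)//.
apply: (@le_trans _ _ ((M + 1) * ((M + 1)^-1 / 2 * rnorm x))).
  by apply: ler_pM => //; rewrite ?rnorm_ge0// lerDl.
by rewrite !mulrA divff ?mul1r// gt_eqF// ltr_wpDl.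
Qed.

End Neumann.

End Operators.

(** * Fredholm operators of index zero *)

Section FredholmIndexZero.
Variable R : realType.
Local Notation C := R[i].
Variable X : completeNormedModType C.
Implicit Types (S T V : B(X)) (x y : X).

(** Invertible operators minus operators of finite rank are exactly the
    Fredholm operators of index zero; in this form their stability under
    perturbations that are small or of finite rank is immediate. *)
Definition index_zero T := exists r (u : 'I_r -> X) (phi : 'I_r -> X -> C) V,
  [/\ forall i, functional (phi i), invertible V &
      forall x, T x = V x - \sum_i phi i x *: u i].

Lemma index_zero_rank_one T w phi : functional phi ->
  index_zero (T + rank_one w phi) -> index_zero T.
Proof.
move=> phiF [r [u [psi [V [psiF iV TV]]]]].
exists r.+1, (fun i => oapp u w (unlift ord0 i)),
  (fun i => oapp psi phi (unlift ord0 i)), V; split=> //.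
  by move=> i; case: unliftP => [j|] _ /=.
move=> x; rewrite big_ord_recl unlift_none /=.
under eq_bigr do rewrite liftK /=.
rewrite opprD addrCA -TV -(rank_oneE w x phiF).
by rewrite (_ : (T + _) x = T x + rank_one w phi x)// addrC addrK.
Qed.

Lemma index_zero_near T V : index_zero V -> exists2 e : R, 0 < e &
  forall S, (forall x, rnorm (S x - V x) <= e * rnorm x) -> index_zero S.
Proof.
move=> [r [u [phi [W [phiF iW VW]]]]]; have [e e0 eW] := invertible_near iW.
exists e => // S SV; exists r, u, phi, (W + (S - V)); split=> //.
  apply: eW => x; rewrite (_ : (W + (S - V)) x = W x + (S x - V x))//.
  by rewrite addrAC subrr add0r.
move=> x; rewrite (_ : (W + (S - V)) x = W x + (S x - V x))//.
by rewrite addrAC -VW addrC subrK.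
Qed.

(** Solving T x = y reduces to a square linear system, whose matrix is either
    invertible or has both a left and a right kernel; a vector in the left
    kernel yields a functional vanishing on the range of T. *)
Lemma index_zero_alternative T : index_zero T ->
  ((forall x, T x = 0 -> x = 0) /\ (forall y, exists x, T x = y)) \/
  ((exists2 x, T x = 0 & x != 0) /\ exists y, forall x, T x <> y).
Proof.
move=> [r [u [phi [V [phiF [W [WV VW]] TV]]]]].
have WVx x : W (V x) = x by rewrite -[LHS]/((W * V) x) WV.
have VWx x : V (W x) = x by rewrite -[LHS]/((V * W) x) VW.
pose M : 'M[C]_r := \matrix_(i, j) ((i == j)%:R - phi i (W (u j))).
have ME (c : 'cV[C]_r) i :
    (M *m c) i 0 = c i 0 - phi i (W (\sum_j c j 0 *: u j)).
  rewrite mxE bop_sum functional_sum//.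
  under eq_bigr do rewrite mxE mulrBl.
  rewrite sumrB (bigD1 i)//= eqxx mul1r big1 ?addr0; last first.
    by move=> j ji; rewrite eq_sym (negbTE ji) mul0r.
  congr (_ - _); apply: eq_bigr => j _.
  by rewrite bopZ functionalZ// mulrC.
have [uM|nM] := boolP (M \in unitmx); [left|right]; split.
- move=> x Tx.
  have Vx : V x = \sum_i phi i x *: u i.
    by apply/eqP; rewrite -subr_eq0 -TV Tx.
  pose c : 'cV[C]_r := \col_i phi i x.
  have Mc : M *m c = 0.
    apply/colP => i; rewrite ME !mxE; under eq_bigr do rewrite mxE.
    by rewrite -Vx WVx subrr.
  have c0 : c = 0 by rewrite -[c](mulKmx uM) Mc mulmx0.
  rewrite -(WVx x) Vx big1 ?bop0// => i _.
  by have /colP/(_ i) := c0; rewrite !mxE => ->; rewrite scale0r.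
- move=> y; pose b : 'cV[C]_r := \col_i phi i (W y).
  pose c := invmx M *m b; pose x := W (y + \sum_j c j 0 *: u j).
  exists x; rewrite TV VWx (_ : \sum_i _ = \sum_j c j 0 *: u j) ?addrK//.
  apply: eq_bigr => i _; congr (_ *: _).
  have Mc : (M *m c) i 0 = phi i (W y) by rewrite mulKVmx// mxE.
  have /eqP := ME c i; rewrite Mc eq_sym subr_eq => /eqP ->.
  by rewrite /x bopD functionalD.
- have [c c0 Mc] : exists2 c : 'cV[C]_r, c != 0 & M *m c = 0.
    have : kermx M^T != 0 by rewrite kermx_eq0 row_free_unit unitmx_tr.
    case/rowV0Pn => d /sub_kermxP dM d0; exists d^T.
      by rewrite -(inj_eq trmx_inj) trmxK trmx0.
    by apply: trmx_inj; rewrite trmx_mul trmxK dM trmx0.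
  pose x := W (\sum_j c j 0 *: u j).
  have cx i : phi i x = c i 0.
    have := ME c i; rewrite Mc (_ : (0 : 'cV[C]_r) i 0 = 0); last by rewrite mxE.
    by move=> /esym/eqP; rewrite subr_eq0 => /eqP ->.
  exists x; last first.
    apply: contra_neq c0 => x0; apply/colP => i.
    by rewrite -cx x0 functional0// mxE.
  rewrite TV VWx; apply/eqP; rewrite subr_eq0; apply/eqP.
  by apply: eq_bigr => i _; rewrite cx.
- have : kermx M != 0 by rewrite kermx_eq0 row_free_unit.
  case/rowV0Pn => d /sub_kermxP dM d0.
  pose chi x := \sum_i d 0 i * phi i (W x).
  have chiu j : chi (u j) = d 0 j.
    have /rowP/(_ j) := dM; rewrite !mxE.
    under eq_bigr do rewrite mxE mulrBr.
    rewrite sumrB (bigD1 j)//= eqxx mulr1 big1 ?addr0; last first.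
      by move=> i ij; rewrite (negbTE ij) mulr0.
    by move=> /eqP; rewrite subr_eq0 => /eqP.
  have chiB x y : chi (x - y) = chi x - chi y.
    rewrite /chi -sumrB; apply: eq_bigr => i _.
    by rewrite bopB functionalB// mulrBr.
  have chiZ (I : finType) (a : I -> C) (v : I -> X) :
      chi (\sum_i a i *: v i) = \sum_i a i * chi (v i).
    rewrite /chi; under [RHS]eq_bigr do rewrite big_distrr /=.
    rewrite exchange_big; apply: eq_bigr => i _ /=.
    rewrite bop_sum functional_sum// big_distrr /=; apply: eq_bigr => j _.
    by rewrite bopZ functionalZ// mulrCA.
  have chiT x : chi (T x) = 0.
    rewrite TV chiB chiZ {1}/chi; under eq_bigr do rewrite WVx.
    apply/eqP; rewrite subr_eq0; apply/eqP; apply: eq_bigr => i _.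
    by rewrite chiu mulrC.
  have [j dj] : exists j, d 0 j != 0.
    apply/existsP; apply: contra_neqT d0; rewrite negb_exists => /forallP H.
    by apply/rowP => j; rewrite mxE; apply/eqP; have := H j; rewrite negbK.
  exists (u j) => x Txu; move/eqP: dj; apply.
  by rewrite -chiu -Txu chiT.
Qed.

Lemma range_closed T (Z : set X) (c : R) : 0 < c ->
  (forall x y, Z x -> Z y -> Z (x - y)) -> closed Z ->
  (forall x, Z x -> c * rnorm x <= rnorm (T x)) ->
  forall y, (forall d : R, 0 < d -> exists2 z, Z z & rnorm (T z - y) < d) ->
  exists2 z, Z z & T z = y.
Proof.
move=> c0 ZB cZ cT y yT.
have /choice[z zP] n : exists z, Z z /\ rnorm (T z - y) < 2^-1 ^+ n.
  by have [|z] := yT (2^-1 ^+ n); [rewrite exprn_gt0|exists z].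
have {zP} [zZ zy] : (forall n, Z (z n)) /\ forall n, rnorm (T (z n) - y) < 2^-1 ^+ n.
  by split=> n; have [] := zP n.
have [|l zl] := @geometric_limit R X z (2 / c).
  move=> n; have := cT _ (ZB _ _ (zZ n.+1) (zZ n)); rewrite bopB => H.
  rewrite -[leRHS]mulrAC ler_pdivlMr// mulrC; apply: le_trans H _.
  apply: le_trans (rdist_tri _ y _) _; rewrite [rnorm (y - _)]rdistC.
  have := zy n; have := zy n.+1; rewrite exprS exprVn.
  have : 0 < (2 ^+ n : R)^-1 by rewrite invr_gt0 exprn_gt0.
  by move: (_^-1) (rnorm _) (rnorm _) => a b b'; lra.
exists l.
  apply: closed_rnorm => // d d0; have [n nd] := geometric_small (2 * (2 / c)) d0.
  by exists (z n) => //; apply: le_lt_trans (zl n) nd.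
apply/eqP; rewrite -subr_eq0 -rnorm_eq0 eq_le rnorm_ge0 andbT.
apply/ler_addgt0Pr => e e0; rewrite add0r.
have [M M0 MT] := bop_bound T.
have [n ne] := geometric_small (M * (2 * (2 / c)) + 1) e0.
apply: le_trans (ltW ne); rewrite mulrDl.
apply: le_trans (rdist_tri _ (T (z n)) _) _; apply: lerD.
  rewrite -bopB; apply: le_trans (MT _) _; rewrite -mulrA ler_wpM2l// rdistC.
  exact: zl.
by rewrite mul1r -exprVn ltW.
Qed.

(** Being triangular is all that survives from biorthogonality, and it can be
    obtained one vector at a time. *)
Definition triangular k (z : nat -> X) (phi : nat -> X -> C) :=
  [/\ forall i, (i < k)%N -> functional (phi i),
      forall i, (i < k)%N -> phi i (z i) = 1 &
      forall i j, (i < j < k)%N -> phi i (z j) = 0].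

Definition common_kernel k (phi : nat -> X -> C) : set X :=
  [set x | forall i, (i < k)%N -> phi i x = 0].

Lemma functional_kernel_closed (phi : X -> C) x : functional phi ->
  (forall d : R, 0 < d -> exists2 a, phi a = 0 & rnorm (a - x) < d) -> phi x = 0.
Proof.
move=> phiF H; have [_ [M Mphi]] := phiF.
apply/eqP; rewrite -(@rnorm_eq0 R C^o) eq_le (@rnorm_ge0 R C^o) andbT.
apply/ler_addgt0Pr => e e0; rewrite add0r.
have [|a a0 ax] := H (e / (`|M| + 1)); first by rewrite divr_gt0// ltr_wpDl.
have := Mphi (x - a); rewrite functionalB// a0 subr0 => /le_trans; apply.
apply: (@le_trans _ _ ((`|M| + 1) * rnorm (x - a))).
  by rewrite ler_wpM2r ?rnorm_ge0// (le_trans (ler_norm _))// lerDl.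
by rewrite mulrC -ler_pdivlMr ?ltr_wpDl// rdistC ltW.
Qed.

Section Kernel.
Variables (k : nat) (z : nat -> X) (phi : nat -> X -> C).
Hypothesis tri : triangular k z phi.

Lemma common_kernelB x y : common_kernel k phi x -> common_kernel k phi y ->
  common_kernel k phi (x - y).
Proof.
have [phiF _ _] := tri => kx ky i ik.
by rewrite (functionalB (phiF _ ik)) kx// ky// subr0.
Qed.

Lemma common_kernel_closed : closed (common_kernel k phi).
Proof.
have [phiF _ _] := tri => x /closure_rnormP cx i ik.
apply: functional_kernel_closed => [|d d0]; first exact: phiF.
by have [a ka ax] := cx d d0; exists a => //; exact: ka.
Qed.

End Kernel.

Lemma triangularS k z phi : triangular k.+1 z phi -> triangular k z phi.
Proof.
move=> [phiF phi1 phi0]; split=> [i ik|i ik|i j /andP[ij jk]].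
- exact/phiF/ltnW.
- exact/phi1/ltnW.
- by apply: phi0; rewrite ij ltnW.
Qed.

(** The image under T of the kernel of k.+1 functionals is closed, so T (z k)
    has positive distance to it. This bounds the coefficient phi k x of z k in
    terms of T x, and then both components of x. *)
Lemma bounded_below_extend k z phi T (c : R) : triangular k.+1 z phi -> 0 < c ->
  (forall x, common_kernel k.+1 phi x -> c * rnorm x <= rnorm (T x)) ->
  (forall x, common_kernel k.+1 phi x -> T x <> T (z k)) ->
  exists2 d : R, 0 < d &
    forall x, common_kernel k phi x -> d * rnorm x <= rnorm (T x).
Proof.
move=> tri c0 cT Tzk; have [phiF phi1 phi0] := tri.
have [e e0 eT] : exists2 e : R, 0 < e &
    forall x, common_kernel k.+1 phi x -> e <= rnorm (T (z k) - T x).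
  apply: contrapT => H.
  have [|||x kx] := @range_closed T (common_kernel k.+1 phi) c c0 _ _ cT (T (z k)).
  - by move=> x y; exact: (common_kernelB tri).
  - exact: (common_kernel_closed tri).
  - move=> d d0; apply: contrapT => H'; apply: H; exists d => // x kx.
    rewrite leNgt; apply/negP => xd; apply: H'; exists x => //.
    by rewrite rdistC.
  - exact: Tzk.
pose a x := phi k x.
have split_x x : common_kernel k phi x -> common_kernel k.+1 phi (x - a x *: z k).
  move=> kx i; rewrite ltnS leq_eqVlt => /predU1P[->|ik].
    by rewrite functionalB ?functionalZ ?phi1 ?mulr1 ?subrr//; exact: phiF.
  have ik1 : (i < k.+1)%N by exact: ltnW.
  rewrite (functionalB (phiF _ ik1)) (functionalZ (phiF _ ik1)) kx// phi0 ?ik//=.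
  by rewrite mulr0 subr0.
have ea x : common_kernel k phi x -> e * rnorm (a x : C^o) <= rnorm (T x).
  move=> kx; have [->|ax0] := eqVneq (a x) 0.
    by rewrite (@rnorm0 R C^o) mulr0 rnorm_ge0.
  have ra0 : 0 < rnorm (a x : C^o) by rewrite (@rnorm_gt0 R C^o).
  have kx' : common_kernel k.+1 phi (- ((a x)^-1 *: (x - a x *: z k))).
    move=> i ik; rewrite (functionalN (phiF _ ik)) (functionalZ (phiF _ ik)).
    by rewrite split_x// mulr0 oppr0.
  have := eT _ kx'; rewrite bopN opprK bopZ bopB bopZ scalerBr scalerA mulVf//.
  rewrite scale1r addrC subrK rnormZ rnormV mulrC ler_pdivlMr//.
pose D := rnorm (z k) / e + (1 + rnorm (T (z k)) / e) / c + 1.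
have D0 : 0 < D.
  by rewrite ltr_wpDl// addr_ge0// divr_ge0 ?addr_ge0 ?divr_ge0 ?rnorm_ge0// ltW.
exists D^-1; first by rewrite invr_gt0.
move=> x kx; rewrite ler_pdivrMl//.
set t := rnorm (T x); have t0 : 0 <= t by exact: rnorm_ge0.
have at_ : rnorm (a x : C^o) <= t / e.
  by rewrite ler_pdivlMr// mulrC; exact: ea.
have H1 : rnorm (x - a x *: z k) <= (1 + rnorm (T (z k)) / e) / c * t.
  rewrite mulrAC ler_pdivlMr// mulrC; apply: le_trans (cT _ (split_x _ kx)) _.
  rewrite bopB bopZ; apply: le_trans (rnormB _ _) _; rewrite rnormZ -/t mulrDl mul1r.
  by rewrite lerD2l -mulrA [leLHS]mulrC ler_wpM2l ?rnorm_ge0// mulrC.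
have H2 : rnorm (a x *: z k) <= rnorm (z k) / e * t.
  by rewrite rnormZ -mulrA [leLHS]mulrC ler_wpM2l ?rnorm_ge0// mulrC.
rewrite -{1}(subrK (a x *: z k) x); apply: le_trans (rnormD _ _) _.
by rewrite /D 2!mulrDl mul1r addrC -[leLHS]addr0; apply: lerD => //; apply: lerD.
Qed.

(** A limit of index zero operators that is bounded below on a subspace of
    finite codimension is of index zero: perturbing it by operators of rank one
    lowers the codimension, down to the case of an operator bounded below on
    the whole space, which inherits invertibility from its approximations. *)
Lemma index_zero_closed k z phi T (c : R) : triangular k z phi -> 0 < c ->
  (forall x, common_kernel k phi x -> c * rnorm x <= rnorm (T x)) ->
  (forall e : R, 0 < e -> exists2 S, index_zero S &
     forall x, rnorm (S x - T x) <= e * rnorm x) ->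
  index_zero T.
Proof.
elim: k T c => [|k IH] T c tri c0 cT clT.
  (* An approximation S of T is bounded below, hence injective, hence
     invertible since its index is zero. *)
  have {}cT x : c * rnorm x <= rnorm (T x) by apply: cT.
  have [|S iS ST] := clT (c / 4); first by rewrite divr_gt0.
  have cS x : c / 2 * rnorm x <= rnorm (S x).
    have := rnorm_sub_ge (T x) (S x); have := ST x; rewrite rdistC.
    have := cT x; have : 0 <= c * rnorm x by rewrite mulr_ge0 ?rnorm_ge0 ?ltW.
    rewrite ![c / _ * _]mulrAC.
    by move: (rnorm (S x)) (rnorm (T x)) (rnorm (_ - _)) (c * _) => a b d e; lra.
  have injS x : S x = 0 -> x = 0.
    move=> Sx; have := cS x; rewrite Sx rnorm0 pmulr_rle0 ?divr_gt0// => x0.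
    by apply/eqP; rewrite -rnorm_eq0 eq_le x0 rnorm_ge0.
  have [[_ surS]|[[x Sx]]] := index_zero_alternative iS; last first.
    by rewrite (injS x Sx) eqxx.
  have invS : invertible S.
    by apply: (invertible_bijective _ cS surS); rewrite divr_gt0.
  have [S' [S'S SS']] := invS.
  have SS'x x : S (S' x) = x by rewrite -[LHS]/((S * S') x) SS'.
  exists 0%N, (fun=> 0), (fun=> fun=> 0), T; split=> //; first by case.
    have -> : T = S * (1 - S' * (S - T)).
      by rewrite mulrBr mulr1 mulrA SS' mul1r subKr.
    apply: invertibleM => //; apply: neumann => x.
    have := cS (S' ((S - T) x)); rewrite SS'x => H.
    have c2 : 0 < c / 2 by rewrite divr_gt0.
    rewrite -(ler_pM2l c2); apply: le_trans H _; apply: le_trans (ST x) _.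
    by rewrite mulrA ler_wpM2r ?rnorm_ge0//; lra.
  by move=> x; rewrite big_ord0 subr0.
have [phiF phi1 phi0] := tri; have phikF : functional (phi k) by exact: phiF.
have tri' := triangularS tri.
(* If T (z k) lies outside the image of the smaller kernel, then T is bounded
   below on the larger one. Otherwise this is achieved by an operator of rank one
   which moves T (z k) by a vector w outside this image. *)
have [[z' kz' Tz']|Tzk] := pselect (exists2 x, common_kernel k.+1 phi x & T x = T (z k)); last first.
  have [x kx Tx|d d0 dT] := bounded_below_extend tri c0 cT; last exact: IH dT clT.
  by apply: Tzk; exists x.
have [[w wT]|surT] := pselect (exists w, forall x, common_kernel k.+1 phi x -> T x <> w).
  pose T' := T + rank_one w (phi k).
  have T'E x : T' x = T x + phi k x *: w by rewrite -rank_oneE.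
  have T'k x : common_kernel k.+1 phi x -> T' x = T x.
    by move=> kx; rewrite T'E kx// scale0r addr0.
  apply: (index_zero_rank_one phikF (w := w)).
  have [||d d0 dT] := bounded_below_extend (T := T') tri c0.
  - by move=> x kx; rewrite T'k//; exact: cT.
  - move=> x kx; rewrite T'k// T'E phi1// scale1r -Tz' => Tx.
    apply: (wT (x - z')); first exact: (common_kernelB tri).
    by rewrite bopB Tx addrC addKr.
  - apply: IH dT _ => // e e0; have [S iS ST] := clT e e0.
    exists (S + rank_one w (phi k)); last first.
      move=> x; rewrite (_ : (S + _) x = S x + rank_one w (phi k) x)//.
      rewrite (_ : (T + _) x = T x + rank_one w (phi k) x)//.
      by rewrite [T x + _]addrC addrKA.
    apply: (@index_zero_rank_one _ (- w) _ phikF).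
    rewrite (_ : S + _ + _ = S)//; apply: bop_ext => x.
    rewrite (_ : (S + _ + _) x = S x + rank_one w (phi k) x + rank_one (- w) (phi k) x)//.
    by rewrite !rank_oneE// scalerN addrK.
(* The remaining case is impossible: T would be invertible on the common kernel
   of k.+1 functionals, and then so would its approximations S, which have index
   zero and map z k into the image of this kernel. *)
have {}surT y : exists x, common_kernel k.+1 phi x /\ T x = y.
  apply: contrapT => H; apply: surT; exists y => x kx Tx; apply: H.
  by exists x.
have [g gP] := choice surT.
have injT x y : common_kernel k.+1 phi x -> common_kernel k.+1 phi y -> T x = T y -> x = y.
  move=> kx ky Txy; apply/eqP; rewrite -subr_eq0 -rnorm_eq0 eq_le rnorm_ge0 andbT.
  have := cT (x - y) (common_kernelB tri kx ky).
  by rewrite bopB Txy subrr rnorm0 pmulr_rle0.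
have [||G GE] := @bop_exists R X g.
- move=> a x y; apply: injT; first by have [] := gP (a *: x + y).
    have [kgx _] := gP x; have [kgy _] := gP y => i ik.
    have [-> _] := phiF _ ik; rewrite kgx// kgy// mulr0 addr0//.
  by rewrite bopP; have [_ ->] := gP x; have [_ ->] := gP y; have [_ ->] := gP (a *: x + y).
- exists c^-1 => y; rewrite ler_pdivlMl//; have [kg Tg] := gP y.
  by rewrite -{2}Tg; exact: cT.
have kG y : common_kernel k.+1 phi (G y) by rewrite GE; have [] := gP y.
have TG y : T (G y) = y by rewrite GE; have [] := gP y.
have [|S iS ST] := clT (c / 2); first by rewrite divr_gt0.
have [H [_ HG]] : invertible (S * G).
  have -> : S * G = 1 - (T - S) * G.
    apply: bop_ext => y; rewrite mulrBl opprB addrCA (_ : T * G = 1) ?subrr ?addr0//.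
    by apply: bop_ext => x; exact: TG.
  apply: neumann => y; rewrite (_ : ((T - S) * G) y = T (G y) - S (G y))// rdistC.
  apply: le_trans (ST _) _; rewrite mulrAC mulrC ler_wpM2l//.
  by apply: le_trans (cT _ (kG y)) _; rewrite TG.
have SGH y : S (G (H y)) = y by rewrite -[LHS]/((S * G * H) y) HG.
have [[injS _]|[_ [y yS]]] := index_zero_alternative iS; last first.
  by have := yS _ (SGH y).
have zk : z k = G (H (S (z k))).
  by apply/eqP; rewrite -subr_eq0; apply/eqP/injS; rewrite bopB SGH subrr.
have := kG (H (S (z k))) k (ltnSn k); rewrite -zk phi1// => /eqP.
by rewrite oner_eq0.
Qed.

End FredholmIndexZero.

(** * Strictly singular operators *)

Section StrictlySingular.
Variable R : realType.
Local Notation C := R[i].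

Section FiniteDimension.
Variable X : normedModType C.
Implicit Types (V W : set X).

Definition span_of (z : nat -> X) : set X :=
  [set x | exists n (c : nat -> C), x = \sum_(i < n) c i *: z i].

Lemma span_of_subspace z : is_subspace (span_of z).
Proof.
split=> [|a _ _ [m [c ->]] [n [d ->]]].
  by exists 0%N, (fun=> 0); rewrite big_ord0.
exists (maxn m n), (fun i => a * (if (i < m)%N then c i else 0) +
    (if (i < n)%N then d i else 0)).
under [RHS]eq_bigr do rewrite scalerDl -scalerA.
rewrite big_split /= -scaler_sumr; congr (_ *: _ + _).
  rewrite (big_ord_widen _ (fun i => c i *: z i) (leq_maxl m n)) big_mkcond.
  by apply: eq_bigr => i _ /=; case: ifP => //; rewrite scale0r.
rewrite (big_ord_widen _ (fun i => d i *: z i) (leq_maxr m n)) big_mkcond.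
by apply: eq_bigr => i _ /=; case: ifP => //; rewrite scale0r.
Qed.

Lemma mem_span_of z i : span_of z (z i).
Proof.
exists i.+1, (fun j => (j == i)%:R); rewrite big_ord_recr /= eqxx scale1r.
rewrite big1 ?add0r// => j _.
by rewrite (ltn_eqF (ltn_ord j)) scale0r.
Qed.

Lemma closure_subspace V : is_subspace V -> is_subspace (closure V).
Proof.
move=> [V0 VD]; split; first exact: subset_closure.
move=> a u v /closure_rnormP cu /closure_rnormP cv; apply/closure_rnormP => d d0.
set M := rnorm (a : C^o) + 1.
have M0 : 0 < M by rewrite ltr_wpDl// (@rnorm_ge0 R C^o).
have [|u' Vu' uu'] := cu (d / 2 / M); first by rewrite !divr_gt0.
have [|v' Vv' vv'] := cv (d / 2); first by rewrite divr_gt0.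
exists (a *: u' + v'); first exact: VD.
rewrite opprD addrACA -scalerBr; apply: le_lt_trans (rnormD _ _) _.
rewrite rnormZ [d]splitr; apply: ler_ltD => //.
apply: (@le_trans _ _ (M * rnorm (u' - u))).
  by rewrite ler_wpM2r ?rnorm_ge0// lerDl.
by rewrite mulrC -ler_pdivlMr// ltW.
Qed.

Lemma triangular_infinite_dimensional V (z : nat -> X) (phi : nat -> X -> C) :
  (forall k, functional (phi k)) -> (forall i, phi i (z i) = 1) ->
  (forall i j, (i < j)%N -> phi i (z j) = 0) -> (forall i, V (z i)) ->
  ~ finite_dimensional V.
Proof.
move=> phiF phi1 phi0 Vz [n [e VE]].
have /choice[c cP] j : exists c : 'I_n -> C, z j = \sum_i c i *: e i.
  by have := Vz j; rewrite VE.
pose M : 'M[C]_(n.+1, n) := \matrix_(j, i) c j i.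
have : kermx M != 0.
  by rewrite kermx_eq0 /row_free neq_ltn ltnS rank_leq_col.
case/rowV0Pn => d /sub_kermxP dM /eqP; apply.
have dz : \sum_j d 0 j *: z j = 0.
  under eq_bigr do rewrite cP scaler_sumr.
  rewrite exchange_big big1// => i _ /=.
  under eq_bigr do rewrite scalerA; rewrite -scaler_suml.
  have /rowP/(_ i) := dM; rewrite !mxE.
  by under eq_bigr do rewrite mxE; move=> ->; rewrite scale0r.
suff H m (j : 'I_n.+1) : (j < m)%N -> d 0 j = 0.
  by apply/rowP => j; rewrite mxE (H n.+1).
elim: m j => // m IH j; rewrite ltnS leq_eqVlt => /predU1P[jm|]; last exact: IH.
have := congr1 (phi j) dz; rewrite functional0// functional_sum//.
rewrite (bigD1 j)//= functionalZ// phi1 mulr1 big1 ?addr0//.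
move=> i ij; rewrite functionalZ//.
have [ij'|ji|/val_inj] := ltngtP i j; last by move/eqP; rewrite (negbTE ij).
  by rewrite IH ?mul0r// -jm.
by rewrite phi0// mulr0.
Qed.

Lemma image_infinite_dimensional V (T : B(X)) (c : R) : is_subspace V -> 0 < c ->
  (forall x, V x -> c * rnorm x <= rnorm (T x)) ->
  ~ finite_dimensional V -> ~ finite_dimensional [set T x | x in V].
Proof.
move=> [V0 VD] c0 cT Vinf [n [e TVE]]; apply: Vinf.
have VB x y : V x -> V y -> V (x - y).
  by move=> Vx Vy; rewrite addrC -scaleN1r; exact: VD.
have VS m (a : 'I_m -> C) (v : 'I_m -> X) : (forall i, V (v i)) -> V (\sum_i a i *: v i).
  elim: m a v => [|m IH] a v Vv; first by rewrite big_ord0.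
  by rewrite big_ord_recl; apply: VD => //; apply: IH.
have /choice[v vP] i : exists v, V v /\ T v = e i.
  have : [set T x | x in V] (e i).
    rewrite TVE; exists (fun j => (j == i)%:R); rewrite (bigD1 i)//= eqxx scale1r.
    by rewrite big1 ?addr0// => j /negbTE ->; rewrite scale0r.
  by move=> [w Vw <-]; exists w.
exists n, v; apply/seteqP; split=> [x Vx|_ [a ->]]; last first.
  by apply: VS => i; have [] := vP i.
have : [set T x | x in V] (T x) by exists x.
rewrite TVE => -[a Tx]; exists a.
set y := \sum_i _; have Vy : V y by apply: VS => i; have [] := vP i.
have Ty : T y = T x.
  by rewrite Tx bop_sum; apply: eq_bigr => i _; rewrite bopZ; have [_ ->] := vP i.
apply/eqP; rewrite -subr_eq0 -rnorm_eq0 eq_le rnorm_ge0 andbT.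
by have := cT _ (VB _ _ Vx Vy); rewrite bopB Ty subrr rnorm0 pmulr_rle0.
Qed.

End FiniteDimension.

Section Main.
Variable X : completeNormedModType C.
Implicit Types (S T A : B(X)) (x y : X).

Definition strictly_singular A := forall (V : set X) (c : R), closed V ->
  is_subspace V -> ~ finite_dimensional V -> 0 < c ->
  ~ forall x, V x -> c * rnorm x <= rnorm (A x).

(** Otherwise one could choose a triangular sequence of unit vectors on which
    1 - a A tends to 0 so fast that 1 - a A is small on their closed span,
    which makes A bounded below there. The coefficients of a unit vector of the
    span grow at most like 2 ^ n, so a rate of 4 ^ - n suffices. *)
Lemma strictly_singular_bounded_below A (a : C) : strictly_singular A ->
  exists k z phi (c : R), [/\ triangular k z phi, 0 < c &
    forall x, common_kernel k phi x -> c * rnorm x <= rnorm ((1 - a *: A) x)].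
Proof.
move=> ssA; set T := 1 - a *: A.
pose good (s : seq (X * (X -> C))) (p : X * (X -> C)) :=
  [/\ rnorm p.1 = 1, functional p.2 /\ p.2 p.1 = 1,
      forall x, rnorm (p.2 x : C^o) <= rnorm x,
      forall i, (i < size s)%N -> (nth (0, fun=> 0) s i).2 p.1 = 0 &
      rnorm (T p.1) <= 4^-1 / 4 ^+ (size s)].
have /choice[F FP] (s : seq (X * (X -> C))) :
    exists p, (exists p', good s p') -> good s p.
  have [[p gp]|ng] := pselect (exists p, good s p); first by exists p.
  by exists (0, fun=> 0).
pose s := fix s n := if n is m.+1 then rcons (s m) (F (s m)) else [::].
have ss n : size (s n) = n by elim: n => //= n IH; rewrite size_rcons IH.
have sn n i : (i < n)%N -> nth (0, fun=> 0) (s n) i = F (s i).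
  elim: n => // n IH; rewrite ltnS leq_eqVlt /= nth_rcons ss => /predU1P[->|ni].
    by rewrite ltnn eqxx.
  by rewrite ni IH.
pose z n := (F (s n)).1; pose phi n := (F (s n)).2.
have gP n : good (s n) (F (s n)) -> [/\ rnorm (z n) = 1, functional (phi n) /\ phi n (z n) = 1,
    forall x, rnorm (phi n x : C^o) <= rnorm x,
    forall i, (i < n)%N -> phi i (z n) = 0 & rnorm (T (z n)) <= 4^-1 / 4 ^+ n].
  move=> [z1 phi1 phile phi0 Tz]; split=> //; last by rewrite -[in leRHS](ss n).
  by move=> i ni; have := phi0 i; rewrite ss sn// => /(_ ni).
have tri n : (forall i, (i < n)%N -> good (s i) (F (s i))) -> triangular n z phi.
  move=> g; split=> [i ni|i ni|i j /andP[ij jn]].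
  - by have [_ []] := gP i (g i ni).
  - by have [_ []] := gP i (g i ni).
  - by have [_ _ _ + _] := gP j (g j jn); apply.
(* If the construction stops at a stage n, then T is bounded below on the common
   kernel of the first n functionals. *)
have [gall|] := pselect (forall n, good (s n) (F (s n))); last first.
  move=> /existsNP[n0 bad0].
  pose b n := ~~ `[< good (s n) (F (s n)) >].
  have exb : exists n, b n by exists n0; apply/asboolPn.
  have [n /asboolPn bad nmin] := ex_minnP exb.
  have gn i : (i < n)%N -> good (s i) (F (s i)).
    move=> ni; apply/asboolP; apply: contraT => bi.
    by have := nmin i bi; rewrite leqNgt ni.
  exists n, z, phi, (4^-1 / 4 ^+ n); split; first exact: tri.
    by rewrite divr_gt0 ?exprn_gt0.
  move=> x kx; rewrite leNgt; apply/negP => xT; apply: bad; apply: FP.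
  have x0 : x != 0.
    by apply: contraTneq xT => ->; rewrite rnorm0 mulr0 -leNgt rnorm_ge0.
  have rx : 0 < rnorm x by rewrite rnorm_gt0.
  pose u := ((rnorm x)^-1)%:C%C *: x.
  have u1 : rnorm u = 1.
    by rewrite rnormZ rnorm_real gtr0_norm ?invr_gt0// mulVf ?gt_eqF.
  have u0 : u != 0 by rewrite -rnorm_gt0 u1.
  have [psi psiF [psiu psile]] := norming_functional u0.
  have Tu : rnorm (T u) <= 4^-1 / 4 ^+ n.
    rewrite /u bopZ rnormZ rnorm_real gtr0_norm ?invr_gt0// ler_pdivrMl// mulrC.
    exact: ltW.
  exists (u, psi); split; rewrite ?ss //.
  - by move=> y; rewrite -[leRHS]divr1 -u1.
  - move=> i ni; rewrite sn//.
    have [_ [phiF _] _ _ _] := gP i (gn i ni).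
    by rewrite [LHS](functionalZ phiF) kx// mulr0.
have z1 n : rnorm (z n) = 1 by have [] := gP n (gall n).
have phiF n : functional (phi n) by have [_ []] := gP n (gall n).
have phi1 n : phi n (z n) = 1 by have [_ []] := gP n (gall n).
have phile n x : rnorm (phi n x : C^o) <= rnorm x by have [_ _ ] := gP n (gall n).
have phi0 i n : (i < n)%N -> phi i (z n) = 0 by move=> ni; have [_ _ _ ->] := gP n (gall n).
have Tz n : rnorm (T (z n)) <= 4^-1 / 4 ^+ n by have [] := gP n (gall n).
have coef n (c : nat -> C) x : x = \sum_(i < n) c i *: z i ->
    forall i, (i < n)%N -> rnorm (c i : C^o) <= 2 ^+ i * rnorm x.
  move=> xE; elim/ltn_ind => i IH ni.
  have ci : c i = phi i x - \sum_(j < i) c j * phi i (z j).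
    rewrite xE functional_sum//.
    under eq_bigr do rewrite functionalZ//.
    rewrite -(big_mkord xpredT (fun j => c j * phi i (z j))).
    rewrite (big_cat_nat (leq0n i) (ltnW ni))/= big_mkord addrAC subrr add0r.
    rewrite big_ltn// phi1 mulr1 big_nat big1 ?addr0// => j /andP[ij _].
    by rewrite phi0// mulr0.
  have : rnorm (c i : C^o) <= rnorm x + \sum_(j < i) 2 ^+ j * rnorm x.
    rewrite ci; apply: le_trans (@rnormB R C^o _ _) _; apply: lerD => //.
    apply: le_trans (@rnorm_sum R C^o _ _ _ _) _; apply: ler_sum => j _.
    rewrite rnormM -[leRHS]mulr1; apply: ler_pM; rewrite ?(@rnorm_ge0 R C^o)//.
      by apply: IH => //; exact: ltn_trans ni.
    by rewrite -(z1 j).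
  move=> /le_trans; apply; rewrite -mulr_suml -[X in X + _]mul1r -mulrDl.
  rewrite ler_wpM2r ?rnorm_ge0// le_eqVlt; apply/orP; left; apply/eqP.
  elim: (i) => [|m IHm]; first by rewrite big_ord0 addr0.
  by rewrite big_ord_recr /= addrA IHm exprS; ring.
have Tspan x : span_of z x -> rnorm (T x) <= 2^-1 * rnorm x.
  move=> [n [c xE]]; have cle := coef n c x xE.
  rewrite {1}xE bop_sum; apply: le_trans (rnorm_sum _ _ _) _.
  apply: (@le_trans _ _ (\sum_(i < n) 4^-1 / 2 ^+ i * rnorm x)).
    apply: ler_sum => i _; rewrite bopZ rnormZ.
    apply: (@le_trans _ _ (2 ^+ i * rnorm x * (4^-1 / 4 ^+ i))).
      by apply: ler_pM; rewrite ?rnorm_ge0 ?(@rnorm_ge0 R C^o)// cle.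
    rewrite (_ : 4 = 2 * 2 :> R) ?exprMn; last by ring.
    have : (2 : R) ^+ i != 0 by rewrite expf_neq0.
    by move: (2 ^+ i) => t t0; rewrite le_eqVlt; apply/orP; left; apply/eqP; field.
  rewrite -mulr_suml ler_wpM2r ?rnorm_ge0//.
  suff -> : \sum_(i < n) 4^-1 / 2 ^+ i = 2^-1 - 2^-1 / 2 ^+ n :> R.
    by rewrite gerBl divr_ge0 ?invr_ge0 ?exprn_ge0.
  elim: n {c xE cle} => [|n IH]; first by rewrite big_ord0 expr0 divr1 subrr.
  rewrite big_ord_recr /= IH exprS.
  have : (2 : R) ^+ n != 0 by rewrite expf_neq0.
  by move: (2 ^+ n) => t t0; field.
pose V := closure (span_of z).
have TV x : V x -> rnorm (T x) <= 2^-1 * rnorm x.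
  move=> /closure_rnormP cx; have [M M0 MT] := bop_bound T.
  apply/ler_addgt0Pr => e e0.
  have [|y zy yx] := cx (e / (M + 1)); first by rewrite divr_gt0// ltr_wpDl.
  have H1 := Tspan y zy; have H2 := MT (x - y); have H3 := rnorm_sub_ge y x.
  have H4 : (M + 1) * rnorm (y - x) <= e.
    by rewrite mulrC -ler_pdivlMr ?ltr_wpDl// ltW.
  rewrite -[T x](subrK (T y)) -bopB; apply: le_trans (rnormD _ _) _.
  rewrite [rnorm (x - y)]rdistC in H2; have H5 := rnorm_ge0 (y - x).
  by lra.
exfalso; apply: (ssA V (2^-1 / (rnorm (a : C^o) + 1))).
- exact: closed_closure.
- exact/closure_subspace/span_of_subspace.
- apply: triangular_infinite_dimensional phi0 _ => // i.
  exact/subset_closure/mem_span_of.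
- by rewrite divr_gt0// ltr_wpDl// (@rnorm_ge0 R C^o).
move=> x Vx; have aC : 0 < rnorm (a : C^o) + 1 by rewrite ltr_wpDl// (@rnorm_ge0 R C^o).
rewrite mulrAC ler_pdivrMr//.
have H1 := TV x Vx; have := rnorm_sub_ge x (T x).
rewrite (_ : x - T x = a *: A x); last by rewrite (_ : T x = x - a *: A x)// subKr.
by rewrite rnormZ; have := rnorm_ge0 (A x); lra.
Qed.

(** Along the segment from 1 to 1 - A the index is zero on an open set of
    parameters, and also on a closed one since every 1 - t A is bounded below
    on a subspace of finite codimension. *)
Lemma strictly_singular_index_zero A : strictly_singular A -> index_zero (1 - A).
Proof.
move=> ssA.
pose P (t : R) := index_zero (1 - t%:C%C *: A).
have [M M0 MA] := bop_bound A.
have diffE (s t : R) x : (1 - s%:C%C *: A) x - (1 - t%:C%C *: A) x = (t - s)%:C%C *: A x.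
  rewrite (_ : (1 - s%:C%C *: A) x = x - s%:C%C *: A x)//.
  rewrite (_ : (1 - t%:C%C *: A) x = x - t%:C%C *: A x)//.
  by rewrite opprB addrC addrA subrK -scalerBl rmorphB.
have diff (s t e : R) : 0 < e -> `|t - s| < e / (M + 1) -> forall x,
    rnorm ((1 - s%:C%C *: A) x - (1 - t%:C%C *: A) x) <= e * rnorm x.
  move=> e0 st x; rewrite diffE rnormZ rnorm_real.
  apply: (@le_trans _ _ (e / (M + 1) * ((M + 1) * rnorm x))).
    apply: ler_pM; rewrite ?rnorm_ge0 ?(ltW st)//; apply: le_trans (MA x) _.
    by rewrite ler_wpM2r ?rnorm_ge0// lerDl.
  by rewrite mulrA divfK// gt_eqF// ltr_wpDl.
have Popen t : P t -> exists2 d : R, 0 < d & forall s, `|t - s| < d -> P s.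
  move=> Pt; have [e e0 eP] := index_zero_near 0 Pt.
  exists (e / (M + 1)); first by rewrite divr_gt0// ltr_wpDl.
  by move=> s ts; apply: eP; exact: diff.
have Pclosed t : (forall d : R, 0 < d -> exists2 s, P s & `|t - s| < d) -> P t.
  move=> clP; have [k [z [phi [c [tri c0 cT]]]]] :=
    strictly_singular_bounded_below t%:C%C ssA.
  apply: (index_zero_closed tri c0 cT) => e e0.
  have [|s Ps st] := clP (e / (M + 1)); first by rewrite divr_gt0// ltr_wpDl.
  by exists (1 - s%:C%C *: A) => //; apply: diff.
have P0 : P 0.
  rewrite /P scale0r subr0; exists 0%N, (fun=> 0), (fun=> fun=> 0), 1; split.
  - by case.
  - by exists 1; rewrite mulr1.
  - by move=> x; rewrite big_ord0 subr0.
have P1 : P 1.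
  pose E : set R := [set t | 0 <= t <= 1 /\ forall s, 0 <= s <= t -> P s].
  have E0 : E 0.
    by split; [rewrite lexx ler01|move=> s ?; rewrite (_ : s = 0)//; apply/eqP; rewrite eq_le andbC].
  have ubE : ubound E 1 by move=> t [/andP[]].
  have supE : has_sup E by split; [exists 0|exists 1].
  set t := sup E.
  have t0 : 0 <= t by apply: ub_le_sup => //; exists 1.
  have t1 : t <= 1 by apply: ge_sup => //; exists 0.
  have Plt s : 0 <= s -> s < t -> P s.
    move=> s0 st; have ts : 0 < t - s by rewrite subr_gt0.
    have [u [_ uP]] := sup_adherent ts supE.
    by rewrite subKr => su; apply: uP; rewrite s0 ltW.
  have Pt : P t.
    apply: Pclosed => d d0; have [->|tn0] := eqVneq t 0.
      by exists 0 => //; rewrite subrr normr0.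
    have tgt0 : 0 < t by rewrite lt_def tn0.
    have [dt|td] := leP t d.
      exists (t / 2); first by apply: Plt; lra.
      by rewrite ger0_norm; lra.
    exists (t - d / 2); first by apply: Plt; lra.
    by rewrite ger0_norm; lra.
  have [d d0 dP] := Popen t Pt.
  have [t1'|tlt1] := eqVneq t 1; first by rewrite -t1'.
  have {}tlt1 : t < 1 by rewrite lt_def eq_sym tlt1.
  pose u := Num.min 1 (t + d / 2).
  have ut : t < u by rewrite lt_min tlt1 /=; lra.
  have : E u.
    split; first by rewrite ge_min lexx /= andbT (le_trans t0 (ltW ut)).
    move=> s /andP[s0 su]; have [st|ts] := ltP s t; first exact: Plt.
    apply: dP; rewrite ler0_norm ?subr_le0// opprB.
    have : s <= t + d / 2 by apply: le_trans su _; rewrite ge_min lexx orbT.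
    by lra.
  move=> Eu; have /negP[] : ~~ (u <= t) by rewrite -ltNge.
  by apply: ub_le_sup Eu; exists 1.
by move: P1; rewrite /P (_ : 1%:C%C = 1)// scale1r.
Qed.

End Main.

End StrictlySingular.

(** * Surjective homomorphisms from B(X) *)

Section IdealArgument.
Variable R : realType.
Local Notation C := R[i].

(** The inverse of a linear homeomorphism is bounded on the range only, hence
    the formulation as a lower bound. *)
Lemma isomorphic_bounds (X Z : normedModType C) (W : set X) :
  isomorphic_to_subspace Z W ->
  exists (J : {linear Z -> X}) (inv : X -> Z) (M N : R),
    [/\ range J = W, cancel J inv, forall z, rnorm (J z) <= M * rnorm z &
        forall z, rnorm z <= N * rnorm (J z)].
Proof.
move=> [J [inv [cJ rJ JK cinv]]].
have [M MJ] : exists M : R, forall z, rnorm (J z) <= M * rnorm z.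
  have : nbhs (J 0) [set y | rnorm (J 0 - y) < 1].
    by apply/nbhs_rnormP; exists 1.
  move=> /(cJ 0)/nbhs_rnormP[d d0 dP]; exists (2 / d) => z.
  have [->|z0] := eqVneq z 0; first by rewrite linear0 !rnorm0 mulr0.
  have rz : 0 < rnorm z by rewrite rnorm_gt0.
  pose t : R := d / 2 / rnorm z.
  have t0 : 0 < t by rewrite !divr_gt0.
  have := dP (t%:C%C *: z); rewrite sub0r rnormN rnormZ rnorm_real gtr0_norm//.
  rewrite /t divfK ?gt_eqF// => /(_ _)/= H.
  have /H {H} : d / 2 < d by lra.
  rewrite linear0 sub0r rnormN linearZ /= rnormZ rnorm_real gtr0_norm//.
  rewrite -ltr_pdivlMl// => /ltW/le_trans; apply.
  rewrite mulr1 /t le_eqVlt; apply/orP; left; apply/eqP.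
  by field; rewrite !gt_eqF.
have W0 : W 0 by rewrite -rJ; exists 0 => //; exact: linear0.
have inv0 : inv 0 = 0 by rewrite -(linear0 J) JK.
have [N NJ] : exists N : R, forall z, rnorm z <= N * rnorm (J z).
  move/subspace_continuousP: cinv => /(_ 0 W0).
  have : nbhs (inv 0) [set y | rnorm (inv 0 - y) < 1].
    by apply/nbhs_rnormP; exists 1.
  move=> /[swap]/[apply]/nbhs_rnormP[d d0 dP]; exists (2 / d) => z.
  have [->|z0] := eqVneq z 0; first by rewrite linear0 !rnorm0 mulr0.
  have rz : 0 < rnorm (J z).
    by rewrite rnorm_gt0; apply: contra_neq z0 => Jz; rewrite -(JK z) Jz.
  pose t : R := d / 2 / rnorm (J z).
  have t0 : 0 < t by rewrite !divr_gt0.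
  have Jt : rnorm (J (t%:C%C *: z)) < d.
    rewrite linearZ /= rnormZ rnorm_real gtr0_norm// /t divfK ?gt_eqF//.
    by lra.
  have := dP (J (t%:C%C *: z)); rewrite sub0r rnormN => /(_ Jt).
  have WJ : W (J (t%:C%C *: z)) by rewrite -rJ; exists (t%:C%C *: z).
  move=> /(_ WJ) H; have {H} : rnorm (inv 0 - inv (J (t%:C%C *: z))) < 1 by exact: H.
  rewrite JK inv0 sub0r rnormN rnormZ rnorm_real gtr0_norm//.
  rewrite -ltr_pdivlMl// => /ltW/le_trans; apply.
  rewrite mulr1 /t le_eqVlt; apply/orP; left; apply/eqP.
  by field; rewrite !gt_eqF.
by exists J, inv, M, N.
Qed.

(** Composing with a projection onto W extends the inverse of the embedding to
    the whole space. *)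
Lemma complemented_section (X Z : normedModType C) (W : set X) :
  complemented W -> isomorphic_to_subspace Z W ->
  exists (J : {linear Z -> X}) (U : X -> Z) (M N : R),
    [/\ range J = W, cancel J U /\ (forall a x y, U (a *: x + y) = a *: U x + U y),
        forall z, rnorm (J z) <= M * rnorm z &
        forall x, rnorm (U x) <= N * rnorm x].
Proof.
move=> [P [PP rP]] /isomorphic_bounds[J [inv [M [N [rJ JK MJ NJ]]]]].
have PW x : exists z, P x = J z.
  have : range P (P x) by exists x.
  by rewrite rP -rJ => -[z _ <-]; exists z.
have PJ z : P (J z) = J z.
  have : range J (J z) by exists z.
  by rewrite rJ -rP => -[x _ <-]; rewrite -[LHS]/((P * P) x) PP.
have JU x : J (inv (P x)) = P x by have [z ->] := PW x; rewrite JK.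
have [Q Q0 PQ] := bop_bound P.
exists J, (fun x => inv (P x)), M, (`|N| * Q); split=> //; first split.
- by move=> z; rewrite PJ JK.
- move=> a x y; apply: (can_inj JK); rewrite JU linearP !JU; exact: bopP.
move=> x; apply: le_trans (NJ _) _; rewrite JU.
apply: (@le_trans _ _ (`|N| * rnorm (P x))).
  by rewrite ler_wpM2r ?rnorm_ge0// ler_norm.
by rewrite -mulrA ler_wpM2l.
Qed.

Definition factors_identity (X : normedModType C) (A : B(X)) :=
  exists U V : B(X), U * A * V = 1.

(** If A is bounded below on V, its image A(V) contains a complemented copy of X;
    lifting this copy to V and projecting onto it undoes A. *)
Lemma strictly_singular_or_factors (X : completeNormedModType C) (A : B(X)) :
  complementably_minimal X -> ~ factors_identity A -> strictly_singular A.
Proof.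
move=> cm nA V c cV sV Vinf c0 cA; apply: nA.
have [V0 VD] := sV.
have VB x y : V x -> V y -> V (x - y).
  by move=> Vx Vy; rewrite addrC -scaleN1r; exact: VD.
have [||| W [WV cW iW]] := cm [set A x | x in V].
- move=> y /closure_rnormP cy.
  have [|x Vx <-] := range_closed c0 VB cV cA (y := y); last by exists x.
  by move=> d d0; have [_ [x Vx <-] xy] := cy d d0; exists x.
- split; first by exists 0 => //; exact: bop0.
  by move=> a _ _ [x Vx <-] [y Vy <-]; exists (a *: x + y); [exact: VD|exact: bopP].
- exact: (image_infinite_dimensional sV c0 cA).
have [J [U [M [N [rJ [JU lU] MJ NU]]]]] := complemented_section cW iW.
have /choice[g gP] z : exists x, V x /\ A x = J z.
  have /WV[x Vx Ax] : W (J z) by rewrite -rJ; exists z.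
  by exists x.
have injA x y : V x -> V y -> A x = A y -> x = y.
  move=> Vx Vy Axy; apply/eqP; rewrite -subr_eq0 -rnorm_eq0 eq_le rnorm_ge0 andbT.
  by have := cA _ (VB _ _ Vx Vy); rewrite bopB Axy subrr rnorm0 pmulr_rle0.
have [||G GE] := @bop_exists R X g.
- move=> a x y; have [Vx Ax] := gP x; have [Vy Ay] := gP y; have [Vxy Axy] := gP (a *: x + y).
  by apply: injA => //; [exact: VD|rewrite bopP Ax Ay Axy linearP].
- exists (M / c) => x; have [Vx Ax] := gP x.
  by rewrite mulrAC ler_pdivlMr// mulrC; apply: le_trans (cA _ Vx) _; rewrite Ax.
have [|U' UE] := bop_exists lU; first by exists N.
exists U', G; apply: bop_ext => x.
rewrite -[LHS]/(U' (A (G x))) UE GE; have [_ ->] := gP x.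
exact: JU.
Qed.

Lemma double_copies (X : normedModType C) (W : set X) : complemented W ->
  isomorphic_to_subspace (X * X)%type W ->
  exists a b : bool -> B(X), forall i j, a i * b j = (i == j)%:R.
Proof.
move=> cW iW.
have [J [U [M [N [rJ [JU lU] MJ NU]]]]] := complemented_section cW iW.
have rin (x : X) : rnorm ((x, 0) : (X * X)%type) = rnorm x /\ rnorm ((0, x) : (X * X)%type) = rnorm x.
  rewrite /rnorm !prod_normE /= normr0; split; last by rewrite max_r.
  by rewrite max_l.
have a_ (i : bool) : exists T : B(X), forall x, T x = if i then (U x).1 else (U x).2.
  apply: bop_exists; first by move=> c x y; rewrite lU; case: i.
  exists N => x; apply: le_trans (NU x); have [H1 H2] := rnorm_pair_ge (U x).
  by case: i.
have b_ (i : bool) : exists T : B(X), forall x, T x = J (if i then (x, 0) else (0, x)).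
  apply: bop_exists.
    move=> c x y; rewrite -linearP; congr (J _).
    by case: i; congr (_, _); rewrite /= scaler0 addr0.
  exists M => x; apply: le_trans (MJ _) _; have [H1 H2] := rin x.
  by case: i; rewrite ?H1 ?H2.
have [a aE] := choice a_; have [b bE] := choice b_.
exists a, b => i j; apply: bop_ext => x.
rewrite -[LHS]/(a i (b j x)) aE bE JU.
by case: i; case: j.
Qed.

Section Hom.
Variables X Y : completeNormedModType C.
Variables (psi : {linear B(X) -> B(Y)}).
Hypothesis psiM : {morph psi : f g / f * g}.
Hypothesis psi_surj : forall g, exists f, psi f = g.

Lemma surjective_hom1 : psi 1 = 1.
Proof. by have [f f1] := psi_surj 1; rewrite -[LHS]mulr1 -f1 -psiM mul1r. Qed.

(** Every operator of rank one factors through D, by way of a point at which D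
    does not vanish. *)
Lemma kernel_rank_one (D : B(X)) : D != 0 -> psi D = 0 ->
  forall u phi, functional phi -> psi (rank_one u phi) = 0.
Proof.
move=> D0 psiD u phi phiF.
have [y Dy] : exists y, D y != 0.
  apply: contrapT => H; move/eqP: D0; apply; apply: bop_ext => y.
  by apply/eqP; apply: contraT => Dy; exfalso; apply: H; exists y.
have [g gF [gDy _]] := norming_functional Dy.
have -> : rank_one u phi = rank_one u g * D * rank_one y phi.
  apply: bop_ext => x; rewrite -[RHS]/(rank_one u g (D (rank_one y phi x))).
  by rewrite !rank_oneE// bopZ functionalZ// gDy mulr1.
by rewrite !psiM psiD mulr0 mul0r.
Qed.

(** If Y were one-dimensional, the algebra B(Y) would be commutative and could
    not contain two copies of the identity that are orthogonal to each other. *)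
Lemma not_factors_rank_one (a b : bool -> B(X)) (y0 : Y) f : functional f ->
  (exists y : Y, y != 0) -> (forall i j, a i * b j = (i == j)%:R) ->
  ~ factors_identity (rank_one y0 f).
Proof.
move=> fF [y1 y10] ab [U [V UV]].
set e := U y0.
have line y : y = f (V y) *: e.
  by rewrite -[LHS]/((1 : B(Y)) y) -UV -[LHS]/(U (rank_one y0 f (V y))) rank_oneE// bopZ.
have e0 : e != 0 by apply: contra_neq y10 => e0; rewrite (line y1) e0 scaler0.
have scal (T : B(Y)) y : T y = f (V (T e)) *: y.
  by rewrite {1}(line y) bopZ {1}(line (T e)) scalerA mulrC -scalerA -line.
pose al i := f (V (psi (a i) e)); pose be i := f (V (psi (b i) e)).
have albe i j : al i * be j = (i == j)%:R.
  have : psi (a i * b j) e = ((i == j)%:R : C) *: e.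
    by rewrite ab; case: (i == j); rewrite ?surjective_hom1 ?linear0 ?scale1r ?scale0r.
  rewrite psiM -[LHS]/(psi (a i) (psi (b j) e)) scal [psi (b j) e]scal scalerA.
  by move=> /eqP; rewrite -subr_eq0 -scalerBl scaler_eq0 (negbTE e0) orbF subr_eq0 => /eqP.
have := albe true false; have := albe true true; have := albe false false => /=.
move=> H1 H2 /eqP; rewrite mulf_eq0 => /orP[]/eqP H.
  by move/eqP: H2; rewrite H mul0r eq_sym oner_eq0.
by move/eqP: H1; rewrite H mulr0 eq_sym oner_eq0.
Qed.

End Hom.

(** Let psi have a nonzero kernel, which then contains the operators of finite
    rank, and lift an idempotent p of rank one to A. As the identity of Y does
    not factor through p, A is strictly singular, so 1 - A has a left inverse
    modulo operators of finite rank; multiplying p - p^2 = 0 by its image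
    gives p = 0. *)
Theorem complementably_minimal_SHAI (X : completeNormedModType C) :
  complementably_minimal X ->
  (exists W : set X, complemented W /\ isomorphic_to_subspace (X * X)%type W) ->
  SHAI X.
Proof.
move=> cm [W [cW iW]] Y Yn0 psi psiM psi_surj T1 T2 T12.
have [a [b ab]] := double_copies cW iW.
apply/eqP; rewrite -subr_eq0; apply/negPn/negP => D0.
have psiD : psi (T1 - T2) = 0 by rewrite linearB T12 subrr.
have psi1 := kernel_rank_one psiM D0 psiD.
have [y0 y00] := Yn0.
have [f fF [fy0 _]] := norming_functional y00.
pose p := rank_one y0 f.
have py0 : p y0 = y0 by rewrite rank_oneE// fy0 scale1r.
have pp : p * p = p.
  apply: bop_ext => y; rewrite -[LHS]/(p (p y)) /p !rank_oneE//.
  by rewrite functionalZ// fy0 mulr1.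
have [A psiA] := psi_surj p.
have nA : ~ factors_identity A.
  move=> [U [V UV]]; apply: (not_factors_rank_one psiM psi_surj fF Yn0 ab (y0 := y0)).
  by exists (psi U), (psi V); rewrite -/p -psiA -!psiM UV (surjective_hom1 psiM psi_surj).
have [r [u [phi [V [phiF [V' [V'V VV']] AV]]]]] :=
  strictly_singular_index_zero (strictly_singular_or_factors cm nA).
have V'Vx x : V' (V x) = x by rewrite -[LHS]/((V' * V) x) V'V.
have AE : V' * (1 - A) * A = A - \sum_i rank_one (V' (u i)) (phi i \o A).
  apply: bop_ext => x; rewrite -[LHS]/(V' ((1 - A) (A x))) AV bopB V'Vx bop_sum.
  have sumE (I : finType) (F : I -> B(X)) : (\sum_i F i) x = \sum_i F i x.
    by apply: (big_ind2 (fun (S : B(X)) y => S x = y)) => // ? ? ? ? <- <-.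
  rewrite -[RHS]/(A x - (\sum_i rank_one (V' (u i)) (phi i \o A)) x) sumE.
  congr (_ - _); apply: eq_bigr => i _.
  by rewrite bopZ rank_oneE//; exact: functional_comp.
have := congr1 psi AE; rewrite linearB linear_sum big1; last first.
  by move=> i _; apply: psi1; exact: functional_comp.
rewrite subr0 psiA !psiM linearB (surjective_hom1 psiM psi_surj) psiA.
rewrite -mulrA mulrBl mul1r pp subrr mulr0 => p0.
by move/eqP: y00; apply; rewrite -py0 -p0.
Qed.

End IdealArgument.

(** * Finitely supported sequences *)

Section FiniteSequences.
Variable R : realType.
Local Notation C := R[i].
Implicit Types (x y : c00 C) (A B : set nat).

Lemma c00_ext x y : (forall k, x k = y k) -> x = y.
Proof. by move=> xy; apply: val_inj; apply/funext => k; exact: xy. Qed.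

Lemma c00_bounded x : exists D, forall k, (D <= k)%N -> x k = 0.
Proof.
have /asboolP/finite_seqP[s sE] := c00_funP x.
exists (\max_(i <- s) i).+1 => k Dk; apply/eqP; apply: contraT => xk.
have : [set k | x k != 0] k by [].
rewrite sE /= => ks; have := @leq_bigmax_seq _ s xpredT (fun i => i) k ks isT.
by rewrite leqNgt Dk.
Qed.

Lemma c00_mk_subproof (f : nat -> C) (D : nat) :
  (fun k => if (k < D)%N then f k else 0 : C^o) \in @finitely_supported C.
Proof.
apply/asboolP; apply: (@sub_finite_set _ _ [set k | (k < D)%N]).
  by move=> k /=; case: ifP => //; rewrite eqxx.
exact: finite_II.
Qed.

Definition c00_mk f D : c00 C := FinSupp (c00_mk_subproof f D).

Lemma restr_subproof A x :
  (fun k => if `[< A k >] then x k else 0 : C^o) \in @finitely_supported C.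
Proof.
have /asboolP fx := c00_funP x; apply/asboolP; apply: sub_finite_set fx => k /=.
by case: ifP => // _; rewrite eqxx.
Qed.

Definition restr A x : c00 C := FinSupp (restr_subproof A x).

Definition unit_vec k : c00 C := c00_mk (fun j => (j == k)%:R) k.+1.

Lemma unit_vecE k j : unit_vec k j = (j == k)%:R.
Proof. by rewrite /=; case: ltnP => // kj; rewrite gtn_eqF. Qed.

Lemma restr_in A x k : A k -> restr A x k = x k.
Proof. by move=> Ak /=; rewrite asboolT. Qed.

Lemma restr_out A x k : ~ A k -> restr A x k = 0.
Proof. by move=> Ak /=; rewrite asboolF. Qed.

Lemma c00D x y k : (x + y) k = x k + y k. Proof. by []. Qed.
Lemma c00B x y k : (x - y) k = x k - y k. Proof. by []. Qed.
Lemma c00Z (a : C) x k : (a *: x) k = a * x k. Proof. by []. Qed.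
Lemma c00_sum (I : Type) (s : seq I) (P : pred I) (F : I -> c00 C) k :
  (\sum_(i <- s | P i) F i) k = \sum_(i <- s | P i) F i k.
Proof. by apply: (big_ind2 (fun (u : c00 C) v => u k = v)) => // ? ? ? ? <- <-. Qed.

Lemma restr_restr A B x : restr A (restr B x) = restr (A `&` B) x.
Proof.
apply: c00_ext => k; have [Ak|Ak] := pselect (A k); last first.
  by rewrite !restr_out// => -[].
have [Bk|Bk] := pselect (B k); last by rewrite restr_in// !restr_out// => -[].
by rewrite !restr_in.
Qed.

Lemma eq_restr A B x : (forall k, x k != 0 -> A k <-> B k) -> restr A x = restr B x.
Proof.
move=> AB; apply: c00_ext => k; have [xk|xk] := eqVneq (x k) 0.
  by rewrite /= xk !if_same.
have [Ak|Ak] := pselect (A k).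
  by rewrite !restr_in//; apply/AB.
by rewrite !restr_out// => Bk; apply/Ak/AB.
Qed.

Lemma restr_id A x : (forall k, x k != 0 -> A k) -> restr A x = x.
Proof.
move=> Ax; apply: c00_ext => k; have [xk|xk] := eqVneq (x k) 0.
  by rewrite /= xk if_same.
by rewrite restr_in//; exact: Ax.
Qed.

Lemma restr_eq0 A x : (forall k, A k -> x k = 0) -> restr A x = 0.
Proof. by move=> Ax; apply: c00_ext => k /=; case: asboolP => // /Ax. Qed.

Lemma restrP A a x y : restr A (a *: x + y) = a *: restr A x + restr A y.
Proof.
apply: c00_ext => k; rewrite c00D c00Z.
by rewrite /=; case: asboolP => //; rewrite mulr0 addr0.
Qed.

Lemma restrD A x y : restr A (x + y) = restr A x + restr A y.
Proof. by have := restrP A 1 x y; rewrite !scale1r. Qed.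

Lemma restr0 A : restr A 0 = 0.
Proof. by apply: restr_eq0. Qed.

Lemma restrZ A a x : restr A (a *: x) = a *: restr A x.
Proof. by have := restrP A a x 0; rewrite restr0 !addr0. Qed.

Lemma restr_sum A (I : Type) (s : seq I) (P : pred I) (F : I -> c00 C) :
  restr A (\sum_(i <- s | P i) F i) = \sum_(i <- s | P i) restr A (F i).
Proof. by rewrite (big_morph _ (restrD A) (restr0 A)). Qed.

Lemma restr_restrict (E : {fset nat}) x : c00_restrict E x = restr [set` E] x.
Proof.
apply: c00_ext => k /=; case: ifP => kE; first by rewrite asboolT.
by rewrite asboolF//= kE.
Qed.

(** The number of terms is an arbitrary bound for the support of a, on which the
    value does not depend. *)
Definition lincomb (Z : lmodType C) (w : nat -> Z) (a : c00 C) : Z :=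
  \sum_(k < sval (cid (c00_bounded a))) a k *: w k.

Lemma lincombE (Z : lmodType C) (w : nat -> Z) (a : c00 C) D :
  (forall k, (D <= k)%N -> a k = 0) -> lincomb w a = \sum_(k < D) a k *: w k.
Proof.
have widen m n : (m <= n)%N -> (forall k, (m <= k)%N -> a k = 0) ->
    \sum_(k < m) a k *: w k = \sum_(k < n) a k *: w k.
  move=> mn am; rewrite (big_ord_widen n (fun k => a k *: w k) mn) big_mkcond.
  by apply: eq_bigr => k _; case: ltnP => // /am ->; rewrite scale0r.
rewrite /lincomb; case: cid => D' /= aD' aD.
by have [DD|/ltnW DD] := leqP D' D; [exact: widen|exact/esym/widen].
Qed.

Lemma lincombP (Z : lmodType C) (w : nat -> Z) (t : C) (a b : c00 C) :
  lincomb w (t *: a + b) = t *: lincomb w a + lincomb w b.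
Proof.
have [D aD] := c00_bounded a; have [D' bD] := c00_bounded b.
pose m := maxn D D'.
have am k : (m <= k)%N -> a k = 0 by rewrite geq_max => /andP[/aD].
have bm k : (m <= k)%N -> b k = 0 by rewrite geq_max => /andP[_ /bD].
have abm k : (m <= k)%N -> (t *: a + b) k = 0.
  by move=> mk; rewrite c00D c00Z am// bm// mulr0 addr0.
rewrite (lincombE w am) (lincombE w bm) (lincombE w abm).
rewrite scaler_sumr -big_split /=; apply: eq_bigr => k _.
by rewrite -[LHS]/((t * a k + b k) *: w k) scalerDl scalerA.
Qed.

Lemma c00_exists (g : nat -> C) D : (forall k, (D <= k)%N -> g k = 0) ->
  exists y : c00 C, forall k, y k = g k.
Proof.
move=> gD; exists (c00_mk g D) => k /=.
by case: ltnP => // /gD ->.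
Qed.

End FiniteSequences.

(** * The logarithmic weight *)

Section LogWeight.
Variable R : realType.

Definition weight (n : nat) : R := log2 (1 + n%:R).
Local Notation f := weight.

Let ln2_gt0 : 0 < ln 2 :> R. Proof. by rewrite ln_gt0// ltr1n. Qed.

Lemma weight_le m n : (m <= n)%N -> f m <= f n.
Proof.
move=> mn; rewrite /weight /log2 ler_wpM2r ?invr_ge0 ?(ltW ln2_gt0)//.
by rewrite ler_ln ?posrE ?ltr_wpDr// lerD2l ler_nat.
Qed.

Lemma weight1 : f 1 = 1.
Proof. by rewrite /weight /log2 divff ?gt_eqF. Qed.

Lemma weight_ge1 n : (0 < n)%N -> 1 <= f n.
Proof. by move=> n0; rewrite -weight1 weight_le. Qed.

Lemma weight_gt0 n : (0 < n)%N -> 0 < f n.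
Proof. by move=> n0; apply: lt_le_trans (weight_ge1 n0). Qed.

Lemma weight_lt m n : f m < f n -> (m < n)%N.
Proof. by move=> fmn; rewrite ltnNge; apply/negP => /weight_le; rewrite leNgt fmn. Qed.

Lemma weight_ge_3half n : (2 <= n)%N -> 3 / 2 <= f n.
Proof.
move=> n2; apply: le_trans (weight_le n2); rewrite /weight /log2.
rewrite ler_pdivlMr//.
have e3 : ln ((2 : R) ^+ 3) = 3 * ln 2 by rewrite lnXn// mulr_natl.
have e2 : ln ((1 + 2%:R : R) ^+ 2) = 2 * ln (1 + 2%:R).
  by rewrite lnXn ?mulr_natl//; lra.
(* log2 3 >= 3 / 2 because 2 ^ 3 <= 3 ^ 2. *)
suff : ln ((2 : R) ^+ 3) <= ln ((1 + 2%:R : R) ^+ 2) by rewrite e2 e3; lra.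
rewrite ler_ln ?posrE ?exprn_gt0//.
by lra.
Qed.

Lemma weightM m n : (0 < m)%N -> (0 < n)%N -> f (m * n) <= f m + f n.
Proof.
move=> m0 n0; rewrite /weight /log2 -mulrDl ler_wpM2r ?invr_ge0 ?(ltW ln2_gt0)//.
rewrite -lnM ?posrE ?ltr_wpDr// ler_ln ?posrE ?mulr_gt0 ?ltr_wpDr//.
by rewrite natrM; have := ler0n R m; have := ler0n R n; lra.
Qed.

Lemma weight_mul3 m : (0 < m)%N -> f (3 * m) <= f m + 2.
Proof.
move=> m0; rewrite /weight /log2 ler_pdivrMr// mulrDl divfK ?gt_eqF//.
have -> : 2 * ln 2 = ln ((2 : R) ^+ 2) by rewrite lnXn// mulr_natl.
rewrite -lnM ?posrE ?ltr_wpDr ?exprn_gt0// ler_ln ?posrE ?mulr_gt0 ?ltr_wpDr ?exprn_gt0//.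
by rewrite natrM; have := ler0n R m; lra.
Qed.

Lemma weight_exp n k : (0 < n)%N -> (0 < k)%N -> f (n ^ k) <= k%:R * f n.
Proof.
move=> n0; elim: k => // -[|k] IH _; first by rewrite expn1 mul1r.
rewrite expnS; apply: le_trans (weightM _ _) _ => //; first by rewrite expn_gt0 n0.
by rewrite [in leRHS]mulrS mulrDl mul1r lerD2l IH.
Qed.

Lemma weight_unbounded (r : R) : exists n, r <= f n.
Proof.
exists (2 ^ (Num.truncn r).+1)%N; apply: le_trans (ltW (truncnS_gt r)) _.
rewrite /weight /log2 ler_pdivlMr// mulr_natl -lnXn//.
by rewrite ler_ln ?posrE ?exprn_gt0 ?ltr_wpDr// natrX lerDr.
Qed.

End LogWeight.

(** * Schlumprecht's norm and the comparison principle *)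

Section SchlumprechtNorm.
Variables (R : realType) (N : c00 R[i] -> R).
Local Notation C := R[i].
Hypothesis normN : is_norm N.
Hypothesis eqN : schlumprecht_equation N.
Local Notation f := (@weight R).
Implicit Types (x y : c00 C) (A B : set nat).

Lemma ND x y : N (x + y) <= N x + N y.
Proof. by have [nD _ _] := normN; exact: nD. Qed.

Lemma NZ (a : C) x : N (a *: x) = rnorm (a : C^o) * N x.
Proof. by have [_ nZ _] := normN; exact: nZ. Qed.

Lemma N0 : N 0 = 0.
Proof. by rewrite -(scale0r (0 : c00 C)) NZ (@rnorm0 R C^o) mul0r. Qed.

Lemma NN x : N (- x) = N x.
Proof. by rewrite -scaleN1r NZ (@rnormN R C^o) rnorm1 mul1r. Qed.

Lemma N_ge0 x : 0 <= N x.
Proof. by have := ND x (- x); rewrite subrr N0 NN -mulr2n -mulr_natl pmulr_rge0. Qed.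

Lemma N_sum (I : Type) (s : seq I) (P : pred I) (F : I -> c00 C) :
  N (\sum_(i <- s | P i) F i) <= \sum_(i <- s | P i) N (F i).
Proof.
elim/big_rec2: _ => [|i b a _ ab]; first by rewrite N0.
by apply: le_trans (ND _ _) _; rewrite lerD2l.
Qed.

Lemma coord_le x k : rnorm (x k) <= N x.
Proof.
rewrite -lee_fin eqN le_max; apply/orP; left.
by apply: ereal_sup_ubound; exists k.
Qed.

(** Allowing infinite sets spares truncating them at the end of a support. *)
Definition increasing_sets n (A : 'I_n -> set nat) :=
  (forall i, A i !=set0) /\
  (forall i j : 'I_n, (i < j)%N -> forall a b, A i a -> A j b -> (a < b)%N).

Lemma increasing_sets_le n (A : 'I_n -> set nat) x : (2 <= n)%N ->
  increasing_sets A -> \sum_(i < n) N (restr (A i) x) <= f n * N x.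
Proof.
move=> n2 [A0 Alt].
have /choice[w wA] i : exists w, A i w by have [w] := A0 i; exists w.
have [D xD] := c00_bounded x.
pose D' := maxn D (\max_i w i).+1.
pose E (i : 'I_n) := [fset k in iota 0 D' | `[< A i k >]]%fset.
have EP i k : (k \in E i) = (k < D')%N && `[< A i k >].
  by rewrite !inE /= mem_iota.
have sE : successive E.
  split=> [i|i j ij a b].
    apply/fset0Pn; exists (w i); rewrite EP; apply/andP; split; last exact/asboolP.
    by rewrite leq_max ltnS (@leq_bigmax _ w i) orbT.
  rewrite !EP => /andP[_ /asboolP Aa] /andP[_ /asboolP Ab].
  by apply: Alt Aa Ab; rewrite ij.
have -> : \sum_(i < n) N (restr (A i) x) = \sum_(i < n) N (c00_restrict (E i) x).
  apply: eq_bigr => i _; rewrite restr_restrict; congr N; apply: eq_restr => k xk.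
  rewrite /= EP; split=> [Ak|/andP[_ /asboolP//]]; apply/andP; split; last exact/asboolP.
  by rewrite leq_max ltnNge; apply/orP; left; apply: contra xk => /xD ->.
have f0 : 0 < f n by apply: weight_gt0; exact: ltnW.
rewrite -ler_pdivrMl// -lee_fin eqN le_max; apply/orP; right.
by apply: ereal_sup_ubound; exists n, E.
Qed.

Lemma norm_le x (c : R) : (forall k, rnorm (x k) <= c) ->
  (forall n (A : 'I_n -> set nat), (2 <= n)%N -> increasing_sets A ->
     \sum_(i < n) N (restr (A i) x) <= f n * c) ->
  N x <= c.
Proof.
move=> xc xA; rewrite -lee_fin eqN ge_max; apply/andP; split.
  by apply: ge_ereal_sup => _ [k _ <-]; rewrite lee_fin.
apply: ge_ereal_sup => _ [n [E [n2 [E0 Elt] ->]]]; rewrite lee_fin.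
have f0 : 0 < f n by apply: weight_gt0; exact: ltnW.
rewrite ler_pdivrMl//.
under eq_bigr do rewrite restr_restrict.
apply: xA => //; split=> [i|i j].
  by have /fset0Pn[k ki] := E0 i; exists k.
have [k kj] : exists k, (j : nat) = (i + k.+1)%N \/ (j <= i)%N.
  have [ji|ij] := leqP j i; first by exists 0%N; right.
  by exists (j - i).-1; left; rewrite prednK ?subn_gt0// subnKC// ltnW.
case: kj => [|ji]; last by rewrite ltnNge ji.
elim: k j => [|k IH] j jE _ a b aE bE.
  by apply: Elt aE bE; rewrite jE addn1.
have kn : (i + k.+1 < n)%N by have := ltn_ord j; rewrite jE addnS; exact: ltnW.
pose j' := Ordinal kn.
have /fset0Pn[c' cE] := E0 j'.
apply: (@ltn_trans c').
  by apply: (IH j') => //=; rewrite addnS ltnS leq_addr.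
by apply: Elt cE bE; rewrite jE addnS.
Qed.

Lemma N_restr0 A x : (forall k, A k -> x k = 0) -> N (restr A x) = 0.
Proof. by move=> /restr_eq0 ->; exact: N0. Qed.

Section Comparison.
Variables (G : nat -> set nat) (x y : c00 C).
Hypothesis G0 : forall k, G k !=set0.
Hypothesis Glt : forall k l a b, (k < l)%N -> G k a -> G l b -> (a < b)%N.

Let GU (E : set nat) : set nat := \bigcup_(k in E) G k.

Let GU_disjoint k l a : G k a -> G l a -> k = l.
Proof.
move=> ka la; have [kl|lk|//] := ltngtP k l.
  by have := Glt kl ka la; rewrite ltnn.
by have := Glt lk la ka; rewrite ltnn.
Qed.

(** By induction on the support: an admissible family E_i for x becomes the
    admissible family G(E_i) for y. The only families to which the induction
    hypothesis does not apply have a member containing the whole support, and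
    these cannot be norming because f(2) > 1. *)
Lemma comparison (E : set nat) :
  (forall E' k, E' k -> rnorm (x k) <= N (restr (GU E') y)) ->
  N (restr E x) <= N (restr (GU E) y).
Proof.
move=> xy; have [D xD] := c00_bounded x.
have : forall k, E k -> x k != 0 -> k \in iota 0 D.
  move=> k _ xk; rewrite mem_iota /= ltnNge; apply: contra xk.
  by move=> /xD ->.
move: (iota 0 D) => s sE; have [n sn] : exists n, (size s <= n)%N by exists (size s).
elim: n s sn E sE => [|n IH] s sn E sE.
  rewrite N_restr0 ?N_ge0// => k Ek; apply/eqP; apply: contraT => xk.
  by have := sE k Ek xk; case: (s) sn.
set c := N (restr (GU E) y); set d := N (restr E x).
have c0 : 0 <= c by exact: N_ge0.
have d0 : 0 <= d by exact: N_ge0.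
suff : d <= Num.max c (2 / 3 * d).
  by rewrite le_max => /orP[//|]; lra.
apply: norm_le => [k|m A m2 [A0 Alt]].
  rewrite le_max; apply/orP; left; have [Ek|Ek] := pselect (E k).
    by rewrite restr_in//; exact: xy.
  by rewrite restr_out// (@rnorm0 R C^o).
have fm : 3 / 2 <= f m by exact: weight_ge_3half.
have [[i Ai]|nA] := pselect (exists i, forall k, E k -> x k != 0 -> A i k).
  rewrite (bigD1 i)//= big1 ?addr0.
    rewrite restr_restr (eq_restr (B := E)); last first.
      by move=> k xk; split=> [[]//|Ek]; split=> //; exact: Ai.
    rewrite -/d; apply: (@le_trans _ _ (f m * (2 / 3 * d))).
      by rewrite mulrA -[leLHS]mul1r ler_wpM2r//; lra.
    by rewrite ler_wpM2l ?le_max ?lexx ?orbT//; lra.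
  move=> j ji; rewrite restr_restr N_restr0// => k [Ajk Ek].
  apply/eqP; apply: contraT => xk; have Aik := Ai k Ek xk.
  have [ij|ij|/val_inj ij] := ltngtP i j.
  - by have := Alt i j ij k k Aik Ajk; rewrite ltnn.
  - by have := Alt j i ij k k Ajk Aik; rewrite ltnn.
  - by move: ji; rewrite ij eqxx.
have step i : N (restr (A i) (restr E x)) <= N (restr (GU (A i)) (restr (GU E) y)).
  have [k [Ek xk Aik]] : exists k, [/\ E k, x k != 0 & ~ A i k].
    apply: contrapT => H; apply: nA; exists i => k Ek xk.
    by apply: contrapT => Aik; apply: H; exists k.
  rewrite restr_restr restr_restr.
  have -> : GU (A i) `&` GU E = GU (A i `&` E).
    apply/seteqP; split=> a [].
      by move=> [k1 Ak1 ka] [k2 Ek2 ka2]; rewrite (GU_disjoint ka2 ka) in Ek2; exists k1.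
    by move=> k1 [Ak1 Ek1] ka; split; exists k1.
  apply: (IH (rem k s)).
    by rewrite size_rem ?sE//; move: sn; case: (size s).
  move=> l [Ail El] xl; have := sE l El xl.
  by rewrite (perm_mem (perm_to_rem (sE k Ek xk))) inE => /predU1P[lk|//]; rewrite lk in Ail.
apply: (@le_trans _ _ (f m * c)); last first.
  by rewrite ler_wpM2l ?le_max ?lexx//; lra.
apply: le_trans (ler_sum _ (fun i _ => step i)) _.
apply: increasing_sets_le => //; split=> [i|i j ij a b [k Ak ka] [l Al lb]].
  by have [k Ak] := A0 i; have [a Ga] := G0 k; exists a, k.
exact: Glt (Alt i j ij k l Ak Al) ka lb.
Qed.

End Comparison.

Lemma N_le_coord x y : (forall k, rnorm (x k) <= rnorm (y k)) -> N x <= N y.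
Proof.
move=> xy.
have := @comparison (fun k => [set k]) x y _ _ setT _.
rewrite (_ : \bigcup_(k in _) _ = setT); last first.
  by apply/seteqP; split=> // k _; exists k.
rewrite !restr_id//; apply.
- by move=> k; exists k.
- by move=> k l a b kl -> ->.
- move=> E k Ek; apply: le_trans (xy k) _; apply: le_trans (coord_le _ k).
  by rewrite restr_in//; exists k.
Qed.

Lemma N_restr_le A x : N (restr A x) <= N x.
Proof.
apply: N_le_coord => k /=; case: ifP => // _.
by rewrite (@rnorm0 R C^o) rnorm_ge0.
Qed.

Lemma N_restr_sub A B x : (forall k, x k != 0 -> A k -> B k) ->
  N (restr A x) <= N (restr B x).
Proof.
move=> AB; rewrite (_ : restr A x = restr A (restr B x)) ?N_restr_le//.
by rewrite restr_restr; apply: eq_restr => k xk; split=> [Ak|[]//]; split=> //; exact: AB.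
Qed.

(** With singletons G k this says that the unit vector basis is dominated by
    every normalized block basis, and equivalent to each of its subsequences. *)
Lemma block_comparison (G : nat -> set nat) x y : (forall k, G k !=set0) ->
  (forall k l a b, (k < l)%N -> G k a -> G l b -> (a < b)%N) ->
  (forall k, rnorm (x k) <= N (restr (G k) y)) -> N x <= N y.
Proof.
move=> G0 Glt xy.
have := @comparison G x y G0 Glt setT _; rewrite restr_id// => H.
apply: le_trans (H _) (N_restr_le _ _) => E k Ek.
apply: le_trans (xy k) _; apply: N_restr_sub => a _ Ga.
by exists k.
Qed.

End SchlumprechtNorm.

(** * Partitions as labellings *)

Section Labellings.
Variables (R : realType) (N : c00 R[i] -> R).
Local Notation C := R[i].
Hypothesis normN : is_norm N.
Hypothesis eqN : schlumprecht_equation N.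
Local Notation f := (@weight R).
Implicit Types (x y : c00 C) (lam : nat -> nat).

Definition level lam j : set nat := [set t | lam t = j].

(** Successive sets are the level sets of a nondecreasing labelling. This
    presentation allows empty sets, and turns the refinement of a partition
    into arithmetic on labels. *)
Definition level_sum m lam x := \sum_(j < m) N (restr (level lam j) x).

Definition labelling lam := forall s t, (s <= t)%N -> (lam s <= lam t)%N.

Lemma level_sum_ge0 m lam x : 0 <= level_sum m lam x.
Proof. by apply: sumr_ge0 => i _; exact: N_ge0. Qed.

Lemma level_sum_mono m n lam x : (m <= n)%N -> level_sum m lam x <= level_sum n lam x.
Proof.
move=> mn; rewrite /level_sum (big_ord_widen _ (fun j => N (restr (level lam j) x)) mn).
rewrite [leRHS](bigID (fun i : 'I_n => (i < m)%N))/= lerDl.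
by apply: sumr_ge0 => i _; exact: N_ge0.
Qed.

Lemma level_sum_le m lam x : (0 < m)%N -> labelling lam ->
  level_sum m lam x <= f m * N x.
Proof.
move=> m0 mlam.
pose P j := `[< level lam j !=set0 >].
pose s := [seq j <- iota 0 m | P j].
have ss : (size s <= m)%N by rewrite size_filter -[leqRHS](size_iota 0 m) count_size.
have -> : level_sum m lam x = \sum_(i < size s) N (restr (level lam (nth 0%N s i)) x).
  rewrite -(big_mkord xpredT (fun i => N (restr (level lam (nth 0%N s i)) x))).
  rewrite -(big_nth 0%N xpredT (fun j => N (restr (level lam j) x))).
  rewrite big_filter /level_sum -(big_mkord xpredT (fun j => N (restr (level lam j) x))).
  rewrite /index_iota subn0 [RHS]big_mkcond; apply: eq_bigr => j _.
  rewrite /P; case: asboolP => // nj; apply: (N_restr0 normN) => // k kj.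
  by exfalso; apply: nj; exists k.
have sP i : (i < size s)%N -> level lam (nth 0%N s i) !=set0.
  move=> si; have := mem_nth 0%N si; rewrite mem_filter => /andP[/asboolP].
  by [].
have slt i j : (i < j)%N -> (j < size s)%N -> (nth 0%N s i < nth 0%N s j)%N.
  have /(sortedP 0%N) : sorted ltn s.
    by apply: sorted_filter; [exact: ltn_trans|exact: iota_ltn_sorted].
  move=> sS; elim: j => // j IH; rewrite ltnS leq_eqVlt => /predU1P[->|ij] js.
    exact: sS.
  by apply: ltn_trans (sS j js); apply: IH => //; exact: ltnW.
have [s2|] := leqP 2 (size s); last first.
  case: (size s) => [_|[|//] _]; first by rewrite big_ord0 mulr_ge0 ?N_ge0 ?(ltW (weight_gt0 _ m0)).
  rewrite big_ord_recl big_ord0 addr0.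
  apply: (@le_trans _ _ (N x)); first exact: N_restr_le.
  by rewrite -[leLHS]mul1r ler_wpM2r ?N_ge0 ?weight_ge1.
apply: (@le_trans _ _ (f (size s) * N x)); last first.
  by rewrite ler_wpM2r ?N_ge0// weight_le.
apply: (increasing_sets_le eqN (A := fun i : 'I_(size s) => level lam (nth 0%N s i))) => //.
split=> [i|i j ij a b /= la lb]; first exact: sP.
rewrite ltnNge; apply/negP => /mlam; rewrite la lb leqNgt.
by rewrite slt.
Qed.

Lemma norm_le_levels x (c : R) : (forall k, rnorm (x k) <= c) ->
  (forall m lam, (2 <= m)%N -> labelling lam -> level_sum m lam x <= f m * c) ->
  N x <= c.
Proof.
move=> xc xl; apply: norm_le => // n A n2 [A0 Alt].
pose ind (i : 'I_n) (t : nat) : nat := if `[< exists2 a, A i a & (a <= t)%N >] then i : nat else 0%N.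
pose lam (t : nat) : nat := \max_(i < n) ind i t.
have mlam : labelling lam.
  move=> s t st; apply/bigmax_leqP => i _; apply: leq_trans (leq_bigmax i).
  rewrite /ind; case: asboolP => // -[a Aa a_s]; rewrite asboolT//.
  by exists a => //; exact: leq_trans st.
apply: le_trans (xl _ _ n2 mlam); apply: ler_sum => i _.
apply: (N_restr_sub normN eqN) => // t _ At; rewrite /level /=; apply/eqP.
rewrite eqn_leq; apply/andP; split.
  apply/bigmax_leqP => j _; rewrite /ind; case: asboolP => // -[a Aa a_t].
  by rewrite leqNgt; apply/negP => ij; have := Alt i j ij t a At Aa; rewrite ltnNge a_t.
apply: leq_trans (leq_bigmax i); rewrite /ind asboolT//.
by exists t.
Qed.

Lemma level_sum_bounded x : exists L : R, forall m lam, level_sum m lam x <= L.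
Proof.
have [D xD] := c00_bounded x.
exists (\sum_(k < D) N (restr [set (k : nat)] x)) => m lam.
have xE A : restr A x = \sum_(k < D) restr (A `&` [set (k : nat)]) x.
  apply: c00_ext => t; rewrite c00_sum; have [Dt|tD] := leqP D t.
    rewrite /= xD// if_same big1// => k _ /=; by rewrite if_same.
  rewrite (bigD1 (Ordinal tD))//= big1 ?addr0.
    have [At|At] := pselect (A t); first by rewrite !asboolT.
    by rewrite !asboolF// => -[].
  move=> k kt; rewrite asboolF// => -[_ /= tk].
  by move: kt; rewrite -(inj_eq val_inj) /= tk eqxx.
apply: (@le_trans _ _ (\sum_(j < m) \sum_(k < D) N (restr (level lam j `&` [set (k : nat)]) x))).
  by apply: ler_sum => j _; rewrite xE; exact: N_sum.
rewrite exchange_big; apply: ler_sum => k _.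
have [km|mk] := ltnP (lam k) m.
  rewrite (bigD1 (Ordinal km))//= big1 ?addr0.
    by apply: (N_restr_sub normN eqN) => // t _ [].
  move=> j jk; apply: (N_restr0 normN) => // t [/= tj tk].
  by move: jk; rewrite -(inj_eq val_inj) /= -tj tk eqxx.
rewrite big1 ?N_ge0// => j _; apply: (N_restr0 normN) => // t [/= tj tk].
by have := ltn_ord j; rewrite -tj tk ltnNge mk.
Qed.

(** For large m the quotient is small, as f is unbounded and level sums are not;
    for bounded m only finitely many labellings differ on the support of x. *)
Lemma exists_maximizer m0 x : (0 < m0)%N -> exists m lam,
  [/\ (m0 <= m)%N, labelling lam & forall m' lam', (m0 <= m')%N -> labelling lam' ->
    level_sum m' lam' x / f m' <= level_sum m lam x / f m].
Proof.
move=> m00.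
have fpos m : (m0 <= m)%N -> 0 < f m by move=> m0m; apply: weight_gt0; exact: leq_trans m0m.
have [[m1 [lam1 [m01 mlam1 pos]]]|npos] := pselect (exists m lam,
   [/\ (m0 <= m)%N, labelling lam & 0 < level_sum m lam x / f m]); last first.
  exists m0, id; split=> // m' lam' m0m' mlam'.
  apply: (@le_trans _ _ 0); last by rewrite divr_ge0 ?level_sum_ge0 ?ltW ?fpos.
  by rewrite leNgt; apply/negP => pos; apply: npos; exists m', lam'.
set v := level_sum m1 lam1 x / f m1 in pos.
have [D xD] := c00_bounded x.
have [L sumL] := level_sum_bounded x.
have [M fM] := weight_unbounded (L / v + 1).
have small m lam : (m0 <= m)%N -> (M <= m)%N -> level_sum m lam x / f m <= v.
  move=> m0m Mm; rewrite ler_pdivrMr ?fpos//; apply: le_trans (sumL _ _) _.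
  rewrite -ler_pdivrMl// mulrC; apply: le_trans (weight_le _ Mm).
  by apply: le_trans fM; rewrite lerDl.
pose M' := (maxn (maxn M m0) m1).+1.
have m1M : (m1 < M')%N by rewrite ltnS leq_maxr.
pose I := ('I_M' * {ffun 'I_D -> 'I_M'})%type.
pose lamI (i : I) t : nat := if insub t is Some u then i.2 u else M'.
pose valid (i : I) := (m0 <= i.1)%N && `[< labelling (lamI i) >].
pose valI (i : I) : R := level_sum i.1 (lamI i) x / f i.1.
have cover m lam : (m0 <= m)%N -> (m < M')%N -> labelling lam ->
    exists2 i, valid i & level_sum m lam x / f m = valI i.
  move=> m0m mM' mlam.
  have bd t : (minn (lam t) M'.-1 < M')%N by rewrite ltnS geq_minr.
  pose i : I := (Ordinal mM', [ffun u : 'I_D => Ordinal (bd u)]).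
  have lamE t : (t < D)%N -> lamI i t = minn (lam t) M'.-1.
    by move=> tD; rewrite /lamI insubT /= ffunE.
  exists i.
    apply/andP; split=> //; apply/asboolP => s t st.
    have [tD|Dt] := ltnP t D.
      rewrite !lamE ?(leq_ltn_trans st)// leq_min geq_minr andbT.
      by rewrite geq_min mlam.
    rewrite {2}/lamI insubF; last by rewrite ltnNge Dt.
    rewrite /lamI; case: insub => // u; exact/ltnW/ltn_ord.
  rewrite /valI /=; congr (_ / _); apply: eq_bigr => j _; congr N.
  apply: eq_restr => t xt; have tD : (t < D)%N by rewrite ltnNge; apply: contra xt => /xD ->.
  rewrite /level /= lamE//.
  have jM : (j < M'.-1)%N by apply: leq_trans (ltn_ord j) _; rewrite -ltnS.
  split=> [->|]; first by apply/minn_idPl; exact: ltnW.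
  move=> H; move: jM; rewrite -H gtn_min ltnn orbF => lt_.
  exact/esym/minn_idPl/ltnW.
have m0M : (m0 < M')%N by rewrite ltnS 2!leq_max leqnn orbT.
have [i0 vi0 _] := cover m0 id (leqnn _) m0M (fun s t st => st).
have [i vi imax] : exists2 i, valid i & forall j, valid j -> valI j <= valI i.
  by case: (arg_maxP valI vi0) => i vi imax; exists i.
move: (vi) => /andP[mi /asboolP li].
exists i.1, (lamI i); split=> // m lam m0m mlam.
have [mM'|M'm] := ltnP m M'.
  by have [j vj ->] := cover m lam m0m mM' mlam; exact: imax.
apply: le_trans (small m lam m0m _) _.
  by apply: leq_trans M'm; rewrite /M' leqW// 2!leq_max leqnn.
by rewrite /v; have [j vj ->] := cover m1 lam1 m01 m1M mlam1; exact: imax.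
Qed.

End Labellings.

(** * Upper estimates for blocks *)

Section BlockDomination.
Variables (R : realType) (N : c00 R[i] -> R).
Local Notation C := R[i].
Hypothesis normN : is_norm N.
Hypothesis eqN : schlumprecht_equation N.
Local Notation f := (@weight R).
Local Notation T := (level_sum N).

(** A sequence of successive blocks, the k-th of which is supported by
    [p k, p k.+1), and which behaves like the unit vector of l_1 under
    partitions into fewer than M k sets; M k is large compared with the size of
    the preceding blocks. *)
Variables (p : nat -> nat) (x : nat -> c00 C) (L : nat -> R) (M : nat -> nat).
Hypothesis p0 : p 0 = 0%N.
Hypothesis pS : forall k, (p k < p k.+1)%N.
Hypothesis x_supp : forall k i, x k i != 0 -> (p k <= i < p k.+1)%N.
Hypothesis x_norm : forall k, N (x k) <= 1.
Hypothesis x_levels : forall k m lam, labelling lam -> T m lam (x k) <= L k.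
Hypothesis x_average : forall k m lam, (m < M k)%N -> labelling lam ->
  T m lam (x k) <= 4.
Hypothesis M_mono : forall k l, (k <= l)%N -> (M k <= M l)%N.
Hypothesis M_unbounded : forall m, exists k, (m < M k)%N.
Hypothesis LM : forall k, \sum_(l < k) L l <= f (M k).

Implicit Types (b : c00 C) (lam : nat -> nat).

Lemma block_start_le k l : (k <= l)%N -> (p k <= p l)%N.
Proof.
move=> kl; rewrite -(subnKC kl); elim: (l - k)%N => [|d IH]; first by rewrite addn0.
by rewrite addnS; apply: leq_trans IH (ltnW (pS _)).
Qed.

Lemma block_exists i : exists k, (p k <= i < p k.+1)%N.
Proof.
elim: i => [|i [k /andP[ki ik]]]; first by exists 0%N; rewrite p0 /= -{1}p0.
have [ik'|ik'] := ltnP i.+1 (p k.+1); first by exists k; rewrite (leq_trans ki).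
have -> : i.+1 = p k.+1 by apply/eqP; rewrite eqn_leq ik ik'.
by exists k.+1; rewrite leqnn pS.
Qed.

Lemma block_unique i k l : (p k <= i < p k.+1)%N -> (p l <= i < p l.+1)%N -> k = l.
Proof.
move=> /andP[ki ik] /andP[li il]; have [kl|lk|//] := ltngtP k l.
  by have := leq_trans ik (leq_trans (block_start_le kl) li); rewrite ltnn.
by have := leq_trans il (leq_trans (block_start_le lk) ki); rewrite ltnn.
Qed.

Local Notation comb := (lincomb x).

Lemma combE b i k : (p k <= i < p k.+1)%N -> comb b i = b k * x k i.
Proof.
move=> ki; have [D bD] := c00_bounded b; rewrite (lincombE x bD) c00_sum.
have x0 (l : nat) : l != k -> (b l *: x l) i = 0.
  move=> lk; rewrite c00Z; apply/eqP; rewrite mulf_eq0; apply/orP; right.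
  by apply: contraT => /x_supp li; move: lk; rewrite (block_unique li ki) eqxx.
have [kD|Dk] := ltnP k D; last first.
  rewrite bD// mul0r big1// => l _; apply: x0.
  by rewrite ltn_eqF// (leq_trans (ltn_ord l)).
rewrite (bigD1 (Ordinal kD))//= big1 ?addr0// => l lk; apply: x0.
by move: lk; rewrite -(inj_eq val_inj).
Qed.

Lemma comb_ext b (y : c00 C) : (forall k i, (p k <= i < p k.+1)%N -> y i = b k * x k i) ->
  comb b = y.
Proof.
move=> yE; apply: c00_ext => i; have [k ki] := block_exists i.
by rewrite (combE b ki) (yE k i ki).
Qed.

Lemma combD b c : comb (b + c) = comb b + comb c.
Proof. by have := lincombP x 1 b c; rewrite !scale1r. Qed.

Lemma restr_comb A b K : (forall k i, (p k <= i < p k.+1)%N -> x k i != 0 -> b k != 0 ->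
    A i <-> K k) ->
  restr A (comb b) = comb (restr K b).
Proof.
move=> AK; apply/esym/comb_ext => k i ki.
have [xk|xk] := eqVneq (x k i) 0.
  by rewrite xk mulr0 /= (combE _ ki) xk mulr0 if_same.
have [bk|bk] := eqVneq (b k) 0.
  by rewrite /= (combE _ ki) bk mul0r !if_same mul0r.
have [Kk|Kk] := pselect (K k).
  have Ai : A i by apply/(AK k i ki xk bk).
  by rewrite !restr_in// (combE _ ki).
have Ai : ~ A i by move=> /(AK k i ki xk bk).
by rewrite !restr_out// mul0r.
Qed.

Lemma N_restr_comb A b D : (forall k, (D <= k)%N -> b k = 0) ->
  N (restr A (comb b)) <= \sum_(k < D) rnorm (b k) * N (restr A (x k)).
Proof.
move=> bD; rewrite (lincombE x bD) restr_sum; apply: le_trans (N_sum normN _ _ _) _.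
by apply: ler_sum => k _; rewrite restrZ NZ.
Qed.

Lemma level_sumM m nu lam (y : c00 C) : T (m * nu) lam y =
  \sum_(j < m) \sum_(i < nu) N (restr (level lam (j * nu + i)) y).
Proof.
rewrite /level_sum; elim: m => [|k IH]; first by rewrite mul0n !big_ord0.
by rewrite big_ord_recr /= -IH mulSnr big_split_ord.
Qed.

Lemma level_sum_le_coord m lam (y y' : c00 C) :
  (forall i, rnorm (y i) <= rnorm (y' i)) -> T m lam y <= T m lam y'.
Proof.
move=> yy'; apply: ler_sum => j _; apply: (N_le_coord normN eqN) => i /=.
by case: ifP => // _; rewrite (@rnorm0 R C^o).
Qed.

(** The suprema defining the norm are attained, by exists_maximizer. *)
Lemma norm_attained (y : c00 C) : (exists k, N y <= rnorm (y k)) \/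
  exists n mu, [/\ (2 <= n)%N, labelling mu & f n * N y <= T n mu y].
Proof.
apply: contrapT => /not_orP[nc nl].
have [n [mu [n2 mmu nmax]]] := exists_maximizer normN eqN y (isT : (0 < 2)%N).
have [D yD] := c00_bounded y.
pose c := \big[Num.max/0]_(k < D) rnorm (y k).
have fn : 0 < f n by apply: weight_gt0; exact: ltnW.
have yc k : rnorm (y k) <= c.
  have [kD|Dk] := ltnP k D; first by rewrite /c (bigD1 (Ordinal kD))//= le_max lexx.
  rewrite yD// (@rnorm0 R C^o); apply: (big_ind (fun u => 0 <= u)) => //.
    by move=> u v u0 v0; rewrite le_max u0.
  by move=> l _; exact: rnorm_ge0.
have H : N y <= Num.max c (T n mu y / f n).
  apply: (norm_le_levels normN eqN); first by move=> l; rewrite le_max yc.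
  move=> n' mu' n2' mmu'.
  have fn' : 0 < f n' by apply: weight_gt0; exact: ltnW.
  by rewrite mulrC -ler_pdivrMr// le_max nmax// orbT.
have Nn : T n mu y < f n * N y.
  by rewrite ltNge; apply/negP => H'; apply: nl; exists n, mu.
move: H; rewrite le_max => /orP[H|]; last first.
  by rewrite ler_pdivlMr// mulrC leNgt Nn.
have Ny : 0 < N y by rewrite -(pmulr_rgt0 _ fn); apply: le_lt_trans Nn; exact: level_sum_ge0.
have : c < N y.
  apply: (big_ind (fun u => u < N y)) => // [u v uN vN|k _]; first by rewrite gt_max uN.
  by rewrite ltNge; apply/negP => H'; apply: nc; exists k.
by rewrite ltNge H.
Qed.

(** The partition lam into m sets is chosen to maximize the quotient X among all
    partitions of comb b into at least m0 sets. *)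
Section Node.
Variables (m0 : nat) (b : c00 C) (m : nat) (lam : nat -> nat).
Hypothesis m00 : (0 < m0)%N.
Hypothesis m0m : (m0 <= m)%N.
Hypothesis mlam : labelling lam.
Let z := comb b.
Hypothesis maximal : forall m' lam', (m0 <= m')%N -> labelling lam' ->
  T m' lam' z / f m' <= T m lam z / f m.
Let X := T m lam z / f m.
Let E j := level lam j.

Let m_gt0 : (0 < m)%N. Proof. exact: leq_trans m0m. Qed.
Let fm_gt0 : 0 < f m. Proof. exact: weight_gt0. Qed.
Let X_ge0 : 0 <= X. Proof. by rewrite divr_ge0 ?level_sum_ge0// ltW. Qed.
Let XE : f m * X = \sum_(j < m) N (restr (E j) z).
Proof. by rewrite mulrC /X divfK// gt_eqF. Qed.

(** Cutting some of the sets of the partition further cannot exceed the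
    maximum, while the number of sets enters only through f (m * nu), which is
    at most f m + f nu. *)
Lemma refinement (J : pred nat) (n : nat -> nat) (mu : nat -> nat -> nat)
    (nu : nat) : (0 < nu)%N -> (forall j, labelling (mu j)) ->
  (forall j, (j < m)%N -> J j -> (n j <= nu)%N) ->
  \sum_(j < m | J j) T (n j) (mu j) (restr (E j) z) +
  \sum_(j < m | ~~ J j) N (restr (E j) z) <= (f m + f nu) * X.
Proof.
move=> nu0 mmu nnu.
pose lam' t := (lam t * nu + (if J (lam t) then minn (mu (lam t) t) nu.-1 else 0))%N.
have mmin j t : (minn (mu j t) nu.-1 < nu)%N by rewrite -[ltnRHS](prednK nu0) ltnS geq_minr.
have mlam' : labelling lam'.
  move=> s t st; have := mlam st; rewrite leq_eqVlt => /predU1P[lst|lst].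
    rewrite /lam' lst leq_add2l; case: ifP => // _.
    by rewrite leq_min geq_minr andbT geq_min mmu.
  apply: (@leq_trans (lam s * nu + nu)%N).
    by rewrite leq_add2l; case: ifP => // _; exact: ltnW.
  by rewrite -mulSnr (leq_trans _ (leq_addr _ _))// leq_mul2r lst orbT.
have mnu0 : (0 < m * nu)%N by rewrite muln_gt0 m_gt0.
have m0mnu : (m0 <= m * nu)%N by apply: leq_trans m0m _; rewrite leq_pmulr.
apply: (@le_trans _ _ (f (m * nu) * X)); last by rewrite ler_wpM2r// weightM.
have := maximal m0mnu mlam'; rewrite ler_pdivrMr ?weight_gt0// mulrC.
apply: le_trans; rewrite level_sumM.
rewrite [X in X + _ <= _]big_mkcond [X in _ + X <= _]big_mkcond -big_split /=.
apply: ler_sum => j _; have [Jj|Jj] /= := boolP (J j); last first.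
  rewrite add0r; apply: (@le_trans _ _ (N (restr (level lam' (j * nu + 0)) z))).
    apply: (N_restr_sub normN eqN) => t _ tj; rewrite /level /lam' /= tj (negbTE Jj).
    by rewrite addn0.
  rewrite (bigD1 (Ordinal nu0))//= lerDl; apply: sumr_ge0 => i _; exact: N_ge0.
rewrite addr0.
rewrite /level_sum (big_ord_widen nu (fun i => N (restr (level (mu j) i) (restr (E j) z)))); last exact: nnu.
rewrite [leRHS](bigID (fun i : 'I_nu => (i < n j)%N)) /=.
apply: (@le_trans _ _ (\sum_(i < nu | (i < n j)%N) N (restr (level lam' (j * nu + i)) z))); last first.
  by rewrite lerDl; apply: sumr_ge0 => i _; exact: N_ge0.
apply: ler_sum => i _; rewrite restr_restr; apply: (N_restr_sub normN eqN) => t _ [/= ti tj].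
rewrite /level /lam' /= tj Jj ti; congr (_ + _)%N; apply/minn_idPl.
by rewrite -ltnS prednK.
Qed.

Lemma common_bound (J : pred nat) (n : nat -> nat) (B : R) : 1 <= B ->
  (forall j, (j < m)%N -> J j -> f (n j) <= B) ->
  exists nu, [/\ (0 < nu)%N, f nu <= B & forall j, (j < m)%N -> J j -> (n j <= nu)%N].
Proof.
move=> B1; elim: (m) => [|k IH] nB; first by exists 1%N; rewrite weight1.
have [|nu [nu0 nuB nnu]] := IH; first by move=> j jk; apply: nB; exact: ltnW.
have [Jk|Jk] := boolP (J k); last first.
  exists nu; split=> // j; rewrite ltnS leq_eqVlt => /predU1P[->|]; last exact: nnu.
  by rewrite (negbTE Jk).
exists (maxn nu (n k)); split; first by rewrite leq_max nu0.
  by rewrite /maxn; case: ifP => // _; exact: nB.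
move=> j; rewrite ltnS leq_eqVlt leq_max => /predU1P[->|jk Jj]; first by rewrite leqnn orbT.
by rewrite nnu.
Qed.

(** The blocks before t are small compared with f m, and the others behave like
    unit vectors of l_1 under lam. A block k of the second kind is either
    contained in a single set E j, when its first label lo k and its last label
    hi k are both j, or split; the blocks contained in E j make up y j. *)
Variable t : nat.
Hypothesis Mt : forall k, (k < t)%N -> (M k <= m)%N.
Hypothesis tM : forall k, (t <= k)%N -> (m < M k)%N.

Let lo k := lam (p k).
Let hi k := lam (p k.+1).-1.
Let K j : set nat := [set k | [/\ (t <= k)%N, lo k = j & hi k = j]].
Let y j := comb (restr (K j) b).
Let head := N (restr [set k | (k < t)%N] b).
Let tail := N (restr [set k | (t <= k)%N] b).

Let block_lam k i : (p k <= i < p k.+1)%N -> (lo k <= lam i <= hi k)%N.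
Proof.
move=> /andP[ki ik]; rewrite !mlam//.
by rewrite -ltnS prednK// (leq_ltn_trans _ ik).
Qed.

Let lo_hi k : (lo k <= hi k)%N.
Proof. by have := @block_lam k (p k); rewrite leqnn pS => /(_ isT)/andP[_]. Qed.

Let hi_lo k l : (k < l)%N -> (hi k <= lo l)%N.
Proof.
move=> kl; apply: mlam; apply: leq_trans (leq_pred _) _.
exact: block_start_le.
Qed.

Let y_coord j i : rnorm (y j i) <= rnorm (restr (E j) z i).
Proof.
have [k ki] := block_exists i; rewrite /y (combE _ ki).
have [xk|xk] := eqVneq (x k i) 0; first by rewrite xk mulr0 (@rnorm0 R C^o) rnorm_ge0.
have [Kk|Kk] := pselect (K j k); last first.
  by rewrite restr_out// mul0r (@rnorm0 R C^o) rnorm_ge0.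
have [_ lk hk] := Kk; have := block_lam ki; rewrite lk hk => /andP[ji ij].
have Ei : E j i by apply/eqP; rewrite eqn_leq ij ji.
by rewrite !restr_in// /z (combE _ ki).
Qed.

Variable D : nat.
Hypothesis bD : forall k, (D <= k)%N -> b k = 0.

Let split_block k := (t <= k)%N && (lo k < hi k)%N.
Let rest j := N (restr (E j) (comb (restr [set k | (k < t)%N] b))) +
  \sum_(k < D | split_block k) rnorm (b k) * N (restr (E j) (x k)).
Let splits := \sum_(k < D | split_block k && (lo k < m)%N) rnorm (b k).

Let rest_ge0 j : 0 <= rest j.
Proof.
rewrite addr_ge0 ?N_ge0//; apply: sumr_ge0 => k _.
by rewrite mulr_ge0 ?rnorm_ge0 ?N_ge0.
Qed.

Lemma node_split j : N (restr (E j) z) <= N (y j) + rest j.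
Proof.
pose A : set nat := [set k | (k < t)%N].
pose B : set nat := [set k | (t <= k)%N /\ lo k = hi k].
pose B' : set nat := [set k | split_block k].
have bE : b = restr A b + (restr B b + restr B' b).
  apply: c00_ext => k; rewrite !c00D.
  have [kt|tk] := ltnP k t.
    rewrite [restr A b k]restr_in// [restr B b k]restr_out; last first.
      by move=> [/= tk _]; move: kt; rewrite ltnNge tk.
    rewrite [restr B' b k]restr_out ?addr0// /B' /= /split_block => /andP[tk].
    by move: kt; rewrite ltnNge tk.
  rewrite [restr A b k]restr_out; last by rewrite /A /= ltnNge tk.
  rewrite add0r; have := lo_hi k; rewrite leq_eqVlt => /predU1P[lh|lh].
    rewrite [restr B b k]restr_in// [restr B' b k]restr_out ?addr0//.
    by rewrite /B' /= /split_block lh ltnn andbF.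
  rewrite [restr B b k]restr_out; last by move=> [_ lh']; move: lh; rewrite lh' ltnn.
  by rewrite [restr B' b k]restr_in ?add0r// /B' /= /split_block tk.
rewrite /z {1}bE !combD !restrD; apply: le_trans (ND normN _ _) _.
rewrite /rest [leRHS]addrCA lerD2l; apply: le_trans (ND normN _ _) _; apply: lerD.
  rewrite (_ : restr (E j) _ = y j)// /y (@restr_comb _ _ (K j)).
    congr comb; rewrite restr_restr; apply: eq_restr => k _.
    by split=> [[]//|[tk lk hk]]; split=> //; split=> //; rewrite lk.
  move=> k i ki xk; have [[tk lh]|nB] := pselect (B k); last by rewrite restr_out ?eqxx.
  move=> _; have := block_lam ki; rewrite -lh => /andP[li il].
  have lamE : lam i = lo k by apply/eqP; rewrite eqn_leq il li.
  split=> [Ei|[_ lk _]]; last by rewrite /E /level /= lamE.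
  by split=> //; rewrite -?lh -lamE.
apply: le_trans (N_restr_comb (D := D) _ _) _.
  by move=> k Dk /=; rewrite bD// if_same.
rewrite [leRHS]big_mkcond; apply: ler_sum => k _ /=.
case: asboolP => [kB|nB]; first by rewrite kB.
by rewrite (@rnorm0 R C^o) mul0r; case: ifP => // kB; exfalso; apply: nB.
Qed.

(** All blocks before t except the last one have total size at most f m, as the
    sequence M is lacunary; the last one has norm at most 1, and a partition
    into m sets gains at most the factor f m. *)
Lemma node_head :
  \sum_(j < m) N (restr (E j) (comb (restr [set k | (k < t)%N] b))) <= 2 * f m * head.
Proof.
apply: (@le_trans _ _ (\sum_(k < t) rnorm (b k) * T m lam (x k))).
  under [leRHS]eq_bigr do rewrite /level_sum big_distrr /=.
  rewrite [leRHS]exchange_big /=; apply: ler_sum => j _.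
  apply: le_trans (N_restr_comb (D := t) _ _) _.
    by move=> k tk; rewrite restr_out//= ltnNge tk.
  by apply: ler_sum => k _; rewrite restr_in//; exact: ltn_ord.
have bh k : (k < t)%N -> rnorm (b k) <= head.
  move=> kt; apply: le_trans (coord_le eqN _ k).
  by rewrite restr_in.
have head0 : 0 <= head by exact: N_ge0.
case: (t) Mt bh => [|s] Ms bh.
  by rewrite big_ord0 mulr_ge0// mulr_ge0// ltW.
rewrite big_ord_recr /=.
apply: (@le_trans _ _ (\sum_(k < s) head * L k + head * f m)).
  apply: lerD.
    apply: ler_sum => k _; apply: ler_pM; rewrite ?rnorm_ge0 ?level_sum_ge0//.
      by apply: bh; rewrite ltnS ltnW.
    exact: x_levels.
  apply: ler_pM; rewrite ?rnorm_ge0 ?level_sum_ge0 ?bh//.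
  apply: le_trans (level_sum_le normN eqN _ m_gt0 mlam) _.
  by rewrite -[leRHS]mulr1 ler_wpM2l// ltW.
rewrite -big_distrr /= -mulrDr mulrC ler_wpM2r//.
have := LM s; have : f (M s) <= f m by apply: weight_le; exact: Ms.
by lra.
Qed.

Lemma node_rest : \sum_(j < m) rest j <= 2 * f m * head + 4 * splits.
Proof.
rewrite big_split /=; apply: lerD; first exact: node_head.
rewrite exchange_big /= /splits big_distrr /=.
rewrite big_mkcond [leRHS]big_mkcond /=; apply: ler_sum => k _.
have [sk|//] := boolP (split_block k); rewrite -big_distrr /= mulrC.
have [lm|ml] := ltnP (lo k) m.
  rewrite ler_wpM2r ?rnorm_ge0//; apply: x_average => //.
  by apply: tM; have /andP[] := sk.
rewrite big1 ?mul0r// => j _; apply: (N_restr0 normN) => i Ei.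
apply/eqP; apply: contraT => /x_supp /block_lam /andP[li _].
have := leq_trans ml li; rewrite [lam i]Ei.
by rewrite leqNgt ltn_ord.
Qed.

(** Cutting each K j at an index tt j and isolating the split blocks gives a
    partition of the indices of b into 3 m successive sets. *)
Lemma node_relabel (tt : nat -> nat) :
  \sum_(j < m) (N (restr [set k | (k < tt j)%N] (restr (K j) b)) +
    N (restr [set k | (tt j <= k)%N] (restr (K j) b))) + splits <= (f m + 2) * tail.
Proof.
pose th k := (lo k * 3 + (if (lo k == hi k) then (tt (lo k) <= k) : nat else 2))%N.
have thi k : ((if (lo k == hi k) then (tt (lo k) <= k)%N : nat else 2) <= 2)%N.
  by case: ifP => // _; exact: leq_trans (leq_b1 _) _.
have mth : labelling th.
  move=> k l; rewrite leq_eqVlt => /predU1P[->//|kl].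
  have lkl : (lo k <= lo l)%N by apply: leq_trans (lo_hi k) (hi_lo kl).
  move: (lkl); rewrite leq_eqVlt => /predU1P[lE|lt_]; last first.
    apply: (@leq_trans (lo k * 3 + 3)%N); first by rewrite leq_add2l; exact: leq_trans (thi k) _.
    by rewrite -mulSnr (leq_trans _ (leq_addr _ _))// leq_mul2r.
  have hE : hi k = lo k.
    by apply/eqP; rewrite eqn_leq lo_hi andbT lE hi_lo.
  rewrite /th lE leq_add2l -lE hE eqxx.
  case: ifP => _; last exact: leq_trans (leq_b1 _) _.
  by have [tk|//] := leqP (tt (lo k)) k; rewrite (leq_trans tk (ltnW kl)).
have m30 : (0 < m * 3)%N by rewrite muln_gt0 m_gt0.
apply: (@le_trans _ _ (T (m * 3) th (restr [set k | (t <= k)%N] b))); last first.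
  apply: le_trans (level_sum_le normN eqN _ m30 mth) _.
  by rewrite ler_wpM2r ?N_ge0// mulnC weight_mul3.
rewrite level_sumM.
have splitsE : splits = \sum_(j < m) \sum_(k < D | split_block k && (lo k == j)) rnorm (b k).
  under [RHS]eq_bigr do rewrite big_mkcond.
  rewrite exchange_big /= /splits big_mkcond; apply: eq_bigr => k _.
  have [sk|//] := boolP (split_block k); last by rewrite big1.
  rewrite /=; have [lm|ml] := ltnP (lo k) m.
    rewrite (bigD1 (Ordinal lm))//= eqxx big1 ?addr0// => j jk.
    by rewrite eq_sym; move: jk; rewrite -(inj_eq val_inj) /= => /negbTE ->.
  rewrite big1// => j _; rewrite gtn_eqF//.
  by apply: leq_trans ml.
rewrite splitsE -big_split /=; apply: ler_sum => j _.
rewrite !big_ord_recr big_ord0 /= add0r !restr_restr.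
apply: lerD; first apply: lerD.
- apply: (N_restr_sub normN eqN) => k _ [/= kt [tk lk hk]]; split=> //.
  by rewrite /level /th /= lk hk eqxx leqNgt kt.
- apply: (N_restr_sub normN eqN) => k _ [/= kt [tk lk hk]]; split=> //.
  by rewrite /level /th /= lk hk eqxx kt.
have [[k [kD sk lk]]|nk] := pselect (exists k : 'I_D, [/\ true, split_block k & lo k = j]); last first.
  rewrite big1 ?N_ge0// => k /andP[sk /eqP lk]; exfalso; apply: nk.
  by exists k.
rewrite (big_pred1 k); last first.
  move=> l /=; apply/andP/eqP => [[sl /eqP ll]|->]; last by rewrite lk.
  apply/val_inj => /=; have /andP[_ shk] := sk; have /andP[_ shl] := sl.
  have [kl|kl|//] := ltngtP (l : nat) k.
    by have := leq_trans shl (hi_lo kl); rewrite ll lk ltnn.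
  by have := leq_trans shk (hi_lo kl); rewrite ll lk ltnn.
apply: le_trans (coord_le eqN _ k); have /andP[tk shk] := sk.
rewrite restr_in//; split=> //; rewrite /level /th /= lk.
by rewrite -lk ltn_eqF.
Qed.

(** The sets of the partition are classified by the weight of a partition
    norming the vector that they contain: refining those of small weight gains
    at least a factor 3 / 2, those of weight comparable with f m gain more than
    enough, and only the others, whose weight exceeds 4 f m, survive. Along a
    branch of such sets the errors form a convergent series. *)
Lemma node_bound : 2500 <= f m ->
  (forall j n mu, (j < m)%N -> labelling mu -> 4 * f m <= f n ->
    f n * N (y j) <= T n mu (y j) ->
    exists t', N (y j) <=
      12 * N (restr [set k | (k < t')%N] (restr (K j) b)) +
      12 * (1 + 15 / Num.sqrt (f m)) * N (restr [set k | (t' <= k)%N] (restr (K j) b))) ->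
  X <= 12 * head + 12 * (1 + 30 / Num.sqrt (f m)) * tail.
Proof.
move=> fm2500 child; set s := Num.sqrt (f m).
have fm0 : 0 <= f m by exact: ltW.
have s2 : s ^+ 2 = f m by rewrite sqr_sqrtr.
have s50 : 50 <= s.
  by rewrite -(ler_pXn2r (n := 2)) ?nnegrE ?sqrtr_ge0// s2; lra.
have head0 : 0 <= head by exact: N_ge0.
have tail0 : 0 <= tail by exact: N_ge0.
have /choice[g gP] j : exists g : nat * (nat -> nat), labelling g.2 /\
    ((g.1 = 0%N /\ exists k, N (y j) <= rnorm (y j k)) \/
     ((2 <= g.1)%N /\ f g.1 * N (y j) <= T g.1 g.2 (y j))).
  have [yc|[n [mu [n2 mmu yn]]]] := norm_attained (y j).
    by exists (0%N, id); split; [move=> ? ?|left].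
  by exists (n, mu); split=> //; right.
pose n j := (g j).1; pose mu j := (g j).2.
have mmu j : labelling (mu j) by have [] := gP j.
pose W j := N (y j).
have W0 j : 0 <= W j by exact: N_ge0.
have TW j : (2 <= n j)%N -> f (n j) * W j <= T (n j) (mu j) (restr (E j) z).
  move=> n2; have [_ [[nj0 _]|[_ H]]] := gP j; first by move: n2; rewrite /n nj0.
  by apply: le_trans H _; apply: level_sum_le_coord => i; exact: y_coord.
pose J2 j := (2 <= n j)%N && (f (n j) < s).
pose J1 j := (2 <= n j)%N && (s <= f (n j)) && (f (n j) < 4 * f m).
(* J2 collects the sets refined by few pieces, and J1 those of intermediate
   weight; W j is negligible on both in comparison with f m * X. *)
have class1 : \sum_(j < m | J1 j) W j <= 5 * s * X.
  have [||nu [nu0 nuB nnu]] := @common_bound J1 n (4 * f m).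
  - by lra.
  - by move=> j _ /andP[_ /ltW].
  have H := refinement nu0 mmu nnu.
  have {}H : \sum_(j < m | J1 j) s * W j <= 5 * f m * X.
    apply: (@le_trans _ _ ((f m + f nu) * X)); last first.
      by rewrite ler_wpM2r//; lra.
    apply: le_trans H; rewrite -[leLHS]addr0; apply: lerD; last first.
      by apply: sumr_ge0 => j _; exact: N_ge0.
    apply: ler_sum => j /andP[/andP[n2 sf] _]; apply: le_trans (TW j n2).
    by rewrite ler_wpM2r.
  have s0 : 0 < s by lra.
  rewrite -(ler_pM2l s0) big_distrr /=; apply: le_trans H _.
  by rewrite -s2 le_eqVlt; apply/orP; left; apply/eqP; ring.
have class2 : \sum_(j < m | J2 j) W j <= 2 * s * X + 2 * \sum_(j < m) rest j.
  have [||nu [nu0 nuB nnu]] := @common_bound J2 n s.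
  - by lra.
  - by move=> j _ /andP[_ /ltW].
  have H := refinement nu0 mmu nnu.
  have H1 : 3 / 2 * \sum_(j < m | J2 j) W j <=
      \sum_(j < m | J2 j) T (n j) (mu j) (restr (E j) z).
    rewrite big_distrr /=; apply: ler_sum => j /andP[n2 _].
    apply: le_trans (TW j n2); rewrite ler_wpM2r//; exact: weight_ge_3half.
  have H2 : f m * X <= \sum_(j < m | J2 j) W j + \sum_(j < m) rest j +
      \sum_(j < m | ~~ J2 j) N (restr (E j) z).
    rewrite XE (bigID (fun j : 'I_m => J2 j)) /= lerD2r.
    rewrite [X in _ <= _ + X](bigID (fun j : 'I_m => J2 j)) /= addrA -big_split /=.
    rewrite -[leLHS]addr0; apply: lerD; last by apply: sumr_ge0.
    by apply: ler_sum => j _; exact: node_split.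
  have H3 : f nu * X <= s * X by rewrite ler_wpM2r.
  move: H H1 H2 H3; rewrite mulrDl -(mulrA 2).
  move: (f m * X) (f nu * X) (s * X) (\sum_(j < m) rest j).
  move: (\sum_(j < m | J2 j) W j) (\sum_(j < m | ~~ J2 j) N (restr (E j) z)).
  move: (\sum_(j < m | J2 j) T (n j) (mu j) (restr (E j) z)) => u1 u2 u3 u4 u5 u6 u7.
  by lra.
pose J0 j := ~~ J1 j && ~~ J2 j.
have total : f m * X <= \sum_(j < m | J0 j) W j + 5 * s * X + 2 * s * X +
    3 * \sum_(j < m) rest j.
  have H : f m * X <= \sum_(j < m) W j + \sum_(j < m) rest j.
    by rewrite XE -big_split /=; apply: ler_sum => j _; exact: node_split.
  have HW : \sum_(j < m) W j <= \sum_(j < m | J0 j) W j +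
      \sum_(j < m | J1 j) W j + \sum_(j < m | J2 j) W j.
    rewrite [\sum_(j < m | J0 j) _]big_mkcond [\sum_(j < m | J1 j) _]big_mkcond.
    rewrite [\sum_(j < m | J2 j) _]big_mkcond -!big_split /=.
    apply: ler_sum => j _; rewrite /J0; move: (W j) (W0 j) => w w0.
    by case: (J1 j); case: (J2 j) => /=; rewrite ?addr0 ?add0r ?lerDl.
  move: H HW class1 class2.
  move: (f m * X) (_ * s * X) (2 * s * X) (\sum_(j < m) rest j) (\sum_(j < m) W j).
  move: (\sum_(j < m | J0 j) W j) (\sum_(j < m | J1 j) W j).
  by move: (\sum_(j < m | J2 j) W j) => u1 u2 u3 u4 u5 u6 u7 u8; lra.
have /choice[tt ttP] j : exists t', (j < m)%N -> J0 j -> W j <=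
      12 * N (restr [set k | (k < t')%N] (restr (K j) b)) +
      12 * (1 + 15 / s) * N (restr [set k | (t' <= k)%N] (restr (K j) b)).
  have [jm|mj] := ltnP j m; last by exists 0%N.
  have [J0j|nJ0] := boolP (J0 j); last by exists 0%N.
  have [_ [[_ [i yi]]|[n2 yn]]] := gP j.
    exists D => _ _; have [k ki] := block_exists i.
    rewrite -[leLHS]addr0; apply: lerD; last first.
      by rewrite !mulr_ge0 ?N_ge0 ?addr_ge0 ?divr_ge0 ?sqrtr_ge0.
    apply: le_trans yi _; rewrite /y (combE _ ki) rnormM.
    set c := restr (K j) b; have cD : restr [set k | (k < D)%N] c = c.
      by apply: restr_id => l; apply: contraR; rewrite /= -leqNgt => /bD; rewrite /c /= => ->; rewrite if_same.
    rewrite cD; apply: (@le_trans _ _ (N c * 1)).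
      apply: ler_pM; rewrite ?rnorm_ge0// ?(@rnorm_ge0 R C^o) ?coord_le//.
      by apply: le_trans (coord_le eqN _ _) (x_norm k).
    by rewrite mulr1 -[leLHS]mul1r ler_wpM2r ?N_ge0// ler1n.
  have fn : 4 * f m <= f (n j).
    move: J0j; rewrite /J0 /J1 /J2 -/(n j) n2 /= -!leNgt => /andP[].
    by rewrite negb_and -ltNge -leNgt => /orP[H1 H2|//]; lra.
  by have [t' Ht'] := child j _ _ jm (mmu j) fn yn; exists t'.
(* The coefficient 12 absorbs the error 3 * 4 * splits of node_rest. *)
have class0 : \sum_(j < m | J0 j) W j + 12 * splits <= 12 * (1 + 15 / s) * ((f m + 2) * tail).
  have s150 : 0 <= 15 / s by rewrite divr_ge0// sqrtr_ge0.
  have splits0 : 0 <= splits by apply: sumr_ge0 => k _; exact: (@rnorm_ge0 R C^o).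
  apply: (@le_trans _ _ (12 * (1 + 15 / s) * (\sum_(j < m) (N (restr [set k | (k < tt j)%N] (restr (K j) b)) +
    N (restr [set k | (tt j <= k)%N] (restr (K j) b))) + splits))); last first.
    by rewrite ler_wpM2l ?node_relabel// mulr_ge0// addr_ge0.
  rewrite mulrDr; apply: lerD; last by rewrite ler_wpM2r//; lra.
  rewrite big_distrr /= big_mkcond; apply: ler_sum => j _; case: ifP => [J0j|_].
    apply: le_trans (ttP j (ltn_ord j) J0j) _; rewrite [leRHS]mulrDr lerD2r.
    by rewrite ler_wpM2r ?N_ge0//; lra.
  by rewrite !mulr_ge0 ?addr_ge0 ?N_ge0.
have H := node_rest.
have main : (s ^+ 2 - 7 * s) * X <=
    6 * s ^+ 2 * head + 12 * (1 + 15 / s) * ((s ^+ 2 + 2) * tail).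
  by rewrite s2; move: total class0 H; lra.
have ss : 0 < s ^+ 2 - 7 * s by nra.
rewrite -(ler_pM2l ss); apply: le_trans main _.
rewrite [leRHS]mulrDr; apply: lerD.
  by rewrite !mulrA ler_wpM2r//; nra.
rewrite !mulrA ler_wpM2r//.
have s0 : 0 < s by lra.
rewrite -subr_ge0.
have -> : (s ^+ 2 - 7 * s) * 12 * (1 + 30 / s) - 12 * (1 + 15 / s) * (s ^+ 2 + 2) =
  12 / s * (8 * s ^+ 2 - 212 * s - 30) by field; rewrite gt_eqF.
apply: mulr_ge0; first by rewrite divr_ge0 ?ler0n// ltW.
by nra.
Qed.

End Node.

(** Induction on the support of b: the vectors y j that are normed by partitions
    of weight at least 4 f m satisfy the same bound with an error halved, since
    sqrt (f n) >= 2 sqrt (f m). If some K j contains the whole support, then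
    so does E j, so that N z is at most the quotient of lam, which is at most
    N z / f m; hence z = 0. *)
Lemma head_tail_bound m0 b m lam : 2500 <= f m0 -> (m0 <= m)%N -> labelling lam ->
  (forall m' lam', (m0 <= m')%N -> labelling lam' ->
     T m' lam' (comb b) / f m' <= T m lam (comb b) / f m) ->
  exists t, T m lam (comb b) / f m <= 12 * N (restr [set k | (k < t)%N] b) +
    12 * (1 + 30 / Num.sqrt (f m)) * N (restr [set k | (t <= k)%N] b).
Proof.
move=> fm0; have m00 : (0 < m0)%N.
  by case: (m0) fm0 => //; rewrite /weight addr0 /log2 ln1 mul0r; lra.
have [D bD] := c00_bounded b.
have : forall k, b k != 0 -> k \in iota 0 D.
  by move=> k bk; rewrite mem_iota /= ltnNge; apply: contra bk => /bD ->.
move: (iota 0 D) => s; move: {D bD} (size s) {-2}s (erefl (size s)).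
move=> n; elim/ltn_ind: n b m lam => n IH b m lam {}s sn bs m0m mlam maximal.
have m_gt0 : (0 < m)%N by exact: leq_trans m0m.
have fm2500 : 2500 <= f m by apply: le_trans fm0 (weight_le _ m0m).
have [D bD] := c00_bounded b.
have [t mt tmin] := ex_minnP (M_unbounded m).
have Mt k : (k < t)%N -> (M k <= m)%N.
  by move=> kt; rewrite leqNgt; apply/negP => /tmin; rewrite leqNgt kt.
have tM k : (t <= k)%N -> (m < M k)%N.
  by move=> tk; apply: leq_trans mt (M_mono tk).
exists t; apply: (node_bound m00 m0m mlam maximal Mt tM bD fm2500).
move=> j nj mu jm mmu fn yn.
set K := [set k | _] in yn *; set c := restr K b in yn *.
have fm_gt0 : 0 < f m by exact: weight_gt0.
have fn_gt0 : 0 < f nj by lra.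
have mn : (m0 <= nj)%N.
  apply: leq_trans m0m _; apply: ltnW; apply: (@weight_lt R).
  by lra.
have Nc : N (comb c) <= T nj mu (comb c) / f nj by rewrite ler_pdivlMr// mulrC.
have [[k [bk Kk]]|nK] := pselect (exists k, b k != 0 /\ ~ K k).
  have [||||||t' Ht'] := IH (size (rem k s)) _ c nj mu (rem k s) => //.
  - by rewrite -sn size_rem ?bs//; have := bs k bk; case: (s).
  - move=> l; rewrite /c; have [Kl|Kl] := pselect (K l); last by rewrite restr_out ?eqxx.
    rewrite restr_in// => bl; have := bs l bl.
    rewrite (perm_mem (perm_to_rem (bs k bk))) inE => /predU1P[lk|//].
    by move: Kl; rewrite lk => /Kk.
  - move=> m' lam' m0m' mlam'; apply: le_trans Nc.
    have m'0 : (0 < m')%N by exact: leq_trans m0m'.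
    by rewrite ler_pdivrMr ?weight_gt0// mulrC level_sum_le.
  exists t'; apply: le_trans Nc _; apply: le_trans Ht' _; rewrite lerD2l.
  apply: ler_wpM2r; first exact: N_ge0.
  rewrite ler_pM2l// lerD2l.
  have s0 : 0 < Num.sqrt (f m) by rewrite sqrtr_gt0.
  have s1 : 0 < Num.sqrt (f nj) by rewrite sqrtr_gt0.
  have ss : 2 * Num.sqrt (f m) <= Num.sqrt (f nj).
    have -> : 2 = Num.sqrt (2 ^+ 2 : R) by rewrite sqrtr_sqr ger0_norm.
    rewrite -sqrtrM ?exprn_ge0// ler_sqrt; last exact: ltW.
    by rewrite -natrX.
  rewrite ler_pdivrMr// mulrAC ler_pdivlMr// (_ : 30 = 15 * 2); last by rewrite -natrM.
  by rewrite -mulrA ler_wpM2l.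
have cb : c = b by apply: restr_id => k bk; apply: contrapT => Kk; apply: nK; exists k.
rewrite cb in yn Nc *; set z := comb b in yn Nc maximal *.
have zj : T m lam z <= N z.
  rewrite /level_sum (bigD1 (Ordinal jm))//= big1 ?addr0; first exact: N_restr_le.
  move=> i ij; apply: (N_restr0 normN) => l li; have [k kl] := block_exists l.
  rewrite /z (combE _ kl); have [->|bk] := eqVneq (b k) 0; first by rewrite mul0r.
  have [_ lk hk] : K k by apply: contrapT => Kk; apply: nK; exists k.
  have /andP[kl1 kl2] := kl.
  have H1 : (j <= lam l)%N by rewrite -lk mlam.
  have H2 : (lam l <= j)%N.
    by rewrite -hk mlam// -ltnS prednK// (leq_ltn_trans _ kl2).
  exfalso; move: ij; rewrite -(inj_eq val_inj) /= => /eqP; apply.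
  by rewrite -li; apply/eqP; rewrite eqn_leq H1 H2.
have H : N z <= T m lam z / f m by apply: le_trans Nc _; exact: maximal.
have z0 : 0 <= N z by exact: N_ge0.
have : N z * f m <= N z by rewrite -ler_pdivlMr// (le_trans H)// ler_wpM2r// invr_ge0 ltW.
move=> H'; have zle0 : N z <= 0.
  rewrite leNgt; apply/negP => z1; move: H'; rewrite ger_pMr// leNgt.
  by rewrite (lt_le_trans _ fm2500)// ltr1n.
exists 0%N; apply: le_trans zle0 _.
by rewrite addr_ge0 ?mulr_ge0 ?N_ge0 ?addr_ge0 ?divr_ge0 ?sqrtr_ge0.
Qed.

(** The coordinates of comb b are handled by x_norm, and partitions into few
    sets by counting them as partitions into m0 sets, at the cost of a constant
    factor. *)
Theorem block_domination : exists K : R, forall b, N (comb b) <= K * N b.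
Proof.
have [m0 fm0] := @weight_unbounded R 2500.
have m00 : (2 <= m0)%N.
  apply: (@weight_lt R 1); rewrite weight1; lra.
have fm0_gt0 : 0 < f m0 by lra.
exists (f m0 * 32) => b.
have b0 : 0 <= N b by exact: N_ge0.
have [m [lam [m0m mlam maximal]]] := exists_maximizer normN eqN (comb b) (ltnW m00).
have [t bt] := head_tail_bound fm0 m0m mlam maximal.
have s50 : 50 <= Num.sqrt (f m).
  have fm : 0 <= f m by rewrite ltW// weight_gt0// (leq_trans (ltnW m00)).
  rewrite -(ler_pXn2r (n := 2)) ?nnegrE ?sqrtr_ge0// sqr_sqrtr//.
  by have := @weight_le R _ _ m0m; lra.
have V32 : T m lam (comb b) / f m <= 32 * N b.
  apply: le_trans bt _.
  have H1 := N_restr_le normN eqN [set k | (k < t)%N] b.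
  have H2 := N_restr_le normN eqN [set k | (t <= k)%N] b.
  have H3 : 12 * (1 + 30 / Num.sqrt (f m)) <= 20.
    have : 30 / Num.sqrt (f m) <= 2 / 3 by rewrite ler_pdivrMr; lra.
    by lra.
  have H4 := N_ge0 normN (restr [set k | (t <= k)%N] b).
  have H5 : 12 * (1 + 30 / Num.sqrt (f m)) * N (restr [set k | (t <= k)%N] b) <= 20 * N b.
    by apply: ler_pM => //; rewrite mulr_ge0// addr_ge0// divr_ge0// sqrtr_ge0.
  by lra.
apply: (norm_le_levels normN eqN) => [i|n mu n2 mmu].
  have [k ki] := block_exists i; rewrite (combE _ ki) rnormM.
  apply: (@le_trans _ _ (N b * 1)).
    apply: ler_pM; rewrite ?(@rnorm_ge0 R C^o) ?coord_le//.
    by apply: le_trans (coord_le eqN _ _) (x_norm k).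
  by rewrite mulrC ler_wpM2r//; lra.
have fn1 : 1 <= f n by apply: weight_ge1; exact: ltnW.
pose n' := maxn n m0.
have m0n' : (m0 <= n')%N by rewrite leq_maxr.
have fn' : 0 < f n' by apply: weight_gt0; exact: leq_trans (ltnW m00) m0n'.
apply: le_trans (level_sum_mono normN mu _ (leq_maxl n m0)) _.
have := le_trans (maximal n' mu m0n' mmu) V32; rewrite ler_pdivrMr// mulrC.
move=> /le_trans; apply.
apply: (@le_trans _ _ (f n * f m0 * (32 * N b))); last by rewrite !mulrA.
apply: ler_wpM2r; first by rewrite mulr_ge0.
rewrite /n' /maxn; case: ifP => _; first by rewrite ler_peMl// ltW.
by rewrite ler_peMr//; lra.
Qed.

End BlockDomination.

(** * Averages behaving like unit vectors of l_1 *)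

Section Averages.
Variables (R : realType) (N : c00 R[i] -> R).
Local Notation C := R[i].
Hypothesis normN : is_norm N.
Hypothesis eqN : schlumprecht_equation N.
Local Notation f := (@weight R).
Local Notation T := (level_sum N).

Lemma level_sum_sum m lam (I : Type) (s : seq I) (P : pred I) (F : I -> c00 C) :
  T m lam (\sum_(i <- s | P i) F i) <= \sum_(i <- s | P i) T m lam (F i).
Proof.
rewrite /level_sum exchange_big /=; apply: ler_sum => j _.
by rewrite restr_sum; exact: N_sum.
Qed.

(** An interval meets at most one set more than the number of steps of lam along
    it. *)
Lemma level_sum_interval m lam (x : c00 C) u v : labelling lam ->
  (forall i, x i != 0 -> (u <= i < v)%N) ->
  T m lam x <= (\sum_(j < m) ((lam u <= j) && (j < lam v) : nat) + 1)%N%:R * N x.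
Proof.
move=> mlam xuv; have Nx := N_ge0 normN x.
have step (j : 'I_m) : N (restr (level lam j) x) <=
    (((lam u <= j) && (j < lam v)) + (j == lam v :> nat))%N%:R * N x.
  have [jin|jout] := boolP ((lam u <= j)%N && (j <= lam v)%N); last first.
    rewrite N_restr0 ?mulr_ge0// => i ij; apply/eqP; apply: contraT => /xuv /andP[ui iv].
    by move: jout; rewrite -ij !mlam// ltnW.
  have [uj jv] := andP jin; apply: (@le_trans _ _ (1 * N x)).
    by rewrite mul1r N_restr_le.
  rewrite ler_wpM2r// ler1n uj /=.
  by move: jv; rewrite leq_eqVlt => /orP[->|->]; rewrite ?addn1 ?add1n.
apply: le_trans (ler_sum _ (fun j _ => step j)) _.
rewrite -big_distrl /= ler_wpM2r// -natr_sum ler_nat big_split /= leq_add2l.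
have [vm|mv] := ltnP (lam v) m.
  rewrite (bigD1 (Ordinal vm))//= eqxx big1// => j jv.
  by move: jv; rewrite -(inj_eq val_inj) /= => /negbTE ->.
by rewrite big1// => j _; rewrite ltn_eqF// (leq_trans (ltn_ord j)).
Qed.

(** An average of n successive vectors of norm at most 2 / n behaves, up to a
    factor 4, like a unit vector of l_1 under partitions into at most n sets. *)
Lemma average_levels n (u : nat -> c00 C) (a : nat -> nat) m lam :
  (0 < n)%N -> (m <= n)%N -> labelling lam ->
  (forall r, (a r <= a r.+1)%N) ->
  (forall r i, u r i != 0 -> (a r <= i < a r.+1)%N) ->
  (forall r, (r < n)%N -> N (u r) <= 2 / n%:R) ->
  T m lam (\sum_(r < n) u r) <= 4.
Proof.
move=> n0 mn mlam aS au un.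
have n0R : 0 < n%:R :> R by rewrite ltr0n.
apply: le_trans (level_sum_sum _ _ _ _ _) _.
pose c r := (\sum_(j < m) ((lam (a r) <= j) && (j < lam (a r.+1)) : nat) + 1)%N.
apply: (@le_trans _ _ (\sum_(r < n) (c r)%:R * (2 / n%:R))).
  apply: ler_sum => r _; apply: le_trans (level_sum_interval _ mlam (au r)) _.
  by rewrite ler_wpM2l// un.
rewrite -big_distrl /= -natr_sum.
have cm : (\sum_(r < n) c r <= m + n)%N.
  rewrite big_split /= sum1_card card_ord leq_add2r exchange_big /=.
  rewrite -[leqRHS]card_ord -sum1_card; apply: leq_sum => j _.
  suff H k : (\sum_(r < k) ((lam (a r) <= j) && (j < lam (a r.+1)) : nat) <=
      nat_of_bool (j < lam (a k)))%N by apply: leq_trans (H n) (leq_b1 _).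
  elim: k => [|k IH]; first by rewrite big_ord0.
  rewrite big_ord_recr /=; have kS : (lam (a k) <= lam (a k.+1))%N by apply: mlam.
  apply: (leq_trans (leq_add IH (leqnn _))).
  have [jk|kj] := ltnP j (lam (a k)); first by rewrite (leq_trans jk kS).
  by rewrite add0n.
rewrite mulrA ler_pdivrMr// -natrM -(natrM _ 4) ler_nat.
by apply: (@leq_trans ((m + n) * 2)); [rewrite leq_mul2r cm orbT|lia].
Qed.

Section BlockSums.
Variables (y : nat -> c00 C) (p : nat -> nat).
Hypothesis p0 : p 0 = 0%N.
Hypothesis pS : forall k, (p k < p k.+1)%N.
Hypothesis y_supp : forall k i, y k i != 0 -> (p k <= i < p k.+1)%N.
Hypothesis y_norm : forall k, N (y k) = 1.

Let S a b : c00 C := \sum_(a <= q < b) y q.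

Let S_coord a b i k : (p k <= i < p k.+1)%N -> (a <= k < b)%N -> S a b i = y k i.
Proof.
move=> ki kab; rewrite /S c00_sum (bigD1_seq k)/= ?mem_index_iota ?iota_uniq//.
rewrite big1_seq ?addr0// => l /andP[lk _]; apply/eqP; apply: contraT => /y_supp li.
by move: lk; rewrite (block_unique pS li ki) eqxx.
Qed.

Let S_supp a b i : S a b i != 0 -> (p a <= i < p b)%N.
Proof.
rewrite /S c00_sum => /eqP H; apply: contrapT => ni; apply: H.
rewrite big1_seq// => l /andP[_]; rewrite mem_index_iota => /andP[al lb].
apply/eqP; apply: contraT => /y_supp/andP[li il]; exfalso; apply: ni.
by rewrite (leq_trans (block_start_le pS al) li) (leq_trans il (block_start_le pS lb)).
Qed.

Let N_S_ge1 a b : (a < b)%N -> 1 <= N (S a b).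
Proof.
move=> ab; rewrite -(y_norm a); apply: (N_le_coord normN eqN) => i.
have [k ki] := block_exists p0 pS i.
have [->|yi] := eqVneq (y a i) 0; first by rewrite (@rnorm0 R C^o) rnorm_ge0.
by rewrite (@S_coord a b i a)// ?leqnn//; exact: y_supp.
Qed.

Let block_label : exists lam, labelling lam /\
  forall k i, (p k <= i < p k.+1)%N -> lam i = k.
Proof.
have /choice[lam lamP] := block_exists p0 pS.
exists lam; split=> [s t st|k i ki]; last exact: (block_unique pS (lamP i) ki).
rewrite leqNgt; apply/negP => ts.
have /andP[_ H1] := lamP t; have /andP[H2 _] := lamP s.
have := leq_trans (leq_trans H1 (block_start_le pS ts)) (leq_trans H2 st).
by rewrite ltnn.
Qed.

Let N_S_lower n : (0 < n)%N -> n%:R <= f n * N (S 0 n).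
Proof.
move=> n0; have [lam [mlam lamP]] := block_label.
apply: le_trans (level_sum_le normN eqN (S 0 n) n0 mlam).
have -> : n%:R = \sum_(j < n) (1 : R) by rewrite sumr_const card_ord.
apply: ler_sum => j _; rewrite -(y_norm j); apply: (N_le_coord normN eqN) => i.
have [->|yi] := eqVneq (y j i) 0; first by rewrite (@rnorm0 R C^o) rnorm_ge0.
have ji := y_supp yi; rewrite restr_in; last exact: lamP.
by rewrite (@S_coord 0 n i j)//=.
Qed.

Let S_split a n k : S (a * n * k) (a.+1 * n * k) =
  \sum_(r < n) S ((a * n + r) * k) ((a * n + r).+1 * k).
Proof.
suff H t : S (a * n * k) ((a * n + t) * k) =
    \sum_(r < t) S ((a * n + r) * k) ((a * n + r).+1 * k) by rewrite -H mulSn addnC.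
elim: t => [|t IH]; first by rewrite addn0 big_ord0 /S big_geq.
rewrite big_ord_recr /= -IH /S -big_cat_nat//=; first by rewrite addnS.
  by rewrite leq_mul2r leq_addr orbT.
by rewrite leq_mul2r leqnSn orbT.
Qed.

(** James' argument: if no such average existed, the norm of the sum of n ^ J
    blocks would be at most (n / 2) ^ J, although it is at least n ^ J / f(n ^ J)
    and f grows only logarithmically. *)
Lemma average_exists n : (0 < n)%N -> exists a b, (a < b)%N /\
  forall m lam, (m <= n)%N -> labelling lam ->
    T m lam ((N (S a b))^-1%:C%C *: S a b) <= 4.
Proof.
move=> n0; have n0R : 0 < n%:R :> R by rewrite ltr0n.
(* The a-th group of n ^ i consecutive blocks is composed of the groups
   U i (a * n + r) for r < n. *)
pose U i a := S (a * n ^ i) (a.+1 * n ^ i).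
have [[i [a iaP]]|none] := pselect (exists i a, forall r, (r < n)%N ->
    n%:R / 2 * N (U i (a * n + r)%N) <= N (U i.+1 a)).
  pose A := N (U i.+1 a).
  have ni0 : (0 < n ^ i.+1)%N by rewrite expn_gt0 n0.
  exists (a * n ^ i.+1)%N, (a.+1 * n ^ i.+1)%N; split.
    by rewrite ltn_mul2r ni0 /=.
  have A1 : 1 <= A by apply: N_S_ge1; rewrite ltn_mul2r ni0 /=.
  have A0 : 0 < A by lra.
  move=> m lam mn mlam; rewrite -/(U i.+1 a) -/A.
  have -> : (A^-1)%:C%C *: U i.+1 a = \sum_(r < n) (A^-1)%:C%C *: U i (a * n + r)%N.
    by rewrite -scaler_sumr; congr (_ *: _); rewrite /U expnS !mulnA S_split.
  apply: (average_levels (u := fun r => (A^-1)%:C%C *: U i (a * n + r)%N)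
    (a := fun r => p ((a * n + r) * n ^ i)) n0 mn mlam).
  - move=> r; apply: block_start_le => //; by rewrite leq_mul2r leq_add2l leqnSn orbT.
  - move=> r j; rewrite c00Z mulf_eq0 negb_or => /andP[_ /S_supp].
    by rewrite addnS.
  - move=> r rn; rewrite (NZ normN) rnorm_real gtr0_norm ?invr_gt0//.
    rewrite ler_pdivrMl// mulrA ler_pdivlMr//; have := iaP r rn; rewrite -/A.
    by lra.
have {}none i a : exists r, (r < n)%N /\ N (U i.+1 a) <= n%:R / 2 * N (U i (a * n + r)%N).
  apply: contrapT => H; apply: none; exists i, a => r rn.
  rewrite leNgt; apply/negP => /ltW rlt; apply: H; exists r; split=> //.
have Ule i a : N (U i a) <= (n%:R / 2) ^+ i.
  elim: i a => [|i IH] a.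
    by rewrite /U expn0 !muln1 /S big_nat1 y_norm expr0.
  have [r [rn H]] := none i a; apply: le_trans H _.
  by rewrite exprS ler_wpM2l ?divr_ge0.
exfalso; pose r := (Num.truncn (f n)).+1; pose J := r.*2.+1.
have fr : f n <= r%:R by apply: ltW; exact: truncnS_gt.
have H1 := Ule J 0%N; rewrite /U mul0n mul1n in H1.
have nJ : (0 < n ^ J)%N by rewrite expn_gt0 n0.
have H2 := N_S_lower nJ.
have H3 : f (n ^ J) <= (J * r)%N%:R.
  by apply: le_trans (weight_exp _ n0 _) _ => //; rewrite natrM ler_wpM2l.
have H4 : (n ^ J)%:R <= (J * r)%N%:R * (n%:R / 2) ^+ J :> R.
  apply: le_trans H2 _; apply: ler_pM => //; last by exact: N_ge0.
  by apply/ltW/weight_gt0.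
have H5 : (2 ^ J <= J * r)%N.
  rewrite -(ler_nat R); move: H4; rewrite exprMn exprVn natrX mulrCA.
  by rewrite -[X in X <= _]mulr1 ler_pM2l ?exprn_gt0// ler_pdivlMr ?exprn_gt0// mul1r natrX.
move: H5; rewrite /J -addnn expnS expnD.
have : (r < 2 ^ r)%N by rewrite ltn_expl.
move: (2 ^ r)%N => t; nia.
Qed.

End BlockSums.

End Averages.

(** * Extension to the completion *)

Section Completion.
Variables (R : realType) (N : c00 R[i] -> R).
Local Notation C := R[i].
Hypothesis normN : is_norm N.
Hypothesis eqN : schlumprecht_equation N.
Variables (S : completeNormedModType C) (iota : {linear c00 C -> S}).
Hypothesis iotaN : forall x, rnorm (iota x) = N x.
Hypothesis iota_dense : dense (range iota).

Lemma near_c00 (s : S) (d : R) : 0 < d -> exists x, rnorm (iota x - s) < d.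
Proof.
by move=> d0; have [_ [x _ <-] xs] := dense_rnorm s iota_dense d0; exists x.
Qed.

(** The value at s is characterized by the estimate
    rnorm (g x - l) <= K * rnorm (iota x - s) for all x, which makes
    uniqueness, linearity and the bound consequences of density. *)
Lemma extension (Z : completeNormedModType C) (g : c00 C -> Z) (K : R) : 0 <= K ->
  (forall a x y, g (a *: x + y) = a *: g x + g y) ->
  (forall x, rnorm (g x) <= K * N x) ->
  exists G : S -> Z, [/\ forall x, G (iota x) = g x,
    forall a s t, G (a *: s + t) = a *: G s + G t &
    forall s, rnorm (G s) <= K * rnorm s].
Proof.
move=> K0 glin gK.
have gB x y : g (x - y) = g x - g y.
  by rewrite addrC -scaleN1r glin scaleN1r addrC.
have gdist x y : rnorm (g x - g y) <= K * rnorm (iota x - iota y).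
  by rewrite -gB -linearB iotaN.
have K10 : 0 < K + 1 by lra.
have /choice[G GP] s : exists l, forall x, rnorm (g x - l) <= K * rnorm (iota x - s).
  have /choice[u us] n : exists x, rnorm (iota x - s) < 1 / 2 ^+ n.
    by apply: near_c00; rewrite divr_gt0// exprn_gt0.
  have [|l ul] := @geometric_limit R Z (fun n => g (u n)) (K * 2).
    move=> n; apply: le_trans (gdist _ _) _; rewrite -mulrA ler_wpM2l//.
    apply: le_trans (rdist_tri _ s _) _; rewrite [rnorm (s - _)]rdistC.
    have H1 := us n; have := us n.+1; rewrite exprS invfM.
    have : 0 < (2 ^+ n : R)^-1 by rewrite invr_gt0 exprn_gt0.
    by move: H1; move: (_^-1) (rnorm _) (rnorm _) => t a b; lra.
  exists l => x; apply/ler_addgt0Pr => e e0.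
  have [n ne] := geometric_small (K + 2 * (K * 2)) e0.
  apply: le_trans (rdist_tri _ (g (u n)) _) _.
  have H1 := ul n; have H2 := gdist x (u n); have H3 := us n.
  have H4 := rdist_tri (iota x) s (iota (u n)); rewrite [rnorm (s - _)]rdistC in H4.
  have H5 : K * rnorm (iota x - iota (u n)) <= K * rnorm (iota x - s) + K * (1 / 2 ^+ n).
    rewrite -mulrDr ler_wpM2l//; apply: le_trans H4 _; rewrite lerD2l; exact: ltW.
  by move: ne; rewrite mulrDl; move: H1 H2 H5; rewrite mul1r; lra.
have small (z : Z) (A B : R) : (forall d : R, 0 < d -> rnorm z <= A + B * d) -> 0 <= B -> rnorm z <= A.
  move=> H B0; apply/ler_addgt0Pr => e e0.
  have B1 : 0 < B + 1 by lra.
  apply: le_trans (H (e / (B + 1)) _) _; first by rewrite divr_gt0.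
  rewrite lerD2l mulrCA -[leRHS]mulr1 ler_wpM2l ?(ltW e0)// ler_pdivrMr//; lra.
have zero (z : Z) (B : R) : (forall d : R, 0 < d -> rnorm z <= B * d) -> 0 <= B -> z = 0.
  move=> H B0; apply/eqP; rewrite -rnorm_eq0 eq_le rnorm_ge0 andbT.
  by apply: (small z 0 B) => // d d0; rewrite add0r; exact: H.
exists G; split.
- move=> x; apply/eqP; rewrite -subr_eq0 -rnorm_eq0 eq_le rnorm_ge0 andbT rdistC.
  by have := GP (iota x) x; rewrite subrr rnorm0 mulr0.
- move=> a s t; apply/eqP; rewrite -subr_eq0; apply/eqP.
  set ra := rnorm (a : C^o); have ra0 : 0 <= ra by exact: (@rnorm_ge0 R C^o).
  apply: (@zero _ (2 * K * (ra + 1))); last by rewrite !mulr_ge0// addr_ge0.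
  move=> d d0; have [x xs] := near_c00 s d0; have [y yt] := near_c00 t d0.
  have H1 := GP (a *: s + t) (a *: x + y); have H2 := GP s x; have H3 := GP t y.
  rewrite glin in H1.
  have H4 : rnorm (iota (a *: x + y) - (a *: s + t)) <= (ra + 1) * d.
    rewrite linearP opprD addrACA -scalerBr; apply: le_trans (rnormD _ _) _.
    rewrite rnormZ mulrDl mul1r; apply: lerD; last exact: ltW.
    by rewrite ler_wpM2l// ltW.
  have -> : G (a *: s + t) - (a *: G s + G t) =
      (a *: (g x - G s) + (g y - G t)) - (a *: g x + g y - G (a *: s + t)).
    by rewrite scalerBr [in RHS]addrACA -opprD opprB [RHS]addrC subrKA.
  apply: le_trans (rnormB _ _) _.
  have H5 : rnorm (a *: (g x - G s) + (g y - G t)) <= ra * (K * d) + K * d.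
    apply: le_trans (rnormD _ _) _; rewrite rnormZ; apply: lerD.
      by rewrite ler_wpM2l//; apply: le_trans H2 _; rewrite ler_wpM2l// ltW.
    by apply: le_trans H3 _; rewrite ler_wpM2l// ltW.
  have H6 : K * rnorm (iota (a *: x + y) - (a *: s + t)) <= K * ((ra + 1) * d).
    by rewrite ler_wpM2l.
  by lra.
- move=> s; apply: (@small _ _ (2 * K)); last by rewrite mulr_ge0.
  move=> d d0; have [x xs] := near_c00 s d0.
  rewrite -(subKr (g x) (G s)); apply: le_trans (rnormB _ _) _.
  have H1 := gK x; have H2 := GP s x; have H3 := rnorm_sub_ge (iota x) s.
  rewrite iotaN in H3.
  have H4 : K * N x <= K * (rnorm s + d) by rewrite ler_wpM2l//; lra.
  have H5 : K * rnorm (iota x - s) <= K * d by rewrite ler_wpM2l// ltW.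
  by lra.
Qed.

Lemma extension_op (g : c00 C -> S) (K : R) : 0 <= K ->
  (forall a x y, g (a *: x + y) = a *: g x + g y) ->
  (forall x, rnorm (g x) <= K * N x) ->
  exists2 G : B(S), forall x, G (iota x) = g x &
    forall s, rnorm (G s) <= K * rnorm s.
Proof.
move=> K0 glin gK; have [G [GE Glin GK]] := extension K0 glin gK.
have [|G' G'E] := bop_exists Glin; first by exists K.
by exists G' => [x|s]; rewrite G'E.
Qed.

Lemma bop_ext_dense (P Q : B(S)) : (forall x, P (iota x) = Q (iota x)) -> P = Q.
Proof.
move=> PQ; apply: bop_ext => s; apply/eqP; rewrite -subr_eq0 -rnorm_eq0.
rewrite eq_le rnorm_ge0 andbT; apply/ler_addgt0Pr => e e0; rewrite add0r.
have [M M0 MPQ] := bop_bound (P - Q).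
have M1 : 0 < M + 1 by lra.
have [|x xs] := near_c00 s (d := e / (M + 1)); first by rewrite divr_gt0.
have := MPQ (s - iota x); rewrite bopB (_ : (P - Q) (iota x) = 0); last first.
  by rewrite (_ : (P - Q) (iota x) = P (iota x) - Q (iota x))// PQ subrr.
rewrite subr0 (_ : (P - Q) s = P s - Q s)// => /le_trans; apply.
apply: (@le_trans _ _ ((M + 1) * rnorm (s - iota x))).
  by rewrite ler_wpM2r ?rnorm_ge0//; lra.
by rewrite mulrC -ler_pdivlMr// rdistC ltW.
Qed.

(** The coordinate is extended as the operator x |-> x k *: e of rank one, and a
    functional norming e turns it back into a scalar. *)
Lemma coordinate_functional k : exists phi : S -> C,
  [/\ functional phi, forall x, phi (iota x) = x k &
      forall s, rnorm (phi s : C^o) <= rnorm s].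
Proof.
set e := iota (unit_vec R k).
have e0 : e != 0.
  rewrite -rnorm_eq0 iotaN; apply: contra_neqN (oner_neq0 C) => /eqP Ne.
  have [_ _ Neq0] := normN; have /(congr1 (fun x : c00 C => x k)) := Neq0 _ Ne.
  by rewrite unit_vecE eqxx.
have [chi chiF [chie chile]] := norming_functional e0.
have [|||G GE GK] := @extension_op (fun x => (x k : C) *: e) (rnorm e).
- exact: rnorm_ge0.
- by move=> a x y; rewrite c00D c00Z scalerDl scalerA.
- by move=> x; rewrite rnormZ mulrC ler_wpM2l ?rnorm_ge0// coord_le.
exists (chi \o G); split.
- exact: functional_comp.
- by move=> x /=; rewrite GE functionalZ// chie mulr1.
- move=> s /=; apply: le_trans (chile _) _.
  by rewrite ler_pdivrMr ?rnorm_gt0// mulrC.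
Qed.

End Completion.

Section Hump.
Variable R : realType.
Local Notation C := R[i].

(** Its contrapositive provides, in a subspace of infinite dimension, a common
    zero of finitely many functionals. *)
Lemma finite_dimensional_common_kernel (X : normedModType C) n (phi : nat -> X -> C)
    (V : set X) : is_subspace V -> (forall k, functional (phi k)) ->
  (forall v, V v -> (forall k, (k < n)%N -> phi k v = 0) -> v = 0) ->
  finite_dimensional V.
Proof.
move=> sV phiF; elim: n V sV => [|n IH] V sV V0.
  exists 0%N, (fun=> 0); apply/seteqP; split=> [v Vv|_ [c ->]].
    by exists (fun=> 0); rewrite big_ord0; apply: V0.
  by rewrite big_ord0; have [] := sV.
have [V00 VD] := sV.
pose V' : set X := [set v | V v /\ phi n v = 0].
have [m [e V'E]] : finite_dimensional V'.
  apply: IH.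
    split; first by split=> //; rewrite functional0.
    move=> a u v [Vu nu] [Vv nv]; split; first exact: VD.
    by rewrite functionalD// functionalZ// nu nv mulr0 addr0.
  move=> v [Vv nv] H; apply: V0 => // k; rewrite ltnS leq_eqVlt => /predU1P[->//|].
  exact: H.
have [[v0 [Vv0 nv0]]|allV'] := pselect (exists v, V v /\ phi n v != 0); last first.
  exists m, e; rewrite -V'E; apply/seteqP; split=> [v Vv|v []//]; split=> //.
  by apply/eqP; apply: contraT => nv; exfalso; apply: allV'; exists v.
exists m.+1, (fun i => oapp e v0 (unlift ord0 i)).
apply/seteqP; split=> [v Vv|_ [c ->]].
  pose a := phi n v / phi n v0.
  have : V' (v - a *: v0).
    split; first by rewrite addrC -scaleNr; exact: VD.
    by rewrite functionalB// functionalZ// divfK// subrr.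
  rewrite V'E => -[c vE].
  exists (fun i => oapp c a (unlift ord0 i)); rewrite big_ord_recl unlift_none /=.
  by under eq_bigr do rewrite liftK /=; rewrite -vE addrC subrK.
rewrite big_ord_recl unlift_none /=; apply: VD => //.
under eq_bigr do rewrite liftK.
have : V' (\sum_(i < m) c (lift ord0 i) *: e i).
  by rewrite V'E; exists (fun i => c (lift ord0 i)).
by case.
Qed.

End Hump.

(** * Blocks in subspaces *)

Section BlocksInSubspaces.
Variables (R : realType) (N : c00 R[i] -> R).
Local Notation C := R[i].
Hypothesis normN : is_norm N.
Hypothesis eqN : schlumprecht_equation N.
Variables (S : completeNormedModType C) (iota : {linear c00 C -> S}).
Hypothesis iotaN : forall x, rnorm (iota x) = N x.
Hypothesis iota_dense : dense (range iota).
Local Notation f := (@weight R).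
Local Notation T := (level_sum N).

Section Subspace.
Variable V : set S.
Hypothesis sV : is_subspace V.
Hypothesis Vinf : ~ finite_dimensional V.

Let VZ (a : C) v : V v -> V (a *: v).
Proof.
by move=> Vv; have [V0 VD] := sV; rewrite -[a *: v]addr0; exact: VD.
Qed.

Let V_sum (I : Type) (s : seq I) (P : pred I) (F : I -> S) :
  (forall i, V (F i)) -> V (\sum_(i <- s | P i) F i).
Proof.
have [V0 VD] := sV.
move=> VF; elim/big_rec: _ => // i x _ Vx.
by rewrite -[F i]scale1r; exact: VD.
Qed.

(** A vector of V whose first n coordinates vanish is approximated in c00; the
    first n coordinates of the approximation are small and can be removed. *)
Lemma sliding_hump n (d : R) : 0 < d -> exists v b,
  [/\ V v, N b = 1, forall k, (k < n)%N -> b k = 0 & rnorm (v - iota b) <= d].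
Proof.
move=> d0.
have /choice[phi phiP] := coordinate_functional normN eqN iotaN iota_dense.
have [v0 [Vv0 v00 phiv0]] : exists v, [/\ V v, v != 0 &
    forall k, (k < n)%N -> phi k v = 0].
  apply: contrapT => H; apply: Vinf.
  apply: (@finite_dimensional_common_kernel _ _ n phi) => // [k|v Vv phiv]; first by have [] := phiP k.
  by apply/eqP; apply: contraT => v0; exfalso; apply: H; exists v.
have rv0 : 0 < rnorm v0 by rewrite rnorm_gt0.
pose v1 := ((rnorm v0)^-1)%:C%C *: v0.
have v11 : rnorm v1 = 1.
  by rewrite rnormZ rnorm_real gtr0_norm ?invr_gt0// mulVf// gt_eqF.
have phiv1 k : (k < n)%N -> phi k v1 = 0.
  by move=> kn; have [phiF _ _] := phiP k; rewrite functionalZ// phiv0// mulr0.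
pose K := \sum_(k < n) N (unit_vec R k) + 1.
have K1 : 1 <= K by rewrite lerDr; apply: sumr_ge0 => k _; exact: N_ge0.
pose e := Num.min 2^-1 (d / 2) / (K + 1).
have m0 : 0 < Num.min 2^-1 (d / 2) by rewrite lt_min invr_gt0 ltr0n divr_gt0.
have e0 : 0 < e by rewrite divr_gt0//; lra.
have [x xv] := near_c00 iota_dense v1 e0.
pose b0 := restr [set k | (n <= k)%N] x.
have xb : x - b0 = \sum_(k < n) x k *: unit_vec R k.
  apply: c00_ext => i; rewrite c00B c00_sum; have [ni|ni] := ltnP i n.
    rewrite restr_out ?subr0; last by rewrite /= leqNgt ni.
    rewrite (bigD1 (Ordinal ni))// big1 ?addr0 => [|k ki]; rewrite c00Z unit_vecE /=.
      by rewrite eqxx mulr1 addr0.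
    move: ki; rewrite -(inj_eq val_inj) /= eq_sym => /negbTE ->.
    by rewrite mulr0.
  rewrite restr_in// subrr big1// => k _.
  by rewrite c00Z unit_vecE gtn_eqF ?mulr0// (leq_trans (ltn_ord k)).
have Nxb : N (x - b0) <= K * e.
  rewrite xb; apply: le_trans (N_sum normN _ _ _) _.
  apply: (@le_trans _ _ (\sum_(k < n) e * N (unit_vec R k))).
    apply: ler_sum => k _; rewrite (NZ normN) ler_wpM2r ?N_ge0//.
    have [phiF phiE phile] := phiP k; rewrite -phiE -[phi k _]subr0 -(phiv1 k)//.
    by rewrite -functionalB//; apply: le_trans (phile _) (ltW xv).
  by rewrite -big_distrr /= mulrC ler_wpM2r ?(ltW e0)// lerDl.
have vb0 : rnorm (v1 - iota b0) <= Num.min 2^-1 (d / 2).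
  apply: le_trans (rdist_tri _ (iota x) _) _; rewrite rdistC.
  have -> : Num.min 2^-1 (d / 2) = e + K * e.
    have Kn0 : K + 1 != 0 by rewrite gt_eqF//; lra.
    by rewrite /e; field.
  apply: lerD; first exact: ltW.
  by rewrite -linearB iotaN.
have Nb0 : 2^-1 <= N b0.
  have := rnorm_sub_ge v1 (v1 - iota b0); rewrite subKr iotaN v11.
  have : Num.min 2^-1 (d / 2) <= 2^-1 by rewrite ge_min lexx.
  by lra.
have Nb00 : 0 < N b0 by lra.
pose t := ((N b0)^-1)%:C%C : C.
exists (t *: v1), (t *: b0); split.
- exact/VZ/VZ.
- by rewrite (NZ normN) rnorm_real gtr0_norm ?invr_gt0// mulVf// gt_eqF.
- by move=> k kn; rewrite c00Z restr_out ?mulr0// /= leqNgt kn.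
have -> : t *: v1 - iota (t *: b0) = t *: (v1 - iota b0) by rewrite scalerBr; congr (_ - _); exact: linearZ.
rewrite rnormZ rnorm_real gtr0_norm ?invr_gt0// ler_pdivrMl//; apply: le_trans vb0 _.
apply: (@le_trans _ _ (d / 2)); first by rewrite ge_min lexx orbT.
by rewrite mulrC ler_wpM2r ?(ltW d0)//.
Qed.

(** The average of average_exists is taken over successive humps whose errors are
    summable. *)
Lemma average_in_subspace n m0 (d : R) : 0 < d -> exists v x,
  [/\ V v, N x = 1, forall k, (k < n)%N -> x k = 0,
      forall m lam, (m <= m0)%N -> labelling lam -> T m lam x <= 4 &
      rnorm (v - iota x) <= d].
Proof.
move=> d0.
have step (q s : nat) : exists o : S * c00 C, [/\ V o.1, N o.2 = 1,
    forall k, (k < maxn n s)%N -> o.2 k = 0 & rnorm (o.1 - iota o.2) <= d / 2 ^+ q.+1].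
  have [|v [b [Vv Nb b0 vb]]] := sliding_hump (maxn n s) (d := d / 2 ^+ q.+1).
    by rewrite divr_gt0// exprn_gt0.
  by exists (v, b).
have /choice[out outP] (qs : nat * nat) : exists o : S * c00 C, [/\ V o.1, N o.2 = 1,
    forall k, (k < maxn n qs.2)%N -> o.2 k = 0 & rnorm (o.1 - iota o.2) <= d / 2 ^+ qs.1.+1].
  exact: step.
have /choice[bd bdP] := @c00_bounded R.
pose p := fix p q := if q is q'.+1 then maxn (p q').+1 (bd (out (q', p q')).2) else 0%N.
pose y q := (out (q, p q)).2; pose v q := (out (q, p q)).1.
have pS q : (p q < p q.+1)%N by rewrite /= leq_maxl.
have y_supp q i : y q i != 0 -> (p q <= i < p q.+1)%N.
  have [_ _ y0 _] := outP (q, p q) => yi; apply/andP; split.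
    rewrite leqNgt; apply: contra yi => ip.
    by apply/eqP; apply: y0; rewrite leq_max /= ip orbT.
  rewrite ltnNge; apply: contra yi => pi; apply/eqP; apply: bdP.
  by apply: leq_trans pi; rewrite /= leq_maxr.
have y_norm q : N (y q) = 1 by have [] := outP (q, p q).
have [a [b [ab avg]]] := average_exists normN eqN (erefl (p 0)) pS y_supp y_norm (ltn0Sn m0).
set A := N _ in avg.
have A1 : 1 <= A.
  rewrite /A -(y_norm a); apply: (N_le_coord normN eqN) => i.
  have [->|yi] := eqVneq (y a i) 0; first by rewrite (@rnorm0 R C^o) rnorm_ge0.
  rewrite c00_sum (bigD1_seq a)/= ?mem_index_iota ?iota_uniq ?leqnn//.
  rewrite big1_seq ?addr0// => l /andP[la _]; apply/eqP; apply: contraT => /y_supp li.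
  by move: la; rewrite (block_unique pS li (y_supp _ _ yi)) eqxx.
have A0 : 0 < A by lra.
exists ((A^-1)%:C%C *: \sum_(a <= q < b) v q), ((A^-1)%:C%C *: \sum_(a <= q < b) y q).
split.
- by apply: VZ; apply: V_sum => q; have [] := outP (q, p q).
- by rewrite (NZ normN) rnorm_real gtr0_norm ?invr_gt0// mulVf// gt_eqF.
- move=> k kn; rewrite c00Z c00_sum big1 ?mulr0// => q _.
  by have [_ _ + _] := outP (q, p q); apply; rewrite leq_max kn.
- by move=> m lam mm mlam; apply: avg => //; exact: leqW.
have -> : (A^-1)%:C%C *: \sum_(a <= q < b) v q - iota ((A^-1)%:C%C *: \sum_(a <= q < b) y q) =
    (A^-1)%:C%C *: (\sum_(a <= q < b) v q - iota (\sum_(a <= q < b) y q)).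
  by rewrite scalerBr; congr (_ - _); exact: linearZ.
rewrite rnormZ rnorm_real gtr0_norm ?invr_gt0// ler_pdivrMl//.
apply: (@le_trans _ _ d); last by rewrite ler_peMl// ltW.
rewrite linear_sum -sumrB; apply: le_trans (rnorm_sum _ _ _) _.
apply: (@le_trans _ _ (\sum_(a <= q < b) d / 2 ^+ q.+1)).
  by apply: ler_sum => q _; have [] := outP (q, p q).
have -> : \sum_(a <= q < b) d / 2 ^+ q.+1 = d / 2 ^+ a - d / 2 ^+ b.
  have := telescope_sumr (fun q => - (d / 2 ^+ q)) (ltnW ab).
  rewrite opprK addrC => <-; apply: eq_bigr => q _.
  rewrite exprS invfM; have : (2 : R) ^+ q != 0 by rewrite expf_neq0.
  by move: (2 ^+ q) => u u0; field.
have b0 : 0 <= d / 2 ^+ b by rewrite divr_ge0 ?exprn_ge0// ltW.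
have a0 : d / 2 ^+ a <= d.
  rewrite ler_pdivrMr ?exprn_gt0// ler_peMr ?(ltW d0)//.
  by rewrite exprn_ege1// ler1n.
by lra.
Qed.

Lemma good_blocks_in_subspace : exists (v : nat -> S) (x : nat -> c00 C)
    (p : nat -> nat) (L : nat -> R) (M : nat -> nat),
  [/\ (p 0 = 0%N /\ (forall k, (p k < p k.+1)%N)) /\
      (forall k i, x k i != 0 -> (p k <= i < p k.+1)%N),
      forall k, N (x k) = 1,
      (forall k m lam, T m lam (x k) <= L k) /\
      (forall k m lam, (m < M k)%N -> labelling lam -> T m lam (x k) <= 4),
      (forall k l, (k <= l)%N -> (M k <= M l)%N) /\
      (forall m, exists k, (m < M k)%N) /\
      (forall k, \sum_(l < k) L l <= f (M k)) &
      forall k, V (v k) /\ rnorm (v k - iota (x k)) <= 4^-1 / 2 ^+ k].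
Proof.
have /choice[Lf LfP] := level_sum_bounded normN eqN.
have /choice[bd bdP] := @c00_bounded R.
have /choice[w wP] := @weight_unbounded R.
(* The state before step k consists of the start of the k-th block, of M k and
   of the total size of the preceding blocks. *)
pose St := (nat * nat * R)%type.
have /choice[out outP] (ks : nat * St) : exists o : S * c00 C,
    [/\ V o.1, N o.2 = 1, forall i, (i < ks.2.1.1)%N -> o.2 i = 0,
      forall m lam, (m <= ks.2.1.2)%N -> labelling lam -> T m lam o.2 <= 4 &
      rnorm (o.1 - iota o.2) <= 4^-1 / 2 ^+ ks.1].
  have [|v [x [Vv Nx x0 xT vx]]] := average_in_subspace ks.2.1.1 ks.2.1.2 (d := 4^-1 / 2 ^+ ks.1).
    by rewrite divr_gt0 ?exprn_gt0.
  by exists (v, x).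
pose next k (st : St) : St :=
  let x := (out (k, st)).2 in
  (maxn st.1.1.+1 (bd x), maxn st.1.2.+1 (w (st.2 + Lf x)), st.2 + Lf x).
pose st := fix st k := if k is k'.+1 then next k' (st k') else (0%N, 0%N, 0) : St.
pose v k := (out (k, st k)).1; pose x k := (out (k, st k)).2.
pose p k := (st k).1.1; pose M k := (st k).1.2; pose L k := Lf (x k).
have stL k : (st k).2 = \sum_(l < k) L l.
  by elim: k => [|k IH]; rewrite ?big_ord0// big_ord_recr /= IH.
have pS k : (p k < p k.+1)%N by rewrite /p /= leq_maxl.
have MS k : (M k < M k.+1)%N by rewrite /M /= leq_maxl.
exists v, x, p, L, M; split; first split=> //.
- move=> k i; have [_ _ x0 _ _] := outP (k, st k) => xi; apply/andP; split.
    by rewrite leqNgt; apply: contra xi => ip; apply/eqP; apply: x0.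
  rewrite ltnNge; apply: contra xi => pi; apply/eqP; apply: bdP.
  by apply: leq_trans pi; rewrite /p /= leq_maxr.
- by move=> k; have [] := outP (k, st k).
- split=> [k m lam|k m lam mM mlam]; first exact: LfP.
  by have [_ _ _ + _] := outP (k, st k); apply=> //; exact: ltnW.
- split; last split.
  + move=> k l /subnKC <-; elim: (l - k)%N => [|j IH]; first by rewrite addn0.
    by rewrite addnS; exact: leq_trans IH (ltnW (MS _)).
  + have kM k : (k <= M k)%N by elim: k => // k IH; exact: leq_ltn_trans IH (MS k).
    by move=> m; exists m.+1; exact: kM.
  + case=> [|k]; first by rewrite big_ord0 /weight addr0 /log2 ln1 mul0r.
    rewrite -stL /M /=; apply: le_trans (wP _) _.
    by apply: weight_le; rewrite leq_maxr.
- by move=> k; have [] := outP (k, st k).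
Qed.

End Subspace.
End BlocksInSubspaces.

(** * Schlumprecht's space *)

Section SchlumprechtSpace.
Variables (R : realType) (N : c00 R[i] -> R).
Local Notation C := R[i].
Hypothesis normN : is_norm N.
Hypothesis eqN : schlumprecht_equation N.
Variables (S : completeNormedModType C) (iota : {linear c00 C -> S}).
Hypothesis iotaN : forall x, rnorm (iota x) = N x.
Hypothesis iota_dense : dense (range iota).
Local Notation f := (@weight R).

Lemma iota_lincomb (x : nat -> c00 C) (a : c00 C) :
  iota (lincomb x a) = lincomb (fun k => iota (x k)) a.
Proof.
have [D aD] := c00_bounded a; rewrite !(lincombE _ aD) linear_sum.
by apply: eq_bigr => k _; exact: linearZ.
Qed.

Lemma lincomb_small (w : nat -> S) (c : R) (a : c00 C) : 0 <= c ->
  (forall k, rnorm (w k) <= c / 2 ^+ k) -> rnorm (lincomb w a) <= 2 * c * N a.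
Proof.
move=> c0 wc; have [D aD] := c00_bounded a; rewrite (lincombE _ aD).
apply: le_trans (rnorm_sum _ _ _) _.
apply: (@le_trans _ _ (\sum_(k < D) c / 2 ^+ k * N a)).
  apply: ler_sum => k _; rewrite rnormZ mulrC.
  by apply: ler_pM; rewrite ?rnorm_ge0// ?(@rnorm_ge0 R C^o)// coord_le.
rewrite -big_distrl /= ler_wpM2r ?N_ge0//.
suff -> : \sum_(k < D) c / 2 ^+ k = 2 * c - 2 * c / 2 ^+ D.
  by rewrite gerBl divr_ge0 ?mulr_ge0 ?exprn_ge0.
elim: D {aD} => [|D IH]; first by rewrite big_ord0 expr0 divr1 subrr.
rewrite big_ord_recr /= IH exprS invfM; have : (2 : R) ^+ D != 0 by rewrite expf_neq0.
by move: (2 ^+ D) => u u0; field.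
Qed.

(** The blocks x k of good_blocks_in_subspace are dominated by the unit vectors,
    so e k |-> x k extends to an operator T0, and e k |-> v k to a small
    perturbation T1 of T0 with values in V. A left inverse Q of T0 applies to y
    the functionals norming x k, restricted to the support of x k; the resulting
    sequence is dominated by y according to block_comparison. *)
Theorem schlumprecht_complementably_minimal : complementably_minimal S.
Proof.
move=> V cV sV Vinf; have [V0 VD] := sV.
have [v [x [p [L [M [[[p0 pS] xsupp] x1 [xL xM] [Mmono [Munb LM]] vx]]]]]] :=
  good_blocks_in_subspace normN eqN iotaN iota_dense sV Vinf.
have [K dom] : exists K : R, forall b, N (lincomb x b) <= K * N b.
  apply: (block_domination normN eqN p0 pS xsupp _ _ xM Mmono Munb LM) => k.
    by rewrite x1.
  by move=> m lam _; exact: xL.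
have comb_coord := combE pS xsupp.
have [T0 T0E T0K] : exists2 T0 : B(S), forall a, T0 (iota a) = iota (lincomb x a) &
    forall s, rnorm (T0 s) <= `|K| * rnorm s.
  apply: (extension_op iotaN iota_dense) => //.
    by move=> a b c; rewrite lincombP linearP.
  move=> a; rewrite iotaN; apply: le_trans (dom a) _.
  by rewrite ler_wpM2r ?N_ge0// ler_norm.
pose w k := v k - iota (x k).
have [H HE HK] : exists2 H : B(S), forall a, H (iota a) = lincomb w a &
    forall s, rnorm (H s) <= 2^-1 * rnorm s.
  apply: (extension_op iotaN iota_dense); first by rewrite invr_ge0.
    by move=> a b c; rewrite lincombP.
  have -> : 2^-1 = 2 * 4^-1 :> R by lra.
  move=> a; apply: lincomb_small; first by rewrite invr_ge0.
  by move=> k; have [] := vx k.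
pose G k : set nat := [set i | (p k <= i < p k.+1)%N].
have /choice[chi chiP] k : exists phi : S -> C, [/\ functional phi,
    phi (iota (x k)) = 1 & forall s, rnorm (phi s : C^o) <= rnorm s].
  have xk0 : iota (x k) != 0 by rewrite -rnorm_gt0 iotaN x1.
  have [phi phiF [phix phile]] := norming_functional xk0.
  by exists phi; split=> // s; have := phile s; rewrite iotaN x1 divr1.
pose ph k (y : c00 C) := chi k (iota (restr (G k) y)).
have phP k a y y' : ph k (a *: y + y') = a * ph k y + ph k y'.
  have [phiF _ _] := chiP k.
  by rewrite /ph restrP linearP functionalD// functionalZ.
have kp k : (k <= p k)%N.
  by elim: k => // k IH; exact: leq_ltn_trans IH (pS k).
have /choice[P PE] y : exists y' : c00 C, forall k, y' k = ph k y.
  have [D yD] := c00_bounded y; apply: (@c00_exists _ _ D) => k Dk.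
  rewrite /ph restr_eq0 ?linear0 ?(functional0 (let: And3 h _ _ := chiP k in h))//.
  move=> i /andP[ki _]; apply: yD; exact: leq_trans Dk (leq_trans (kp k) ki).
have [Q QE QK] : exists2 Q : B(S), forall y, Q (iota y) = iota (P y) &
    forall s, rnorm (Q s) <= 1 * rnorm s.
  apply: (extension_op iotaN iota_dense) => //.
    move=> a y y'; rewrite -linearP; congr (iota _); apply: c00_ext => k.
    by rewrite c00D c00Z !PE phP.
  move=> y; rewrite iotaN mul1r; apply: (block_comparison normN eqN (G := G)).
  - by move=> k; exists (p k); rewrite /G /= leqnn pS.
  - move=> k l i j kl /andP[_ ik] /andP[lj _]; apply: leq_trans ik _.
    exact: leq_trans (block_start_le pS kl) lj.
  - by move=> k; rewrite PE -iotaN; have [_ _] := chiP k; apply.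
have QT0 : Q * T0 = 1.
  apply: (bop_ext_dense iota_dense) => a; rewrite -[LHS]/(Q (T0 (iota a))) T0E QE.
  congr (iota _); apply: c00_ext => k; rewrite PE /ph.
  have [phiF phix _] := chiP k.
  have -> : restr (G k) (lincomb x a) = a k *: x k.
    apply: c00_ext => i; rewrite c00Z; have [ki|ki] := pselect (G k i).
      by rewrite restr_in// (comb_coord a i k).
    rewrite restr_out//; apply/esym/eqP; rewrite mulf_eq0; apply/orP; right.
    by apply: contraT => /xsupp.
  by rewrite linearZ /= functionalZ// phix mulr1.
pose T1 := T0 + H.
have [W [WQT QTW]] : invertible (Q * T1).
  rewrite mulrDr QT0 -[Q * H]opprK; apply: neumann => s.
  rewrite (_ : (- (Q * H)) s = - Q (H s))// rnormN.
  by apply: le_trans (QK _) _; rewrite mul1r.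
have T1V s : V (T1 s).
  apply: closed_rnorm => // d d0; have [B B0 BT] := bop_bound T1.
  have B1 : 0 < B + 1 by lra.
  have [|a as_] := near_c00 iota_dense s (d := d / (B + 1)); first by rewrite divr_gt0.
  exists (T1 (iota a)).
    have [D aD] := c00_bounded a.
    have -> : T1 (iota a) = \sum_(k < D) a k *: v k.
      rewrite (_ : T1 (iota a) = T0 (iota a) + H (iota a))// T0E HE iota_lincomb.
      rewrite !(lincombE _ aD) -big_split /=; apply: eq_bigr => k _.
      by rewrite -scalerDr /w addrC subrK.
    elim/big_rec: _ => // k y _ Vy; apply: VD => //.
    by have [] := vx k.
  rewrite -bopB; apply: le_lt_trans (BT _) _.
  apply: (@le_lt_trans _ _ ((B + 1) * rnorm (iota a - s))).
    by rewrite ler_wpM2r ?rnorm_ge0//; lra.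
  by rewrite mulrC -ltr_pdivlMr.
have WQTx s : W (Q (T1 s)) = s by rewrite -[LHS]/((W * (Q * T1)) s) WQT.
exists (range T1); split.
- by move=> _ [s _ <-].
- exists (T1 * (W * Q)); split.
    apply: bop_ext => s; rewrite -[LHS]/(T1 (W (Q (T1 (W (Q s)))))).
    by rewrite WQTx.
  apply/seteqP; split=> [_ [s _ <-]|_ [s _ <-]]; first by exists (W (Q s)).
  by exists (T1 s) => //; rewrite -[LHS]/(T1 (W (Q (T1 s)))) WQTx.
pose T1l : {linear S -> S} := HB.pack (bop_fun T1)
  (GRing.isLinear.Build C S S *:%R (bop_fun T1) (bopP T1)).
exists T1l, (W * Q); split=> //.
- exact: bop_continuous.
- by apply: continuous_subspaceT; exact: bop_continuous.
Qed.

Section Spread.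
Variable sigma : nat -> nat.
Hypothesis sg : forall k l, (k < l)%N -> (sigma k < sigma l)%N.
Local Notation sp := (lincomb (fun k => unit_vec R (sigma k))).

Lemma spread_inj : injective sigma.
Proof.
move=> k l kl; have [lt|lt|//] := ltngtP k l.
  by have := sg lt; rewrite kl ltnn.
by have := sg lt; rewrite kl ltnn.
Qed.

Lemma spreadE (b : c00 C) k : sp b (sigma k) = b k.
Proof.
have [D bD] := c00_bounded b; rewrite (lincombE _ bD) c00_sum.
have [kD|Dk] := ltnP k D.
  rewrite (bigD1 (Ordinal kD))// big1 => [|l lk]; rewrite c00Z unit_vecE /=.
    by rewrite eqxx mulr1 addr0.
  move: lk; rewrite -(inj_eq val_inj) /= (inj_eq spread_inj) eq_sym => /negbTE ->.
  by rewrite mulr0.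
rewrite bD// big1// => l _; rewrite c00Z unit_vecE (inj_eq spread_inj) gtn_eqF ?mulr0//.
exact: leq_trans (ltn_ord l) Dk.
Qed.

Lemma spread0 (b : c00 C) i : (forall k, sigma k != i) -> sp b i = 0.
Proof.
move=> ni; have [D bD] := c00_bounded b; rewrite (lincombE _ bD) c00_sum.
by rewrite big1// => l _; rewrite c00Z unit_vecE eq_sym (negbTE (ni l)) mulr0.
Qed.

(** Partitions for sp a pull back along sigma to partitions for a; the induction
    on the support is the one of the comparison principle. *)
Lemma spread_le (a : c00 C) : N (sp a) <= N a.
Proof.
have spE := spreadE; have sp0 := spread0.
have spR b A : restr A (sp b) = sp (restr (sigma @^-1` A) b).
  apply: c00_ext => i; have [[k <-]|nk] := pselect (exists k, sigma k = i).
    rewrite spE; have [Ak|Ak] := pselect (A (sigma k)).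
      by rewrite !restr_in// spE.
    by rewrite !restr_out.
  have ni k : sigma k != i by apply/eqP => ki; apply: nk; exists k.
  by rewrite /= !sp0// if_same.
have [D aD] := c00_bounded a.
have : forall k, a k != 0 -> k \in seq.iota 0 D.
  by move=> k ak; rewrite mem_iota /= ltnNge; apply: contra ak => /aD ->.
move: (seq.iota 0 D) => s; have [n sn] : exists n, (size s <= n)%N by exists (size s).
elim: n s sn a {D aD} => [|n IH] s sn a sa.
  have -> : sp a = 0; last by rewrite N0// N_ge0.
  have a0 k : a k = 0.
    by apply/eqP; apply: contraT => /sa; case: (s) sn.
  apply: c00_ext => i; have [[k <-]|nk] := pselect (exists k, sigma k = i).
    by rewrite spE a0.
  by rewrite sp0// => k; apply/eqP => ki; apply: nk; exists k.
have Na0 : 0 <= N a by exact: N_ge0.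
have Nsp0 : 0 <= N (sp a) by exact: N_ge0.
suff : N (sp a) <= Num.max (N a) (2 / 3 * N (sp a)).
  by rewrite le_max => /orP[//|]; lra.
apply: (norm_le_levels normN eqN) => [i|m lam m2 mlam].
  rewrite le_max; apply/orP; left.
  have [[k <-]|nk] := pselect (exists k, sigma k = i).
    by rewrite spE; exact: coord_le.
  by rewrite sp0 ?(@rnorm0 R C^o)// => k; apply/eqP => ki; apply: nk; exists k.
have fm : 3 / 2 <= f m by exact: weight_ge_3half.
have m0 : (0 < m)%N by exact: ltnW.
pose A j : set nat := level (lam \o sigma) j.
have spA j : restr (level lam j) (sp a) = sp (restr (A j) a) by rewrite spR.
rewrite /level_sum; under eq_bigr do rewrite spA.
have [[j Aj]|nA] := pselect (exists j : 'I_m, forall k, a k != 0 -> A j k).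
  rewrite (bigD1 j)//= big1 ?addr0.
    rewrite restr_id//; apply: (@le_trans _ _ (f m * (2 / 3 * N (sp a)))).
      by rewrite mulrA -[leLHS]mul1r ler_wpM2r//; lra.
    by rewrite ler_wpM2l ?le_max ?lexx ?orbT//; lra.
  move=> i ij; rewrite -spA; apply: (N_restr0 normN) => l; rewrite /level /= => li.
  have [[k kl]|nk] := pselect (exists k, sigma k = l); last first.
    by rewrite sp0// => k; apply/eqP => kl; apply: nk; exists k.
  rewrite -kl spE; apply/eqP; apply: contraT => /Aj; rewrite /A /level /= kl => lj.
  by move: ij; rewrite -(inj_eq val_inj) /= -lj -li eqxx.
apply: (@le_trans _ _ (f m * N a)); last first.
  by rewrite ler_wpM2l ?le_max ?lexx//; lra.
have mls : labelling (lam \o sigma).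
  move=> k l; rewrite leq_eqVlt => /predU1P[->//|kl].
  by apply: mlam; exact/ltnW/sg.
apply: le_trans (level_sum_le normN eqN a m0 mls); apply: ler_sum => j _.
have [k [ak Ajk]] : exists k, a k != 0 /\ ~ A j k.
  apply: contrapT => H; apply: nA; exists j => k ak; apply: contrapT => Ajk.
  by apply: H; exists k.
apply: (IH (rem k s)).
  by rewrite size_rem ?sa//; move: sn; case: (size s).
move=> l; have [Al|Al] := pselect (A j l); last by rewrite restr_out ?eqxx.
rewrite restr_in// => al; have := sa l al.
rewrite (perm_mem (perm_to_rem (sa k ak))) inE => /predU1P[lk|//].
by rewrite lk in Al.
Qed.

Lemma spread_operators : exists (U U' : B(S)) (P : c00 C -> c00 C),
  [/\ forall a, U (iota a) = iota (sp a), forall a, U' (iota a) = iota (P a) &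
      forall a k, P a k = a (sigma k)].
Proof.
have [U UE _] : exists2 U : B(S), forall a, U (iota a) = iota (sp a) &
    forall s, rnorm (U s) <= 1 * rnorm s.
  apply: (extension_op iotaN iota_dense) => //.
    by move=> t a b; rewrite lincombP linearP.
  by move=> a; rewrite iotaN mul1r; exact: spread_le.
have sigma_ge k : (k <= sigma k)%N.
  by elim: k => // k IH; apply: leq_ltn_trans IH (sg (ltnSn k)).
have /choice[P PE] : forall a : c00 C, exists b : c00 C, forall k, b k = a (sigma k).
  move=> a; have [D aD] := c00_bounded a; apply: (@c00_exists _ _ D) => k Dk.
  by apply: aD; exact: leq_trans Dk (sigma_ge k).
have [U' U'E _] : exists2 U' : B(S), forall a, U' (iota a) = iota (P a) &
    forall s, rnorm (U' s) <= 1 * rnorm s.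
  apply: (extension_op iotaN iota_dense) => //.
    move=> t a b; rewrite -linearP; congr (iota _); apply: c00_ext => k.
    by rewrite c00D c00Z !PE c00D c00Z.
  move=> a; rewrite iotaN mul1r.
  apply: (block_comparison normN eqN (G := fun k => [set sigma k])).
  - by move=> k; exists (sigma k).
  - by move=> k l i j kl /= -> ->; exact: sg.
  - by move=> k; rewrite PE; apply: le_trans (coord_le eqN _ (sigma k)); rewrite restr_in.
by exists U, U', P.
Qed.

End Spread.

(** The two factors are carried by the even and by the odd integers. *)
Lemma schlumprecht_square : isomorphic_to_subspace (S * S)%type [set: S].
Proof.
have evS k l : (k < l)%N -> (k.*2 < l.*2)%N by rewrite ltn_double.
have odS k l : (k < l)%N -> (k.*2.+1 < l.*2.+1)%N by rewrite ltnS ltn_double.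
have evod k l : k.*2 != l.*2.+1.
  by apply/eqP => /(congr1 odd); rewrite /= !odd_double.
have [E [E' [P [EE E'E PE]]]] := spread_operators evS.
have [F [F' [Q [FE F'E QE]]]] := spread_operators odS.
have spodd (a : c00 C) k : lincomb (fun k => unit_vec R k.*2) a k.*2.+1 = 0.
  by apply: (spread0 (sigma := fun k => k.*2)) => l; exact: evod.
have speven (a : c00 C) k : lincomb (fun k => unit_vec R k.*2.+1) a k.*2 = 0.
  by apply: (spread0 (sigma := fun k => k.*2.+1)) => l; rewrite eq_sym evod.
have E'E1 : E' * E = 1.
  apply: (bop_ext_dense iota_dense) => a; rewrite -[LHS]/(E' (E (iota a))) EE E'E.
  by congr (iota _); apply: c00_ext => k; rewrite PE (spreadE evS).
have F'F1 : F' * F = 1.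
  apply: (bop_ext_dense iota_dense) => a; rewrite -[LHS]/(F' (F (iota a))) FE F'E.
  by congr (iota _); apply: c00_ext => k; rewrite QE (spreadE odS).
have E'F0 : E' * F = 0.
  apply: (bop_ext_dense iota_dense) => a; rewrite -[LHS]/(E' (F (iota a))) FE E'E.
  rewrite (_ : P _ = 0) ?linear0//; apply: c00_ext => k.
  by rewrite PE speven.
have F'E0 : F' * E = 0.
  apply: (bop_ext_dense iota_dense) => a; rewrite -[LHS]/(F' (E (iota a))) EE F'E.
  rewrite (_ : Q _ = 0) ?linear0//; apply: c00_ext => k.
  by rewrite QE spodd.
have EF1 : E * E' + F * F' = 1.
  apply: (bop_ext_dense iota_dense) => a.
  rewrite -[LHS]/(E (E' (iota a)) + F (F' (iota a))) E'E F'E EE FE -linearD.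
  congr (iota _); apply: c00_ext => i; rewrite c00D -(odd_double_half i).
  case: (odd i); rewrite ?add1n ?add0n.
    by rewrite spodd (spreadE odS) QE add0r.
  by rewrite speven (spreadE evS) PE addr0.
pose J (z : (S * S)%type) := E z.1 + F z.2.
have Jlin (a : C) (y z : (S * S)%type) : J (a *: y + z) = a *: J y + J z.
  by rewrite /J !bopP scalerDr addrACA.
pose Jl : {linear (S * S)%type -> S} := HB.pack J
  (GRing.isLinear.Build C (S * S)%type S *:%R J Jlin).
pose inv (s : S) : (S * S)%type := (E' s, F' s).
have mulE (A B : B(S)) s : A (B s) = (A * B) s by [].
have Jinv s : J (inv s) = s.
  by rewrite /J /= !mulE -[LHS]/((E * E' + F * F') s) EF1.
have invJ z : inv (J z) = z.
  rewrite /inv /J !bopD !mulE E'E1 F'F1 E'F0 F'E0.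
  by case: z => z1 z2; congr (_, _); rewrite ?addr0 ?add0r.
exists Jl, inv; split=> //.
- have [M M0 ME] := bop_bound E; have [M' M'0 MF] := bop_bound F.
  apply: (@bounded_continuous R _ _ J (M + M')) => [y z|z].
    by rewrite /J !bopB opprD addrACA.
  have [z1 z2] := rnorm_pair_ge z; apply: le_trans (rnormD _ _) _; rewrite mulrDl.
  apply: lerD; first by apply: le_trans (ME _) _; rewrite ler_wpM2l.
  by apply: le_trans (MF _) _; rewrite ler_wpM2l.
- by apply/seteqP; split=> // s _; exists (inv s) => //; exact: Jinv.
- apply: continuous_subspaceT; have [M M0 ME] := bop_bound E'; have [M' M'0 MF] := bop_bound F'.
  apply: (@bounded_continuous R _ _ inv (M + M')) => [y z|s].
    by rewrite /inv !bopB.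
  by apply: le_trans (rnorm_pair_le _ _) _; rewrite mulrDl lerD.
Qed.

Lemma schlumprecht_SHAI : SHAI S.
Proof.
apply: complementably_minimal_SHAI; first exact: schlumprecht_complementably_minimal.
exists setT; split; last exact: schlumprecht_square.
exists 1; split; first by rewrite mulr1.
by apply/seteqP; split=> // s _; exists s.
Qed.

End SchlumprechtSpace.

Theorem theorem1p4 (R : realType) :
  (forall X : completeNormedModType R[i],
     complementably_minimal X ->
     (exists W : set X,
        complemented W /\ isomorphic_to_subspace (X * X)%type W) ->
     SHAI X) /\
  (forall S : completeNormedModType R[i],
     is_schlumprecht_space S -> SHAI S).
Proof.
split; first exact: complementably_minimal_SHAI.
move=> S [N [normN eqN [iota [iotaN iota_dense]]]].
exact: (schlumprecht_SHAI normN eqN iotaN iota_dense).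
Qed.
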